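(* There is a compactification $L$ of $\omega$ such that (1) $L\setminus\omega$ is non-separable and supports a measure, and (2) the natural copy of $c_0$ is complemented in $C(L)$. If $\mathrm{add}(\mathcal{N})=\mathrm{non}(\mathcal{M})$, then we can additionally require that $L\setminus\omega$ does not map continuously onto $[0,1]^{\omega_1}$, and that every isomorphic copy of $c_0$ in $C(L)$ contains a further copy of $c_0$ which is complemented in $C(L)$ (that is, $C(L)$ is hereditarily separably Sobczyk).
   Context: $\mathcal{N}$ is the $\sigma$-ideal of Lebesgue null sets and $\mathcal{M}$ is the $\sigma$-ideal of meager sets (of reals). For an ideal $\mathcal{I}$ of subsets of a set $X$: $\mathrm{add}(\mathcal{I})=\min\{|\mathcal{A}|: \mathcal{A}\subseteq\mathcal{I},\ \bigcup\mathcal{A}\notin\mathcal{I}\}$ and $\mathrm{non}(\mathcal{I})=\min\{|Y|: Y\subseteq X,\ Y\notin\mathcal{I}\}$. A compactification of $\omega$ (with the discrete topology) is a compact (Hausdorff) space $L\supseteq\omega$ in which $\omega$ is a dense (discrete) subspace. A compact space $K$ supports a measure if there is a (finite Radon) measure $\mu$ on $K$ with $\mu(U)>0$ for every nonempty open $U\subseteq K$. $C(L)$ is the Banach space of continuous real-valued functions on $L$ with the supremum norm. The natural copy of $c_0$ in $C(L)$ is the subspace $\{f\in C(L): f(x)=0 \text{ for all } x\in L\setminus\omega\}$. A closed subspace $Y$ of a Banach space $X$ is complemented in $X$ if there is a (bounded linear) projection $p\colon X\to X$ with $p[X]=Y$. *)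

(* Defs.v *)
From HB Require Import structures.
From mathcomp Require Import all_boot all_order all_algebra.
From mathcomp Require Import all_classical all_reals all_analysis.
From mathcomp Require wochoice.

Set Implicit Arguments.
Unset Strict Implicit.
Unset Printing Implicit Defensive.

Import Order.TTheory GRing.Theory Num.Theory.
Import numFieldNormedType.Exports.

Local Open Scope classical_set_scope.
Local Open Scope ring_scope.
Local Open Scope card_scope.

Section CardinalInvariants.
Context {X : Type}.
Implicit Type I : set (set X).

Definition attains_add I (A : set (set X)) :=
  [/\ A `<=` I, ~ I (\bigcup_(B in A) B) &
      forall A' : set (set X),
        A' `<=` I -> ~ I (\bigcup_(B in A') B) -> A #<= A'].

Definition attains_non I (Y : set X) :=
  ~ I Y /\ forall Y' : set X, ~ I Y' -> Y #<= Y'.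

(* add(I) = non(J), the cardinals being represented by sets realizing the two
   minima. *)
Definition add_eq_non I J :=
  exists (A : set (set X)) (Y : set X),
    [/\ attains_add I A, attains_non J Y & A #= Y].

End CardinalInvariants.

Definition null_ideal (R : realType) : set (set R) :=
  [set A | (@lebesgue_measure R).-negligible A].

Arguments null_ideal R _ : clear implicits.

Definition nowhere_dense (T : topologicalType) (A : set T) :=
  interior (closure A) = set0.

Definition meager_ideal (R : realType) : set (set R) :=
  [set A | exists2 F : nat -> set R,
     forall n, nowhere_dense (F n) & A = \bigcup_n F n].

Arguments meager_ideal R _ : clear implicits.

(* Up to isomorphism, omega_1 is the unique uncountable well-order all of whose
   initial segments are countable. *)
Definition is_omega1 (W : Type) (le : rel W) :=
  [/\ wochoice.well_order le, ~ countable [set: W] &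
      forall w, countable [set v | le v w]].

Lemma omega1_exists : exists (W : Type) (le : rel W), is_omega1 le.
Proof.
pose T := set nat.
have ncT : ~ countable [set: T].
  move=> cT; have /pcard_injP[f] : [set: T] #<= [set: nat] by [].
  move=> /(_ _ _ (in_setT _) (in_setT _)) finj.
  have fi : injective f by move=> x y; exact: finj.
  pose D : set nat := [set n | exists2 A, f A = n & ~ A n].
  have [Dn|Dn] := pselect (D (f D)).
    by case: (Dn) => A /fi ->.
  by apply: (Dn); exists D.
have [le wo] := wochoice.well_ordering_principle T.
have [cs|] := pselect (forall w : T, countable [set v | le v w]).
  by exists T, le; split.
move=> /existsNP[w0 nw0].
have [w [[/asboolP nw wmin] _]] :
    exists! z, wochoice.minimum_of le
      [pred w | `[< ~ countable [set v | le v w] >]] z.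
  by apply: wo; exists w0; exact/asboolP.
have wc : wochoice.wo_chain le predT by move=> A _; exact: wo.
have lr x : le x x by exact: (wochoice.wo_chain_reflexive wc).
have la x y : le x y -> le y x -> x = y.
  by move=> xy yx; apply: (wochoice.wo_chain_antisymmetric wc) => //; rewrite xy.
pose S : set T := [set v | le v w /\ v <> w].
have ncS : ~ countable S.
  move=> cS; apply: nw.
  have -> : [set v | le v w] = S `|` [set w].
    apply/seteqP; split => [v /= vw|v [[]//|->//=]].
    by have [->|vw'] := pselect (v = w); [right|left].
  apply: (@sub_countable _ _ _ (\bigcup_(b in [set: bool]) if b then S else [set w])).
    apply: subset_card_le => v [Sv|vw]; [by exists true|by exists false].
  by apply: bigcup_countable => // -[] _; [exact: cS|exact: countable1].
exists (set_type S), (fun x y => le (val x) (val y)); split.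
- move=> A [x xA].
  pose B : {pred T} := [pred v | `[< exists2 y : set_type S, y \in A & val y = v >]].
  have [z [[zB zmin] zu]] : exists! z, wochoice.minimum_of le B z.
    by apply: wo; exists (val x); apply/asboolP; exists x.
  have /asboolP[y yA yz] := zB; exists y; split.
    split=> // t tA; rewrite yz; apply: zmin.
    by apply/asboolP; exists t.
  move=> t [tA tmin]; apply: val_inj; rewrite yz; apply: zu; split.
    by apply/asboolP; exists t.
  by move=> v /asboolP[s sA <-]; exact: tmin.
- move=> cW; apply: ncS.
  have -> : S = set_val @` [set: set_type S].
    apply/seteqP; split=> [v Sv|_ [v _ <-]]; last exact/set_mem/valP.
    by exists (SigSub (mem_set Sv)).
  exact: card_le_trans (card_image_le _ _) cW.
- move=> v; have [vw vnw] := set_mem (valP v).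
  have cv : countable [set t | le t (val v)].
    apply: contrapT => nv; apply: vnw; apply: la => //.
    by apply: wmin; exact/asboolP. 
  have /pcard_injP[f finj] := cv.
  apply/pcard_injP; exists (f \o val) => x y; rewrite !inE /= => xv yv exy.
  by apply: val_inj; apply: finj => //; rewrite inE.
Qed.

Section SupNorm.
Context {R : realType} {T : Type}.
Implicit Types f g : T -> R.

Definition supnorm f : R := sup (range (fun x => `|f x|)).

Let bounded f := exists M, forall x, `|f x| <= M.

Lemma supnorm_ge f x : bounded f -> `|f x| <= supnorm f.
Proof.
move=> [M fM]; apply: ub_le_sup; last by exists x.
by exists M => _ [y _ <-].
Qed.

Lemma supnorm_le f M : 0 <= M -> (forall x, `|f x| <= M) -> supnorm f <= M.
Proof.
move=> M0 fM; rewrite /supnorm; set S := [set _ | _ in _].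
have [->|S0] := eqVneq S set0; first by rewrite sup0.
by apply: ge_sup; [exact/set0P|move=> _ [y _ <-]].
Qed.

Lemma supnorm_ge0 f : bounded f -> 0 <= supnorm f.
Proof.
have [[x _]|T0] := pselect ([set: T] !=set0).
  by move=> /(supnorm_ge x); exact: le_trans.
rewrite /supnorm; set S := [set _ | _ in _].
suff -> : S = set0 by rewrite sup0.
by apply/seteqP; split => // y [x _ _]; apply: T0; exists x.
Qed.

Lemma supnormD f g : bounded f -> bounded g ->
  supnorm (fun x => f x + g x) <= supnorm f + supnorm g.
Proof.
move=> bf bg; apply: supnorm_le => [|x]; first by rewrite addr_ge0 ?supnorm_ge0.
by rewrite (le_trans (ler_normD _ _))// lerD// supnorm_ge.
Qed.

Lemma supnormZ_le l f : bounded f ->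
  supnorm (fun x => l * f x) <= `|l| * supnorm f.
Proof.
move=> bf; apply: supnorm_le => [|x]; first by rewrite mulr_ge0 ?supnorm_ge0.
by rewrite normrM ler_wpM2l// supnorm_ge.
Qed.

Lemma supnormZ l f : bounded f ->
  supnorm (fun x => l * f x) = `|l| * supnorm f.
Proof.
move=> bf; apply/eqP; rewrite eq_le supnormZ_le//=.
have blf : bounded (fun x => l * f x).
  have [M fM] := bf; exists (`|l| * M) => x.
  by rewrite normrM ler_wpM2l.
have [->|l0] := eqVneq l 0.
  rewrite normr0 mul0r supnorm_ge0//.
  by exists 0 => x; rewrite mul0r normr0.
rewrite -ler_pdivlMl ?normr_gt0// -normfV.
rewrite -[leLHS](_ : supnorm (fun x => l^-1 * (l * f x)) = _) ?supnormZ_le//.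
by congr supnorm; apply/funext => x; rewrite mulKf.
Qed.

Lemma supnorm_eq0 f x : bounded f -> supnorm f = 0 -> f x = 0.
Proof.
by move=> /(supnorm_ge x) + f0; rewrite f0 normr_le0 => /eqP.
Qed.

End SupNorm.

HB.mixin Record isCompactHausdorff T & Topological T := {
  compact_setT : compact [set: T] ;
  hausdorff_setT : hausdorff_space T }.

#[short(type="compactHausdorffType")]
HB.structure Definition CompactHausdorff :=
  {T of Topological T & isCompactHausdorff T}.

(* C(L), with the topology of the supremum norm. *)
Definition Cspace (R : realType) (L : compactHausdorffType) :=
  continuousType L R.

Section CspaceNormed.
Context (R : realType) (L : compactHausdorffType).
Local Notation C := (Cspace R L).
Implicit Types f g h : C.

Definition Cspace_fun (f : C) : L -> R := f.
Coercion Cspace_fun : Cspace >-> Funclass.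

Lemma CspaceP f g : f =1 g -> f = g.
Proof. by move=> fg; apply/continuousEP. Qed.

Lemma Cspace_bounded f : exists M, forall x, `|f x| <= M.
Proof.
have cf : compact (range f).
  apply: continuous_compact; last exact: compact_setT.
  by apply: continuous_subspaceT; exact: (@cts_fun _ _ f).
have [M [_ fM]] := compact_bounded cf.
by exists (M + 1) => x; apply: (fM (M + 1)); [rewrite ltrDl|exists x].
Qed.

Lemma Cspace_add_cts f g : continuous (fun x => f x + g x).
Proof. by move=> x; apply: cvgD; exact: cts_fun. Qed.
Lemma Cspace_opp_cts f : continuous (fun x => - f x).
Proof. by move=> x; apply: cvgN; exact: cts_fun. Qed.
Lemma Cspace_scale_cts (l : R) f : continuous (fun x => l * f x).
Proof. by move=> x; apply: cvgMl_tmp; exact: cts_fun. Qed.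

Lemma Cspace_zero_cts : continuous (fun _ : L => 0 : R).
Proof. exact: cst_continuous. Qed.
Definition Cspace_zero : C :=
  (mkcts Cspace_zero_cts : continuousType L R).
Definition Cspace_add f g : C :=
  (mkcts (@Cspace_add_cts f g) : continuousType L R).
Definition Cspace_opp f : C :=
  (mkcts (@Cspace_opp_cts f) : continuousType L R).
Definition Cspace_scale l f : C :=
  (mkcts (@Cspace_scale_cts l f) : continuousType L R).

HB.instance Definition _ := Choice.on C.

Let addA : associative Cspace_add.
Proof. by move=> f g h; apply: CspaceP => x; exact: addrA. Qed.
Let addC : commutative Cspace_add.
Proof. by move=> f g; apply: CspaceP => x; exact: addrC. Qed.
Let add0 : left_id Cspace_zero Cspace_add.
Proof. by move=> f; apply: CspaceP => x; exact: add0r. Qed.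
Let addN : left_inverse Cspace_zero Cspace_opp Cspace_add.
Proof. by move=> f; apply: CspaceP => x; exact: addNr. Qed.

HB.instance Definition _ := GRing.isZmodule.Build C addA addC add0 addN.

Let scaleA (a b : R) f :
  Cspace_scale a (Cspace_scale b f) = Cspace_scale (a * b) f.
Proof. by apply: CspaceP => x; exact: mulrA. Qed.
Let scale1 : left_id 1 Cspace_scale.
Proof. by move=> f; apply: CspaceP => x; exact: mul1r. Qed.
Let scaleDr : right_distributive Cspace_scale +%R.
Proof. by move=> a f g; apply: CspaceP => x; exact: mulrDr. Qed.
Let scaleDl f : {morph Cspace_scale^~ f : a b / a + b}.
Proof. by move=> a b; apply: CspaceP => x; exact: mulrDl. Qed.

HB.instance Definition _ :=
  GRing.Zmodule_isLmodule.Build R C scaleA scale1 scaleDr scaleDl.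

Let normD f g : supnorm (f + g) <= supnorm f + supnorm g.
Proof. by apply: supnormD; exact: Cspace_bounded. Qed.
Let normZ (l : R) f : supnorm (l *: f) = `|l| * supnorm f.
Proof. by apply: supnormZ; exact: Cspace_bounded. Qed.
Let norm0_eq0 f : supnorm f = 0 -> f = 0.
Proof.
by move=> f0; apply: CspaceP => x; apply: supnorm_eq0 => //; exact: Cspace_bounded.
Qed.

HB.instance Definition _ := Lmodule_isNormed.Build R C normD normZ norm0_eq0.

End CspaceNormed.

Record c0 (R : realType) :=
  C0 { c0_seq :> nat -> R ; c0_cvg : c0_seq @ \oo --> (0 : R) }.

Section C0Normed.
Context (R : realType).
Local Notation c0 := (c0 R).
Implicit Types u v w : c0.

HB.instance Definition _ := gen_eqMixin c0.
HB.instance Definition _ := gen_choiceMixin c0.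

Lemma c0P u v : u =1 v -> u = v.
Proof.
case: u v => [u cu] [v cv] /funext /= uv; subst v.
by congr C0; exact: Prop_irrelevance.
Qed.

Lemma c0_bounded u : exists M, forall n, `|u n| <= M.
Proof.
have cu : cvgn (u : nat -> R) by apply/cvg_ex; exists 0; exact: c0_cvg.
have [M [_ uM]] := cvg_seq_bounded cu.
by exists (M + 1) => n; apply: (uM (M + 1)); rewrite ?ltrDl.
Qed.

Lemma c0_zero_cvg : (fun=> 0 : R) @ \oo --> (0 : R).
Proof. exact: cvg_cst. Qed.
Lemma c0_add_cvg u v : (fun n => u n + v n) @ \oo --> (0 : R).
Proof. by rewrite -[0](addr0 0); apply: cvgD; exact: c0_cvg. Qed.
Lemma c0_opp_cvg u : (fun n => - u n) @ \oo --> (0 : R).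
Proof. by rewrite -oppr0; apply: cvgN; exact: c0_cvg. Qed.
Lemma c0_scale_cvg (l : R) u : (fun n => l * u n) @ \oo --> (0 : R).
Proof. by rewrite -(mulr0 l); apply: cvgMl_tmp; exact: c0_cvg. Qed.

Definition c0_zero := C0 c0_zero_cvg.
Definition c0_add u v := C0 (@c0_add_cvg u v).
Definition c0_opp u := C0 (@c0_opp_cvg u).
Definition c0_scale l u := C0 (@c0_scale_cvg l u).

Let addA : associative c0_add.
Proof. by move=> u v w; apply: c0P => n; exact: addrA. Qed.
Let addC : commutative c0_add.
Proof. by move=> u v; apply: c0P => n; exact: addrC. Qed.
Let add0 : left_id c0_zero c0_add.
Proof. by move=> u; apply: c0P => n; exact: add0r. Qed.
Let addN : left_inverse c0_zero c0_opp c0_add.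
Proof. by move=> u; apply: c0P => n; exact: addNr. Qed.

HB.instance Definition _ := GRing.isZmodule.Build c0 addA addC add0 addN.

Let scaleA (a b : R) u : c0_scale a (c0_scale b u) = c0_scale (a * b) u.
Proof. by apply: c0P => n; exact: mulrA. Qed.
Let scale1 : left_id 1 c0_scale.
Proof. by move=> u; apply: c0P => n; exact: mul1r. Qed.
Let scaleDr : right_distributive c0_scale +%R.
Proof. by move=> a u v; apply: c0P => n; exact: mulrDr. Qed.
Let scaleDl u : {morph c0_scale^~ u : a b / a + b}.
Proof. by move=> a b; apply: c0P => n; exact: mulrDl. Qed.

HB.instance Definition _ :=
  GRing.Zmodule_isLmodule.Build R c0 scaleA scale1 scaleDr scaleDl.

Let normD u v : supnorm (u + v) <= supnorm u + supnorm v.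
Proof. by apply: supnormD; exact: c0_bounded. Qed.
Let normZ (l : R) u : supnorm (l *: u) = `|l| * supnorm u.
Proof. by apply: supnormZ; exact: c0_bounded. Qed.
Let norm0_eq0 u : supnorm u = 0 -> u = 0.
Proof.
by move=> u0; apply: c0P => n; apply: supnorm_eq0 => //; exact: c0_bounded.
Qed.

HB.instance Definition _ := Lmodule_isNormed.Build R c0 normD normZ norm0_eq0.

End C0Normed.

Section CopiesOfC0.
Context {R : realType} {X : normedModType R}.
Implicit Type Y : set X.

(* A bounded operator that is bounded below is an isomorphism onto its range. *)
Definition isomorphic_c0 Y :=
  exists T : {linear c0 R -> X},
    [/\ continuous T,
        exists2 c : R, 0 < c & forall u, c * `|u| <= `|T u| &
        range T = Y].

Definition complemented Y :=
  closed Y /\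
  exists p : {linear X -> X},
    [/\ continuous p, forall x, p (p x) = p x & range p = Y].

Definition hereditarily_separably_Sobczyk :=
  forall Y, isomorphic_c0 Y ->
    exists Z, [/\ Z `<=` Y, isomorphic_c0 Z & complemented Z].

End CopiesOfC0.
Arguments hereditarily_separably_Sobczyk {R} X.

Definition separable (T : topologicalType) :=
  exists2 D : set T, countable D & dense D.

(* Measurable types are pointed in the library: [pointed_at x0] is the space T
   pointed at x0. *)
Definition pointed_at (T : topologicalType) (x0 : T) : Type := T.
HB.instance Definition _ (T : topologicalType) (x0 : T) :=
  Topological.copy (pointed_at x0) T.
HB.instance Definition _ (T : topologicalType) (x0 : T) :=
  isPointed.Build (pointed_at x0) x0.

Definition borel (T : topologicalType) (x0 : T) :=
  g_sigma_algebraType (@open (pointed_at x0)).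

Definition radon (R : realType) (T : topologicalType) (x0 : T)
    (mu : set (borel x0) -> \bar R) :=
  forall B : set (borel x0), measurable B ->
    mu B = ereal_sup [set mu C | C in [set C : set T | compact C /\ C `<=` B]].

(* The choice of the base point x0 is immaterial; on the empty space, which
   supports the zero measure, the condition is vacuous. *)
Definition supports_measure (R : realType) (T : topologicalType) :=
  forall x0 : T, exists mu : {finite_measure set (borel x0) -> \bar R},
    radon mu /\ forall U : set T, open U -> U !=set0 -> (0 < mu U)%E.

Definition maps_onto_cube (R : realType) (T : topologicalType) (W : Type) :=
  exists f : T -> prod_topology (fun _ : W => set_type (`[0, 1]%classic : set R)),
    continuous f /\ range f = [set: _].

Section Compactifications.
Context {L : compactHausdorffType} (e : nat -> L).

Definition is_compactification :=
  [/\ injective e,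
      forall n, exists2 U : set L, open U & U `&` range e = [set e n] &
      dense (range e)].

(* As a type, [remainder] carries the subspace topology. *)
Definition remainder : set L := ~` range e.

Definition natural_c0 (R : realType) : set (Cspace R L) :=
  [set f | forall x, remainder x -> f x = 0].

End Compactifications.
Arguments natural_c0 {L} e R _.

(* Main.v *)
(** Let L be the Stone space of the algebra of sets of nodes of the tree with 4^n
    digits at level n that is generated by the singletons, the cones and the sets
    of nodes whose digits avoid a slalom S_w from some level on.  If the slaloms
    are summable, i.e. |S_w(n)| / 4^n is, then a continuous function on L is
    almost equal, at a node s of high level, to its averages over the descendants
    of s.  With nu_s f the limit of these averages, s |-> f s - nu_s f is therefore
    a projection onto c0, and the average over the whole tree is a strictly positive
    measure on the remainder.  The remainder is non-separable as soon as any
    countably many branches meet some S_w infinitely often.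

    Assume moreover that the S_w are well-ordered by almost inclusion.  Below a
    node, sets depending on k slaloms then have only linearly many traces, so there
    is no uncountable independent family and no map onto the cube.  Also L is
    sequentially compact.  Given a copy of c0 with basis f_k, choose
    x_k -> x with f_k x_k - f_k x bounded away from 0; after thinning out, the
    functionals f |-> f x_k - f x are almost biorthogonal to the f_k and yield a
    projection.

    A slalom S is coded by the null set of reals whose expansion hits S infinitely
    often.  If a compact set C of positive measure misses a null set N, then the
    digits not taken below a node s by the cells of positive measure in C form
    a summable slalom, since the measure of C below s is at most the product of the
    1 - |T(n)| / 4^n; countably many such slaloms dominate every S coded by a subset
    of N.  So fewer than add(N) summable slaloms have a common summable bound,
    and along a well-order of length add(N) = non(M) one builds a tower that
    catches the codes of all members of a non-meager set. *)
From HB Require Import structures.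
Require Import Defs.
From mathcomp Require Import all_boot all_order all_algebra.
From mathcomp Require Import all_classical all_reals all_analysis.
From mathcomp Require Import zify ring lra.
From mathcomp Require wochoice.

Set Implicit Arguments.
Unset Strict Implicit.
Unset Printing Implicit Defensive.

Import Order.TTheory GRing.Theory Num.Theory.
Import numFieldNormedType.Exports.

Local Open Scope classical_set_scope.
Local Open Scope ring_scope.

(** The two halves pull in opposite directions. Non-separability asks for many slaloms, so that
    every countable family of branches is met; with no further demand all summable slaloms are
    taken. Excluding maps onto the cube and finding convergent subsequences ask for slaloms arranged
    linearly: comparability leaves a finite family with few traces, and well-foundedness lets one
    thinning of a sequence decide all slaloms at once. A tower meets both demands only if its length
    is at most add(N), so that every proper initial segment still has a summable bound, and at least
    non(M), so that its members can be matched with a non-meager set of codes; hence the equality of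
    the two invariants. The size condition is summability of the relative weights because both sides
    see exactly this: it makes rare the descendants of a high node that newly enter a slalom, which
    gives the projection, and it makes the coded set of reals null by Borel-Cantelli. *)

Lemma compact_finite_cover (T : topologicalType) (A : set T) (I : choiceType)
    (D : set I) (f : I -> set T) : compact A ->
  (forall i, D i -> open (f i)) -> (forall x, A x -> exists2 i, D i & f i x) ->
  exists2 s : seq I, (forall i, i \in s -> D i) & forall x, A x -> exists2 i, i \in s & f i x.
Proof.
have [->|/set0P[x0 _] cA oD Af] := eqVneq A set0; first by exists [::].
have cA' : @compact (pointed_at x0) A by exact: cA.
rewrite compact_cover in cA'; have [x /Af[i Di fi]|E ED Ecov] := cA' I D f oD.
  by exists i.
exists (finmap.enum_fset E) => [i /ED|x /Ecov[i iE fi]]; first exact: set_mem.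
by exists i.
Qed.

(** * Averages over descendants in the tree with 4^n digits at level n *)

(** Since [n.+1 <= 2 ^ n], a slalom with [n.+1] digits at level [n] has weight at most 2^-n there;
    base 4 thus makes all such slaloms summable. *)
Definition br (n : nat) : nat := (4 ^ n)%N.

Lemma br_gt0 n : (0 < br n)%N.
Proof. by rewrite expn_gt0. Qed.

Definition digits_ok (s : seq nat) :=
  all (fun i => nth 0%N s i < br i)%N (iota 0 (size s)).

Lemma digits_okP s :
  reflect (forall i, (i < size s)%N -> (nth 0%N s i < br i)%N) (digits_ok s).
Proof.
apply: (iffP allP) => [h i ilt|h i]; first by apply: h; rewrite mem_iota.
by rewrite mem_iota => /andP[_]; exact: h.
Qed.

Lemma digits_ok_rcons s d :
  digits_ok (rcons s d) = digits_ok s && (d < br (size s))%N.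
Proof.
apply/digits_okP/andP => [h|[/digits_okP h hd] i].
  split; last by have := h (size s); rewrite size_rcons nth_rcons ltnn eqxx; exact.
  apply/digits_okP => i ilt; have := h i; rewrite size_rcons nth_rcons ilt.
  by apply; apply: ltnW.
rewrite size_rcons nth_rcons; case: (ltngtP i (size s)) => [ilt _|igt|-> _//]; first exact: h.
by move=> ilt; have := leq_trans igt ilt; rewrite ltnn.
Qed.

Lemma digits_ok_take n s : digits_ok s -> digits_ok (take n s).
Proof.
move=> /digits_okP h; apply/digits_okP => i; rewrite size_take_min leq_min => /andP[i1 i2].
by rewrite nth_take//; exact: h.
Qed.

Definition node := {s : seq nat | digits_ok s}.

HB.instance Definition _ := Countable.on node.
HB.instance Definition _ := isPointed.Build node (Sub [::] (isT : digits_ok [::])).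

Definition root : node := Sub [::] (isT : digits_ok [::]).
Definition lev (s : node) := size (val s).
Definition dig (s : node) i := nth 0%N (val s) i.
(** An inadmissible digit returns [s] itself, hence the bound on [d] in the lemmas about children.
    In [trunc] the default value never occurs. *)
Definition child (s : node) d : node := insubd s (rcons (val s) d).
Definition trunc n (s : node) : node := insubd s (take n (val s)).

Lemma dig_lt s i : (i < lev s)%N -> (dig s i < br i)%N.
Proof. exact/digits_okP/valP. Qed.

Lemma val_child s d : (d < br (lev s))%N -> val (child s d) = rcons (val s) d.
Proof. by move=> h; rewrite val_insubd digits_ok_rcons (valP s) h. Qed.

Lemma val_trunc n s : val (trunc n s) = take n (val s).
Proof. by rewrite val_insubd digits_ok_take// (valP s). Qed.

Lemma lev_child s d : (d < br (lev s))%N -> lev (child s d) = (lev s).+1.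
Proof. by move=> h; rewrite /lev val_child// size_rcons. Qed.

Lemma dig_child s d i : (d < br (lev s))%N ->
  dig (child s d) i = if i == lev s then d else dig s i.
Proof.
move=> h; rewrite /dig val_child// nth_rcons; case: ltngtP => // il.
by rewrite nth_default// ltnW.
Qed.

Lemma lev_trunc n s : lev (trunc n s) = minn n (lev s).
Proof. by rewrite /lev val_trunc size_take_min. Qed.

Lemma dig_trunc n s i : (i < n)%N -> dig (trunc n s) i = dig s i.
Proof. by move=> h; rewrite /dig val_trunc nth_take. Qed.

Lemma trunc_id n s : (lev s <= n)%N -> trunc n s = s.
Proof. by move=> h; apply: val_inj; rewrite val_trunc take_oversize. Qed.

Lemma trunc_trunc n m s : (n <= m)%N -> trunc n (trunc m s) = trunc n s.
Proof. by move=> h; apply: val_inj; rewrite !val_trunc take_takel. Qed.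

Lemma trunc_child n s d : (d < br (lev s))%N -> (n <= lev s)%N ->
  trunc n (child s d) = trunc n s.
Proof.
move=> h nl; apply: val_inj; rewrite !val_trunc val_child// -cats1 takel_cat//.
Qed.

Lemma truncS n s : (n < lev s)%N -> trunc n.+1 s = child (trunc n s) (dig s n).
Proof.
move=> h; have hm : minn n (lev s) = n by apply/minn_idPl/ltnW.
apply: val_inj; rewrite val_child ?lev_trunc ?hm ?dig_lt//.
by rewrite !val_trunc (take_nth 0%N).
Qed.

Lemma trunc0 s : trunc 0 s = root.
Proof. by apply: val_inj; rewrite val_trunc take0. Qed.

Lemma lev_root s : lev s = 0%N -> s = root.
Proof. by move=> h; apply: val_inj; apply: size0nil. Qed.

Lemma finite_lev n : finite_set [set s : node | (lev s <= n)%N].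
Proof.
elim: n => [|n IH].
  apply: (@sub_finite_set _ _ [set root]) => // s /=.
  by rewrite leqn0 => /eqP/lev_root.
apply: (@sub_finite_set _ _ ([set s : node | (lev s <= n)%N] `|`
   [set child x.1 x.2 | x in [set s : node | (lev s <= n)%N] `*` `I_(br n)])).
  move=> s /=; rewrite leq_eqVlt ltnS => /orP[/eqP sn|]; last by left.
  right; exists (trunc n s, dig s n); last first.
    by rewrite -truncS ?trunc_id ?sn.
  by split => /=; rewrite ?lev_trunc ?geq_minl// dig_lt// sn.
by rewrite finite_setU; split=> //; apply: finite_image; exact: finite_setX.
Qed.

Lemma node_levels n : exists s, lev s = n.
Proof.
elim: n => [|n [s sn]]; first by exists root.
by exists (child s 0); rewrite lev_child ?br_gt0 ?sn.
Qed.

Lemma node_enum : exists2 e : nat -> node, injective e & forall s, exists n, e n = s.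
Proof.
have inf : infinite_set [set: node].
  move=> fin.
  have : finite_set [set: nat].
    apply: (@sub_finite_set _ _ (lev @` [set: node])); last exact: finite_image.
    by move=> n _; have [s <-] := node_levels n; exists s.
  by rewrite -/(infinite_set _); exact: infinite_nat.
have /card_set_bijP[e [_ ei es]] : ([set: nat] #= [set: node])%card.
  by rewrite card_eq_sym; exact: eq_card_nat.
exists e => [x y|s]; first by apply: ei; rewrite inE.
by have [n _ <-] := es s I; exists n.
Qed.

(** * Slaloms, avoidance and cones *)

Definition slalom := nat -> nat -> bool.

Definition avoid (S : slalom) m (u : node) :=
  forall i, (m <= i < lev u)%N -> ~~ S i (dig u i).

Lemma avoid_child S m s d : (m <= lev s)%N -> (d < br (lev s))%N ->
  avoid S m (child s d) <-> avoid S m s /\ ~~ S (lev s) d.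
Proof.
move=> ml h; split=> [av|[av Sd] i].
  split=> [i /andP[mi il]|].
    have := av i; rewrite dig_child// lev_child// mi ltnW//= => /(_ isT).
    by rewrite ltn_eqF.
  by have := av (lev s); rewrite dig_child// lev_child// eqxx ml ltnSn => /(_ isT).
rewrite lev_child// dig_child// ltnS => /andP[mi]; rewrite leq_eqVlt.
case: eqVneq => [->//|_ /= il]; apply: av; exact/andP.
Qed.

(** Digits below level [l] are visible in the truncation at [l]. So a condition from level [m] on
    can be read at any later level, and finitely many conditions can share one level. *)
Lemma avoid_split S m l u : (m <= l)%N ->
  avoid S m u <-> avoid S m (trunc l u) /\ avoid S l u.
Proof.
move=> ml; split=> [av|[av1 av2] i /andP[mi il]].
  split=> i /andP[mi il]; last by apply: av; rewrite il andbT (leq_trans ml).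
  move: il; rewrite lev_trunc leq_min => /andP[il iu].
  by rewrite dig_trunc//; apply: av; exact/andP.
have [li|li] := leqP l i; first by apply: av2; exact/andP.
by rewrite -(dig_trunc _ li); apply: av1; rewrite mi lev_trunc leq_min li.
Qed.

Lemma avoid_le S m l u : (m <= l)%N -> avoid S m u -> avoid S l u.
Proof. by move=> ml /(avoid_split S u ml)[]. Qed.

Lemma avoid_sub (S S' : slalom) m u :
  (forall n d, (m <= n)%N -> (d < br n)%N -> S n d -> S' n d) ->
  avoid S' m u -> avoid S m u.
Proof.
move=> SS' av i /andP[mi il]; apply: contra (av i _); last exact/andP.
by apply: SS' => //; exact: dig_lt.
Qed.

Definition desc (s t : node) := (lev s <= lev t)%N /\ trunc (lev s) t = s.

Lemma desc_refl s : desc s s.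
Proof. by split=> //; exact: trunc_id. Qed.

Lemma desc_trans s t u : desc s t -> desc t u -> desc s u.
Proof.
move=> [st ts] [tu ut]; split; first exact: leq_trans tu.
by rewrite -(trunc_trunc u st) ut.
Qed.

Lemma desc_child s d : (d < br (lev s))%N -> desc s (child s d).
Proof.
by move=> h; split; rewrite ?lev_child ?trunc_child ?trunc_id.
Qed.

Lemma desc_trunc n s : desc (trunc n s) s.
Proof.
split; first by rewrite lev_trunc geq_minr.
by apply: val_inj; rewrite lev_trunc !val_trunc take_min [take (lev s) _]take_size.
Qed.

Lemma desc_truncE l s t : desc s t -> (l <= lev s)%N -> trunc l t = trunc l s.
Proof. by move=> [st ts] ls; rewrite -[in RHS]ts trunc_trunc. Qed.

Lemma avoid_desc S m s t : (m <= lev s)%N -> desc s t -> avoid S m t -> avoid S m s.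
Proof. by move=> ml [st ts] /(avoid_split S t ml)[]; rewrite ts. Qed.

Section Averages.
Context {R : realType}.
Implicit Types (f g : node -> R) (s : node).

Fixpoint avg (r : nat) f s : R := if r is r'.+1 then
  (\sum_(d < br (lev s)) avg r' f (child s d)) / (br (lev s))%:R else f s.

Let brR n : 0 < (br n)%:R :> R.
Proof. by rewrite ltr0n br_gt0. Qed.

Lemma ler_avg r f g s :
  (forall t, desc s t -> lev t = (lev s + r)%N -> f t <= g t) ->
  avg r f s <= avg r g s.
Proof.
elim: r s => [s h|r IH s h] /=; first by apply: h; [exact: desc_refl|rewrite addn0].
rewrite ler_pM2r ?invr_gt0//; apply: ler_sum => d _; apply: IH => t st lt.
apply: h; first exact: desc_trans (desc_child (ltn_ord d)) st.
by rewrite lt lev_child// addSnnS.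
Qed.

Lemma eq_avg r f g s :
  (forall t, desc s t -> lev t = (lev s + r)%N -> f t = g t) ->
  avg r f s = avg r g s.
Proof. by move=> h; apply/le_anti/andP; split; apply: ler_avg => t st lt; rewrite h. Qed.

Lemma avgD r f g s : avg r (fun t => f t + g t) s = avg r f s + avg r g s.
Proof.
elim: r s => [//|r IH] s /=; rewrite -mulrDl -big_split /=.
by congr (_ / _); apply: eq_bigr => d _; exact: IH.
Qed.

Lemma avgZ r (c : R) f s : avg r (fun t => c * f t) s = c * avg r f s.
Proof.
elim: r s => [//|r IH] s /=; rewrite mulrA mulr_sumr.
by congr (_ / _); apply: eq_bigr => d _; exact: IH.
Qed.

Lemma avgN r f s : avg r (fun t => - f t) s = - avg r f s.
Proof.
rewrite -mulN1r -avgZ; congr avg; apply/funext => t; by rewrite mulN1r.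
Qed.

Lemma avg_cst r (c : R) s : avg r (fun=> c) s = c.
Proof.
elim: r s => [//|r IH] s /=; under eq_bigr do rewrite IH.
by rewrite sumr_const card_ord -[c *+ _]mulr_natr mulfK// gt_eqF.
Qed.

Lemma ler_norm_avg r f s : `|avg r f s| <= avg r (fun t => `|f t|) s.
Proof.
rewrite ler_norml -avgN; apply/andP; split; apply: ler_avg => t _ _.
  by rewrite lerNl ler_normr lexx orbT.
exact: ler_norm.
Qed.

Lemma avg_add r q f s : avg (r + q) f s = avg r (avg q f) s.
Proof.
elim: r s => [//|r IH] s /=.
by congr (_ / _); apply: eq_bigr => d _; exact: IH.
Qed.

Lemma avg_sum r (I : Type) (ws : seq I) (F : I -> node -> R) s :
  avg r (fun t => \sum_(w <- ws) F w t) s = \sum_(w <- ws) avg r (F w) s.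
Proof.
elim: ws => [|w ws IH].
  by rewrite big_nil -[RHS](avg_cst r 0 s); apply: eq_avg => t; rewrite big_nil.
rewrite big_cons -IH -avgD; apply: eq_avg => t _ _; by rewrite big_cons.
Qed.

Definition wt (S : slalom) n : R := (\sum_(d < br n) (S n d)%:R) / (br n)%:R.

Lemma wt_ge0 S n : 0 <= wt S n.
Proof. by rewrite divr_ge0//; apply: sumr_ge0. Qed.

Definition slalom_summable (S : slalom) := forall eps : R, 0 < eps ->
  exists N, forall n, \sum_(N <= i < n) wt S i <= eps.

(** A union bound: a descendant that fails to avoid [S] has a digit in [S] at some place from
    [lev s] on, and at place [i] the proportion of such digits is [wt S i]. *)
Lemma avg_avoid S m s r : (m <= lev s)%N -> avoid S m s ->
  avg r (fun t => `[< ~ avoid S m t >]%:R) s <= \sum_(lev s <= i < lev s + r) wt S i.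
Proof.
elim: r s => [|r IH] s ml av.
  by rewrite addn0 big_geq//= asboolF//; apply/contrapT.
rewrite big_ltn ?addnS ?ltnS ?leq_addr//=.
set T := \sum_(_ <= _ < _) _; have T0 : 0 <= T by apply: sumr_ge0 => i _; exact: wt_ge0.
rewrite /wt -[T](mulfK (x := (br (lev s))%:R)) ?gt_eqF// -mulrDl ler_pM2r ?invr_gt0//.
(* The tail [T] is spread evenly over the children, so that each child carries its own digit term
   and one copy of the tail. *)
have -> : T * (br (lev s))%:R = \sum_(d < br (lev s)) T.
  by rewrite sumr_const card_ord mulr_natr.
rewrite -big_split /=; apply: ler_sum => d _.
have [Sd|Sd] := boolP (S (lev s) d).
  rewrite -[X in X <= _]addr0 lerD//.
  rewrite -[leRHS](avg_cst r 1 (child s d)); apply: ler_avg => t _ _.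
  by rewrite lern1 leq_b1.
rewrite add0r; apply: (le_trans (IH _ _ _)); rewrite ?lev_child//.
- by rewrite (leq_trans ml).
- by apply/avoid_child.
Qed.

Section Stable.
Variables (W : eqType) (S : W -> slalom).

(** Up to the finitely many nodes below level [l], the classes are the atoms of the finite algebra
    given by the cones at level [l] and the sets avoiding the slaloms of [ws] from [l] on. A node
    below level [l] is not even related to itself. *)
Definition agree l (ws : seq W) u v :=
  [/\ (l <= lev u)%N, (l <= lev v)%N, trunc l u = trunc l v &
   forall w, w \in ws -> avoid (S w) l u <-> avoid (S w) l v].

Lemma agree_mono l l' (ws ws' : seq W) u v : (l <= l')%N -> {subset ws <= ws'} ->
  agree l' ws' u v -> agree l ws u v.
Proof.
move=> ll wsub [lu lv uv h]; split.
- exact: leq_trans lu.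
- exact: leq_trans lv.
- by rewrite -(trunc_trunc u ll) uv trunc_trunc.
- move=> w /wsub wws; have e z := avoid_split (S w) z ll; have hw := h w wws.
  by split=> /e[a /hw b]; apply/e; split=> //; [rewrite -uv|rewrite uv].
Qed.

Lemma agree_sym l ws u v : agree l ws u v -> agree l ws v u.
Proof. by move=> [lu lv uv h]; split=> // w /h[]. Qed.

(* The function extends continuously to the compactification below. *)
Definition uniform f := forall eps : R, 0 < eps ->
  exists l ws, forall u v, agree l ws u v -> `|f u - f v| <= eps.

(** The estimate is uniform in the depth [r], so it survives the passage to the limit of the
    averages. *)
Definition stable f := forall eps : R, 0 < eps ->
  exists N, forall s, (N <= lev s)%N -> forall r,
    avg r (fun t => `|f t - f s|) s <= eps.

Hypothesis sumS : forall w, slalom_summable (S w).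

Lemma summable_seq ws (eps : R) : 0 < eps ->
  exists N, forall m n, (N <= m)%N -> \sum_(w <- ws) \sum_(m <= i < n) wt (S w) i <= eps.
Proof.
elim: ws eps => [|w ws IH] eps e0.
  by exists 0%N => m n _; rewrite big_nil ltW.
have e2 : 0 < eps / 2 by rewrite divr_gt0.
have [N1 h1] := IH _ e2; have [N2 h2] := sumS w e2.
exists (maxn N1 N2) => m n; rewrite geq_max => /andP[m1 m2].
rewrite big_cons (splitr eps) lerD//; last exact: h1.
apply: le_trans (h2 n); have [mn|nm] := leqP m n; last first.
  by rewrite (big_geq (ltnW nm)); apply: sumr_ge0 => i _; exact: wt_ge0.
rewrite [leRHS](@big_cat_nat _ _ _ m N2 n)//= lerDr.
by apply: sumr_ge0 => i _; exact: wt_ge0.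
Qed.

(** A slalom already entered by [s] stays entered by all descendants. So [f] can move by more than
    eps/2 only at descendants entering one of the finitely many slaloms that [s] avoids, and their
    proportion is bounded by tails of weights. *)
Lemma uniform_stable f M : (forall t, `|f t| <= M) -> uniform f -> stable f.
Proof.
move=> fM uf eps e0.
have M0 : 0 <= M by apply: le_trans (fM root).
have e2 : 0 < eps / 2 by rewrite divr_gt0.
have [l [ws h]] := uf _ e2.
(* The factor [M *+ 2] bounds [|f t - f s|] at the exceptional descendants; adding 1 keeps the
   divisor positive when [M] vanishes. *)
have e3 : 0 < eps / 2 / (M *+ 2 + 1) by rewrite divr_gt0// ltr_pwDr// mulrn_wge0.
have [N hN] := summable_seq ws e3.
exists (maxn l N) => s; rewrite geq_max => /andP[ls Ns] r.
(* [g] counts the slaloms of [ws] avoided by [s] and entered by [t]; it is at least 1 wherever [t]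
   disagrees with [s]. *)
pose g (t : node) := \sum_(w <- [seq w <- ws | `[< avoid (S w) l s >]])
   `[< ~ avoid (S w) l t >]%:R : R.
apply: (@le_trans _ _ (avg r (fun t => eps / 2 + M *+ 2 * g t) s)).
  apply: ler_avg => t st _.
  have g0 : 0 <= g t by apply: sumr_ge0.
  have [ag|nag] := pselect (agree l ws t s).
    by apply: (le_trans (h _ _ ag)); rewrite lerDl mulr_ge0// mulrn_wge0.
  have g1 : 1 <= g t.
    have [w [wws av nav]] : exists w, [/\ w \in ws, avoid (S w) l s & ~ avoid (S w) l t].
      apply: contrapT => nex; apply: nag; split=> //.
      - by case: st => st _; exact: leq_trans st.
      - exact: desc_truncE st _.
      - move=> w wws; split; first exact: avoid_desc.
        by move=> av; apply: contrapT => nav; apply: nex; exists w.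
    rewrite /g (big_rem w) ?mem_filter ?asboolT//= lerDl.
    exact: sumr_ge0.
  apply: (@le_trans _ _ (M *+ 2)).
    by rewrite (le_trans (ler_normB _ _))// mulr2n lerD.
  by rewrite -[leLHS]add0r lerD ?(ltW e2)// ler_peMr// mulrn_wge0.
rewrite avgD avg_cst avgZ [leRHS]splitr lerD2l.
have gle : avg r g s <= eps / 2 / (M *+ 2 + 1).
  apply: le_trans (hN (lev s) (lev s + r)%N Ns); rewrite avg_sum.
  rewrite big_filter [leRHS](bigID (fun w => `[< avoid (S w) l s >]))/=.
  rewrite -[leLHS]addr0 lerD//.
    by apply: ler_sum => w /asboolP av; exact: avg_avoid.
  by apply: sumr_ge0 => w _; apply: sumr_ge0 => i _; exact: wt_ge0.
apply: (le_trans (ler_wpM2l _ gle)); first by rewrite mulrn_wge0.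
rewrite mulrCA ger_pMr// ler_pdivrMr ?mul1r ?lerDl//.
by rewrite ltr_pwDr// mulrn_wge0.
Qed.

End Stable.

Definition nu f s : R := limn (fun r => avg r f s).

(** An average over [r + q] levels is an average over [r] levels of averages over [q] levels, and
    each inner one is centred at a node of high level. *)
Lemma avg_stable f s (eps : R) : stable f -> 0 < eps -> exists N, forall r q,
  (N <= r)%N -> `|avg (r + q) f s - avg r f s| <= eps.
Proof.
move=> sf e0; have [N hN] := sf _ e0; exists N => r q Nr.
rewrite avg_add -avgN -avgD; apply: (le_trans (ler_norm_avg _ _ _)).
rewrite -[leRHS](avg_cst r eps s); apply: ler_avg => t st lt.
rewrite -[X in _ - X](avg_cst q (f t) t) -avgN -avgD.
apply: (le_trans (ler_norm_avg _ _ _)); apply: hN.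
by rewrite lt (leq_trans Nr)// leq_addl.
Qed.

Lemma cvg_avg f s : stable f -> cvgn (fun r => avg r f s).
Proof.
move=> sf; apply/cauchy_cvgP/cauchy_exP => eps e0.
have [N hN] := avg_stable s sf (divr_gt0 e0 (ltr0n R 2)).
exists (avg N f s); exists N => // r /= Nr; rewrite /ball /= distrC.
rewrite -(subnKC Nr) (le_lt_trans (hN _ _ (leqnn N)))// ltr_pdivrMr// ltr_pMr// ltr1n//.
Qed.

Lemma nu_near f (eps : R) : stable f -> 0 < eps ->
  exists N, forall s, (N <= lev s)%N -> `|nu f s - f s| <= eps.
Proof.
move=> sf e0; have [N hN] := sf _ e0; exists N => s Ns.
have h r : `|avg r f s - f s| <= eps.
  rewrite -[X in _ - X](avg_cst r (f s) s) -avgN -avgD.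
  by apply: (le_trans (ler_norm_avg _ _ _)); exact: hN.
have c := @cvg_avg f s sf.
rewrite ler_distl; apply/andP; split.
  by apply: limr_ge => //; near=> r; have := h r; rewrite ler_distl => /andP[].
by apply: limr_le => //; near=> r; have := h r; rewrite ler_distl => /andP[].
Unshelve. all: by end_near. Qed.

Lemma stableD f g : stable f -> stable g -> stable (fun t => f t + g t).
Proof.
move=> sf sg eps e0; have e2 : 0 < eps / 2 by rewrite divr_gt0.
have [N1 h1] := sf _ e2; have [N2 h2] := sg _ e2.
exists (maxn N1 N2) => s; rewrite geq_max => /andP[s1 s2] r.
rewrite (splitr eps); apply: le_trans (lerD (h1 _ s1 r) (h2 _ s2 r)).
rewrite -avgD; apply: ler_avg => t _ _.
by rewrite opprD addrACA ler_normD.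
Qed.

Lemma nuD f g s : stable f -> stable g ->
  nu (fun t => f t + g t) s = nu f s + nu g s.
Proof.
move=> sf sg; apply/cvg_lim => //.
rewrite (_ : (fun r => _) = fun r => avg r f s + avg r g s); last first.
  by apply/funext => r; rewrite avgD.
by apply: cvgD; exact: cvg_avg.
Qed.

Lemma nuZ c f s : stable f -> nu (fun t => c * f t) s = c * nu f s.
Proof.
move=> sf; apply/cvg_lim => //.
rewrite (_ : (fun r => _) = fun r => c * avg r f s); last first.
  by apply/funext => r; rewrite avgZ.
by apply: cvgMl_tmp; exact: cvg_avg.
Qed.

Lemma eq_nu f g s : stable g ->
  (exists N, forall t, (N <= lev t)%N -> f t = g t) -> nu f s = nu g s.
Proof.
move=> sg [N h]; apply/cvg_lim => //; apply: cvg_trans (@cvg_avg g s sg).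
apply: near_eq_cvg; exists N => // r /= Nr; apply: eq_avg => t _ lt.
by rewrite h// lt (leq_trans Nr)// leq_addl.
Qed.

Lemma nu_cst c s : nu (fun=> c) s = c.
Proof.
rewrite /nu (_ : (fun r => _) = cst c) ?lim_cst//.
by apply/funext => r; rewrite avg_cst.
Qed.

Lemma ler_nu f g s : stable f -> stable g -> (forall t, f t <= g t) ->
  nu f s <= nu g s.
Proof.
move=> sf sg fg; apply: ler_lim; try exact: cvg_avg.
by near=> r; apply: ler_avg.
Unshelve. all: by end_near. Qed.

Lemma nu_children f s : stable f ->
  nu f s = (\sum_(d < br (lev s)) nu f (child s d)) / (br (lev s))%:R.
Proof.
move=> sf; rewrite /nu.
apply/cvg_lim => //; rewrite -cvg_shiftS /=.
apply: cvgMr_tmp.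
apply: cvg_big => [|d _]; [exact: add_continuous|exact: cvg_avg].
Qed.

(** By the mean value property over children, the parent of a node with positive value has positive
    value, its other children contributing at least 0. Positivity thus climbs to the root. *)
Lemma nu_root_gt0 f s : stable f -> (forall t, 0 <= f t) -> 0 < nu f s ->
  0 < nu f root.
Proof.
move=> sf f0; have nu0 t : 0 <= nu f t.
  rewrite -(nu_cst 0 t); apply: ler_nu => // eps e0; exists 0%N => u _ r.
  by rewrite subrr normr0 avg_cst ltW.
move: {2}(lev s) (erefl (lev s)) => n; elim: n s => [|n IH] s sn.
  by rewrite (lev_root sn).
move=> ps; have ns : (n < lev s)%N by rewrite sn.
have lt : lev (trunc n s) = n by rewrite lev_trunc sn; apply/minn_idPl.
have dn : (dig s n < br (lev (trunc n s)))%N by rewrite lt dig_lt.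
apply: (IH (trunc n s) lt).
rewrite nu_children// divr_gt0//.
rewrite (bigD1 (Ordinal dn))//= -truncS// trunc_id ?sn//.
by rewrite ltr_pwDl// sumr_ge0.
Qed.

End Averages.

(** * Stone spaces of algebras of sets of nodes *)

Section Stone.
Context {I : Type} (AA : set (set I)).

(* Ultrafilters of the Boolean algebra AA, coded by their characteristic
   functions; the value outside AA is the junk value false. *)
Definition stone_set : set (set I -> bool) :=
  [set p | forall l : seq (set I), exists i, all (fun A => p A == `[<AA A /\ A i>]) l].
Definition stone := set_type stone_set.

Definition cylinder (p : stone) (l : seq (set I)) : set stone :=
  [set q | all (fun A => val q A == val p A) l].

Definition stone_open : set (set stone) :=
  [set U | forall p, U p -> exists l, cylinder p l `<=` U].

Let stone_openT : stone_open setT.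
Proof. by move=> p _; exists [::]. Qed.

Let stone_openI : setI_closed stone_open.
Proof.
move=> U V oU oV p [/oU[l lU] /oV[m mV]]; exists (l ++ m) => q.
by rewrite /cylinder /= all_cat => /andP[/lU ? /mV ?].
Qed.

Let stone_open_bigU (J : Type) (f : J -> set stone) :
  (forall i, stone_open (f i)) -> stone_open (\bigcup_i f i).
Proof.
move=> of_ p [i _ /of_[l lf]]; exists l => q /lf fq; by exists i.
Qed.

HB.instance Definition _ := Choice.on stone.
HB.instance Definition _ :=
  isOpenTopological.Build stone stone_openT stone_openI stone_open_bigU.

Lemma stone_openE : open = stone_open :> set (set stone).
Proof. by []. Qed.

Lemma cylinder_refl p l : cylinder p l p.
Proof. exact/allP. Qed.

Lemma cylinder_sub p q l : cylinder p l q -> cylinder q l `<=` cylinder p l.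
Proof.
rewrite /cylinder /= => h r /=; elim: l h => //= A l IH /andP[/eqP -> h] /andP[-> ?].
by rewrite IH.
Qed.

Lemma open_cylinder p l : open (cylinder p l).
Proof. by move=> q pq; exists l; exact: cylinder_sub. Qed.

Definition hat (A : set I) : set stone := [set p : stone | val p A].

Lemma open_hat A : open (hat A).
Proof.
move=> p pA; exists [:: A] => q; rewrite /cylinder /hat /= andbT => /eqP ->; exact: pA.
Qed.

Arguments open_hat : clear implicits.

Lemma closed_hat A : closed (hat A).
Proof.
rewrite -[hat A]setCK; apply: open_closedC; rewrite stone_openE => p pA; exists [:: A] => q.
rewrite /cylinder /= andbT => /eqP qp qA; apply: pA.
by rewrite /hat /= -qp.
Qed.

Arguments closed_hat : clear implicits.

(** The limit of an ultrafilter [F] takes at [A] the value telling whether [F] contains [hat A]. Any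
    finite list of these values is shared by some point of the space, which supplies the witness
    demanded by [stone_set]. *)
Lemma stone_compact : compact [set: stone].
Proof.
rewrite compact_ultra => F FU _.
have PF := @ultra_proper _ _ FU.
pose p : set I -> bool := fun A => `[< F (hat A) >].
have Fp l : F [set q : stone | all (fun A => val q A == p A) l].
  elim: l => [|A l IH] /=; first exact: filterE.
  suff FA : F [set q : stone | val q A == p A].
    by apply: filterS (filterI FA IH) => q [/= -> ->].
  rewrite /p; have [FA|FA] := asboolP (F (hat A)).
    by apply: filterS FA => q; rewrite /hat /= => ->.
  have [//|] := in_ultra_setVsetC (hat A) FU.
  apply: filterS => q; rewrite /hat /setC /=; by case: (val q A).
have pS : stone_set p.
  move=> l; have [q ql] := filter_ex (Fp l).
  have [i il] := set_mem (valP q) l; exists i; elim: l ql il {Fp} => //= A l IH.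
  by move=> /andP[/eqP -> ql] /andP[-> il]; exact: IH.
exists (SigSub (mem_set pS)); split=> // U; rewrite nbhsE => -[V [oV Vp] VU].
apply: filterS VU _; have [l lV] := oV _ Vp; exact: filterS lV (Fp l).
Qed.

Lemma stone_hausdorff : hausdorff_space stone.
Proof.
rewrite open_hausdorff => p q /eqP pq.
have [A pA] : exists A, val p A != val q A.
  apply: contrapT => h; apply/pq/val_inj/funext => A; apply/eqP/negPn/negP => hA.
  by apply: h; exists A.
exists (cylinder p [:: A], cylinder q [:: A]); rewrite /= ?inE.
  by split; exact: cylinder_refl.
split; [exact: open_cylinder|exact: open_cylinder|].
apply/seteqP; split=> // r [] /=; rewrite /cylinder /= !andbT => /eqP rp /eqP rq.
by move: pA; rewrite /= -rp -rq eqxx.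
Qed.

HB.instance Definition _ := isCompactHausdorff.Build stone stone_compact stone_hausdorff.

Definition stone_emb0 (i : I) : set I -> bool := fun A => `[<AA A /\ A i>].

Lemma stone_emb0P i : stone_emb0 i \in stone_set.
Proof. by rewrite inE => l; exists i; exact/allP. Qed.

Definition emb (i : I) : stone := SigSub (stone_emb0P i).

Lemma hat_emb A i : AA A -> hat A (emb i) <-> A i.
Proof.
rewrite /hat /emb /stone_emb0 /= => AAA.
by split=> [/asboolP[]|Ai]//; exact/asboolP.
Qed.

Lemma stone_approx (p : stone) l : exists i, cylinder p l (emb i).
Proof.
have [i il] := set_mem (valP p) l; exists i; apply: sub_all il => A.
by rewrite eq_sym.
Qed.

Lemma stone_approx1 (p : stone) U : open U -> U p -> exists i, U (emb i).
Proof. by move=> oU /oU[l lU]; have [i /lU] := stone_approx p l; exists i. Qed.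

Lemma hat_mem A p : hat A p -> AA A.
Proof.
move=> pA; have [i] := stone_approx1 (open_hat A) pA.
by rewrite /hat /= => /asboolP[].
Qed.

Hypotheses (AAT : AA setT) (AAC : forall A, AA A -> AA (~` A))
  (AAI : forall A B, AA A -> AA B -> AA (A `&` B)) (AA1 : forall i, AA [set i]).

Lemma AA0 : AA set0. Proof. by rewrite -setCT; exact: AAC. Qed.

Lemma AAU A B : AA A -> AA B -> AA (A `|` B).
Proof. by move=> a b; rewrite -[_ `|` _]setCK setCU; apply/AAC/AAI; exact: AAC. Qed.

(** Hats are clopen and embedded points are dense, so a failure of the identity would occur at some
    [emb i], where [hat] is plain membership. The same argument serves [hat_sub], [hatI] and
    [hatT]. *)
Lemma hatC A : AA A -> hat (~` A) = ~` hat A.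
Proof.
move=> a; have aC := AAC a; apply/seteqP; split=> p pA.
  move=> pA'; have [i [/hat_emb h1 /hat_emb h2]] :=
    stone_approx1 (openI (open_hat (~` A)) (open_hat A)) (conj pA pA').
  by apply: (h1 aC); exact: h2.
apply: contrapT => pA'; have [i [/= h1 h2]] :=
  stone_approx1 (openI (closed_openC (closed_hat (~` A))) (closed_openC (closed_hat A)))
    (conj pA' pA).
by apply: h1; apply/hat_emb => // Ai; apply: h2; exact/hat_emb.
Qed.

Lemma hat_sub A B : AA A -> AA B -> A `<=` B -> hat A `<=` hat B.
Proof.
move=> a b AB p pA; apply: contrapT => pB.
have [i [/= /hat_emb h1 h2]] :=
  stone_approx1 (openI (open_hat A) (closed_openC (closed_hat B))) (conj pA pB).
by apply: h2; apply/hat_emb => //; apply: AB; exact: h1.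
Qed.

Lemma hatI A B : AA A -> AA B -> hat (A `&` B) = hat A `&` hat B.
Proof.
move=> a b; have ab := AAI a b; apply/seteqP; split=> [p pAB|p [pA pB]].
  by split; apply: (hat_sub ab) pAB => // i [].
apply: contrapT => pAB; have [i [[/hat_emb h1 /hat_emb h2] h3]] :=
  stone_approx1 (openI (openI (open_hat A) (open_hat B))
    (closed_openC (closed_hat (A `&` B)))) (conj (conj pA pB) pAB).
by apply: h3; apply/hat_emb => //; split; [exact: h1|exact: h2].
Qed.

Lemma hatT : hat setT = setT.
Proof.
apply/seteqP; split=> // p _; apply: contrapT => h.
have [i] := stone_approx1 (closed_openC (closed_hat setT)) h.
by apply; apply/hat_emb.
Qed.

Lemma hat0 : hat set0 = set0.
Proof. by rewrite -setCT hatC// hatT setCT. Qed.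

Lemma hatU A B : AA A -> AA B -> hat (A `|` B) = hat A `|` hat B.
Proof.
move=> a b; rewrite -[A `|` B]setCK setCU hatC; last by apply: AAI; exact: AAC.
by rewrite hatI ?hatC//; [rewrite -setCU setCK|exact: AAC|exact: AAC].
Qed.

Lemma hat_cylinder (p : stone) l : exists A, [/\ AA A, hat A p & hat A `<=` cylinder p l].
Proof.
elim: l => [|B l [A [a pA Al]]]; first by exists setT; split; rewrite ?hatT//; move=> q.
(* A coordinate outside the algebra is false at every point and constrains nothing. *)
have [b|nb] := pselect (AA B); last first.
  have nB (q : stone) : val q B = false.
    by apply/negP => qB; apply: nb; exact: (@hat_mem B q).
  by exists A; split=> // q /Al ql; rewrite /cylinder /= !nB eqxx.
have [pB|pB] := boolP (val p B).
  exists (A `&` B); split; rewrite ?hatI//; first exact: AAI.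
  by move=> q [/Al ql qB]; rewrite /cylinder /= pB; apply/andP; split=> //; exact/eqP.
have e : hat (A `&` ~` B) = hat A `&` ~` hat B by rewrite hatI ?hatC//; exact: AAC.
exists (A `&` ~` B); rewrite e; split; first by apply: AAI => //; exact: AAC.
  by split=> //; exact/negP.
move=> q [/Al ql /negP qB]; rewrite /cylinder /= (negbTE pB); apply/andP; split=> //.
exact/eqP/negbTE.
Qed.

Lemma stone_base (p : stone) U : open U -> U p -> exists A, [/\ AA A, hat A p & hat A `<=` U].
Proof.
move=> oU /oU[l lU]; have [A [a pA Al]] := hat_cylinder p l.
by exists A; split=> //; exact: subset_trans lU.
Qed.

Lemma stone_separation (F U : set stone) : closed F -> open U -> F `<=` U ->
  exists A, [/\ AA A, F `<=` hat A & hat A `<=` U].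
Proof.
move=> cF oU FU.
have h p : exists A, F p -> [/\ AA A, hat A p & hat A `<=` U].
  have [Fp|] := pselect (F p); last by exists set0.
  have [A hA] := stone_base oU (FU _ Fp); by exists A.
have [f hf] := choice h.
have : compact F by apply: (subclosed_compact cF stone_compact).
move=> /(@compact_finite_cover _ _ stone F (hat \o f))[i _|p Fp|D DF Fcov].
- exact: open_hat.
- by exists p => //; case: (hf _ Fp).
have [A [a FA AU]] : exists A, [/\ AA A, forall i, i \in D -> hat (f i) `<=` hat A & hat A `<=` U].
  elim: D DF {Fcov} => [|i s IH] DF.
    by exists set0; split; [exact: AA0| |rewrite hat0].
  have [A [a FA AU]] := IH (fun j js => DF j (mem_behead (s := i :: s) js)).
  have [h1 h2 h3] := hf i (DF i (mem_head _ _)).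
  exists (f i `|` A); split; [exact: AAU| |by rewrite hatU// subUset].
  rewrite hatU// => j; rewrite inE => /orP[/eqP ->|js] q qj; first by left.
  by right; apply: FA qj.
exists A; split=> // p /Fcov[i iD]; exact: FA.
Qed.

Lemma emb_inj : injective emb.
Proof.
move=> i j ij; have : hat [set i] (emb j) by rewrite -ij; apply/hat_emb.
by move=> /(hat_emb j (AA1 i)) ->.
Qed.

Lemma hat1 i : hat [set i] = [set emb i].
Proof.
apply/seteqP; split=> [p pi|_ ->]; last exact/hat_emb.
apply: stone_hausdorff => U V nU; rewrite nbhsE => -[V' [oV' V'i] V'V].
move: nU; rewrite nbhsE => -[U' [oU' U'p] U'U].
have [j [U'j /(hat_emb j (AA1 i)) ji]] :=
  stone_approx1 (openI oU' (open_hat [set i])) (conj U'p pi).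
by exists (emb i); split; [apply: U'U; rewrite -ji|exact: V'V].
Qed.

(** A finite set of embedded points is closed; removing it from [hat A] leaves an open set free of
    embedded points, hence empty by density. *)
Lemma hat_finite A p : finite_set A -> ~ range emb p -> ~ hat A p.
Proof.
move=> fA np pA; apply: np; apply: contrapT => np.
have cA : closed (emb @` A).
  apply: compact_closed stone_hausdorff _; apply: finite_compact.
  exact: finite_image.
have [i [/hat_emb h1 h2]] : exists i, (hat A `&` ~` (emb @` A)) (emb i).
  apply: (stone_approx1 (p := p)); first exact: openI (open_hat A) (closed_openC cA).
  by split=> // -[i _ ip]; apply: np; exists i.
by apply: h2; exists i => //; apply: h1; exact: hat_mem pA.
Qed.

(** If [hat A] held embedded points only, it would be a compact set covered by open singletons,
    hence finite. *)
Lemma hat_infinite A : AA A -> infinite_set A -> exists2 p, ~ range emb p & hat A p.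
Proof.
move=> a iA; apply: contrapT => h; apply: iA.
have hA p : hat A p -> range emb p.
  by move=> pA; apply: contrapT => np; apply: h; exists p.
have : compact (hat A) by apply: (subclosed_compact (closed_hat A) stone_compact).
move=> /(@compact_finite_cover _ _ stone (range emb) (fun p => [set p]))[||D _ Dcov].
- by move=> _ [i _ <-]; rewrite -hat1; exact: open_hat.
- by move=> p /hA pr; exists p.
apply: (@sub_finite_set _ _ (emb @^-1` [set` D])).
  by move=> i Ai; have [q /= qD iq] := Dcov _ ((hat_emb i a).2 Ai); rewrite iq.
apply: finite_preimage; last exact: finite_seq.
by move=> i j _ _; exact: emb_inj.
Qed.

Section Uniform.
Context {R : realType}.

Lemma continuous_uniform (f : stone -> R) (eps : R) : continuous f -> 0 < eps ->
  exists l, forall p q, cylinder p l q -> `|f p - f q| <= eps.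
Proof.
move=> cf e0; have e2 : 0 < eps / 2 by rewrite divr_gt0.
have h p : exists l, forall q, cylinder p l q -> `|f p - f q| <= eps / 2.
  have := cf p; move=> /cvgrPdist_le/(_ _ e2); rewrite near_simpl.
  rewrite /prop_near1 nbhsE => -[V [oV Vp] VU]; have [l lV] := oV _ Vp.
  by exists l => q /lV /VU.
have [l hl] := choice h.
have := stone_compact.
move=> /(@compact_finite_cover _ _ stone setT (fun p => cylinder p (l p)))[p _|p _|D _ Dcov].
- exact: open_cylinder.
- by exists p => //; exact: cylinder_refl.
exists (flatten [seq l p | p <- D]) => p q pq.
have [r rD rp] := Dcov p Logic.I.
have rq : cylinder r (l r) q.
  apply: cylinder_sub rp _ _; move: pq; rewrite /cylinder /= => /allP pq.
  apply/allP => A Al; apply: pq; apply/flatten_mapP; by exists r.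
rewrite (splitr eps) -(subrKA (f r)) (le_trans (ler_normD _ _))// lerD//.
  by rewrite distrC; exact: hl.
exact: hl.
Qed.

End Uniform.

End Stone.

(** * Bounded operators and complemented subspaces *)

Section BoundedOperators.
Context {R : realType} {V W : normedModType R}.

Lemma bounded_operator_continuous (f : {linear V -> W}) M :
  (forall x, `|f x| <= M * `|x|) -> continuous f.
Proof.
move=> fM; apply/linear_bounded_continuous/linear_boundedP.
near=> r => x; apply: le_trans (fM x) _.
by rewrite ler_wpM2r//; near: r; exact: nbhs_pinfty_ge.
Unshelve. all: by end_near. Qed.

Lemma continuous_operator_bounded (f : {linear V -> W}) :
  continuous f -> exists2 M, 0 < M & forall x, `|f x| <= M * `|x|.
Proof.
move=> /linear_bounded_continuous/linear_boundedP h.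
have [M [M0 hM]] : exists M, 0 < M /\ forall x, `|f x| <= M * `|x|.
  by near +oo_R => M; exists M; split; near: M => //; exact: nbhs_pinfty_gt.
by exists M.
Unshelve. all: by end_near. Qed.

End BoundedOperators.

Lemma projection_complemented (R : realType) (V : normedModType R)
    (p : {linear V -> V}) (Y : set V) :
  continuous p -> (forall x, p (p x) = p x) -> range p = Y -> complemented Y.
Proof.
move=> cp pp pY; split; last by exists p.
have -> : Y = (fun x => p x - x) @^-1` [set 0].
  rewrite -pY; apply/seteqP; split => [_ [x _ <-]|x /= /eqP].
    by rewrite /= pp subrr.
  by rewrite subr_eq0 => /eqP <-; exists x.
apply: preimage_closed; last first.
  exact/accessible_closed_set1/hausdorff_accessible/norm_hausdorff.
by move=> x _; apply: cvgB => //; exact: cp.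
Qed.

(** * The compactification defined by a family of slaloms *)

Section SlalomSpace.
Context {R : realType} {W : eqType} (S : W -> slalom).
Hypothesis sumS : forall w, @slalom_summable R (S w).

(** The algebra is described by its members instead of generators: unions of [agree] classes, with a
    free choice on the nodes below level [l]. That freedom puts every finite set in it. *)
Definition tree_sets : set (set node) :=
  [set A | exists l ws, forall u v, agree S l ws u v -> A u -> A v].

Lemma tree_setsT : tree_sets setT. Proof. by exists 0%N, [::]. Qed.

Lemma tree_setsC A : tree_sets A -> tree_sets (~` A).
Proof.
move=> [l [ws h]]; exists l, ws => u v uv Au Av; apply: Au.
exact: h (agree_sym uv) Av.
Qed.

Lemma tree_setsI A B : tree_sets A -> tree_sets B -> tree_sets (A `&` B).
Proof.
move=> [l [ws h]] [l' [ws' h']]; exists (maxn l l'), (ws ++ ws') => u v uv [Au Bu].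
split; [apply: h Au|apply: h' Bu]; apply: agree_mono uv.
- exact: leq_maxl.
- by move=> w wws; rewrite mem_cat wws.
- exact: leq_maxr.
- by move=> w wws; rewrite mem_cat wws orbT.
Qed.

Lemma tree_sets_cone s : tree_sets [set t | desc s t].
Proof.
exists (lev s), [::] => u v [lu lv uv _] [_ us]; split=> //.
by rewrite -uv.
Qed.

Lemma tree_sets_lev n : tree_sets [set t : node | (lev t < n)%N].
Proof. by exists n, [::] => u v [lu _ _ _] /=; rewrite ltnNge lu. Qed.

Lemma tree_sets1 s : tree_sets [set s].
Proof. by exists (lev s).+1, [::] => u v [lu _ _ _] us; move: lu; rewrite us ltnn. Qed.

Lemma tree_sets_avoid w m : tree_sets [set t | avoid (S w) m t].
Proof. by exists m, [:: w] => u v [_ _ _ h] /= /h; apply; rewrite mem_head. Qed.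

Local Notation L := (stone tree_sets).
Local Notation emb := (@emb _ tree_sets).
Local Notation hat := (@hat _ tree_sets).

Lemma hat_tree_emb A s : tree_sets A -> hat A (emb s) <-> A s.
Proof. exact: hat_emb. Qed.

Lemma tree_hatC A : tree_sets A -> hat (~` A) = ~` hat A.
Proof. exact: hatC tree_setsC _. Qed.

Lemma tree_hatI A B : tree_sets A -> tree_sets B -> hat (A `&` B) = hat A `&` hat B.
Proof. exact: hatI tree_setsI _ _. Qed.

Lemma tree_hatU A B : tree_sets A -> tree_sets B -> hat (A `|` B) = hat A `|` hat B.
Proof. exact: hatU tree_setsC tree_setsI _ _. Qed.

Lemma tree_hat1 s : hat [set s] = [set emb s].
Proof. exact: hat1 tree_sets1 _. Qed.

Lemma tree_hat_sub A B : tree_sets A -> tree_sets B -> A `<=` B -> hat A `<=` hat B.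
Proof. exact: hat_sub. Qed.

Lemma tree_hatT : hat setT = setT.
Proof. exact: hatT tree_setsT. Qed.

Lemma tree_hat0 : hat set0 = set0.
Proof. exact: hat0 tree_setsT tree_setsC. Qed.

Lemma tree_hat_finite A p : finite_set A -> ~ range emb p -> ~ hat A p.
Proof. exact: hat_finite. Qed.

Lemma tree_hat_infinite A : tree_sets A -> infinite_set A ->
  exists2 p, ~ range emb p & hat A p.
Proof. exact: hat_infinite tree_sets1 _. Qed.

Lemma tree_separation (F U : set L) : closed F -> open U -> F `<=` U ->
  exists A, [/\ tree_sets A, F `<=` hat A & hat A `<=` U].
Proof. exact: stone_separation tree_setsT tree_setsC tree_setsI _ _. Qed.

Lemma tree_base (p : L) U : open U -> U p ->
  exists A, [/\ tree_sets A, hat A p & hat A `<=` U].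
Proof. exact: stone_base tree_setsT tree_setsC tree_setsI _ _. Qed.

Lemma agree_cylinder (l : seq (set node)) : exists n ws, forall u v,
  agree S n ws u v -> cylinder (emb u) l (emb v).
Proof.
elim: l => [|A l [n [ws IH]]]; first by exists 0%N, [::].
have [[m [vs hA]]|nA] := pselect (tree_sets A).
  exists (maxn n m), (ws ++ vs) => u v uv; apply/andP; split; last first.
    apply: IH; apply: agree_mono uv; first exact: leq_maxl.
    by move=> w wws; rewrite mem_cat wws.
  have uv' : agree S m vs u v.
    apply: agree_mono uv; first exact: leq_maxr.
    by move=> w wws; rewrite mem_cat wws orbT.
  apply/eqP/asbool_equiv_eq; split=> -[? ?]; split=> //; apply: hA; try eassumption.
  exact: agree_sym.
exists n, ws => u v uv; apply/andP; split; last exact: IH.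
by apply/eqP/asbool_equiv_eq; split=> -[].
Qed.

Lemma continuous_stable (f : L -> R) : continuous f -> stable (f \o emb).
Proof.
move=> cf; have [M hM] : exists M, forall x, `|f x| <= M.
  by have := @Cspace_bounded R L (mkcts cf : continuousType L R).
apply: (uniform_stable sumS (M := M)) => [t|eps e0]; first exact: hM.
have [l hl] := continuous_uniform cf e0.
have [n [ws h]] := agree_cylinder l; exists n, ws => u v uv.
exact/hl/h.
Qed.

Definition node_of (p : L) : node := xget root [set s | emb s = p].

Lemma embK s : node_of (emb s) = s.
Proof.
apply: (emb_inj tree_sets1); rewrite /node_of.
exact: (xgetPex root (ex_intro (fun t => emb t = emb s) s erefl)).
Qed.

Definition c0_ext (g : node -> R) (p : L) : R :=
  if `[< range emb p >] then g (node_of p) else 0.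

Lemma c0_ext_emb g s : c0_ext g (emb s) = g s.
Proof. by rewrite /c0_ext asboolT ?embK//; exists s. Qed.

Lemma c0_ext_remainder g p : ~ range emb p -> c0_ext g p = 0.
Proof. by move=> np; rewrite /c0_ext asboolF. Qed.

(** Embedded nodes are isolated, and a point of the remainder has a neighbourhood free of the
    finitely many nodes of level below [N]. *)
Lemma c0_ext_continuous g :
  (forall eps : R, 0 < eps -> exists N, forall s, (N <= lev s)%N -> `|g s| <= eps) ->
  continuous (c0_ext g).
Proof.
move=> h p; apply/(@cvgrPdist_le R R _ (nbhs p) (nbhs_filter p)) => eps e0.
have [[s _ <-]|np] := pselect (range emb p).
  have : nbhs (emb s) (hat [set s]).
    by apply: open_nbhs_nbhs; split; [exact: open_hat|exact: (hat_tree_emb s (tree_sets1 s)).2].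
  by apply: filterS => q; rewrite tree_hat1 => ->; rewrite subrr normr0 ltW.
have [N hN] := h _ e0; rewrite (c0_ext_remainder g np).
pose A := [set t : node | (lev t < N)%N].
have tA : tree_sets A by exact: tree_sets_lev.
have : nbhs p (~` hat A).
  apply: open_nbhs_nbhs; split; first exact/closed_openC/closed_hat.
  apply: tree_hat_finite => //.
  by apply: sub_finite_set (finite_lev N) => t /= /ltnW.
apply: filterS => q qA; rewrite sub0r normrN.
have [[s _ sq]|nq] := pselect (range emb q); last by rewrite c0_ext_remainder// normr0 ltW.
rewrite -sq c0_ext_emb; apply: hN; rewrite leqNgt; apply/negP => sN; apply: qA.
by rewrite -sq; apply/(hat_tree_emb s tA).
Qed.

Section Projection.

Lemma proj_c0_continuous (f : Cspace R L) :
  continuous (c0_ext (fun s => f (emb s) - nu (f \o emb) s)).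
Proof.
apply: c0_ext_continuous => eps e0.
have [N hN] := nu_near (continuous_stable (@cts_fun _ _ f)) e0.
by exists N => s /hN; rewrite distrC.
Qed.

Definition proj_c0 (f : Cspace R L) : Cspace R L :=
  (mkcts (@proj_c0_continuous f) : continuousType L R).

Lemma proj_c0_emb (f : Cspace R L) s : proj_c0 f (emb s) = f (emb s) - nu (f \o emb) s.
Proof. exact: c0_ext_emb. Qed.

Lemma proj_c0_remainder f p : ~ range emb p -> proj_c0 f p = 0.
Proof. exact: c0_ext_remainder. Qed.

Lemma proj_c0_linear : linear proj_c0.
Proof.
move=> a f g; apply: CspaceP => p.
change (proj_c0 (a *: f + g) p = a * proj_c0 f p + proj_c0 g p).
have [[s _ <-]|np] := pselect (range emb p); last by rewrite !proj_c0_remainder// mulr0 addr0.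
rewrite !proj_c0_emb.
have cf := continuous_stable (@cts_fun _ _ f).
have cg := continuous_stable (@cts_fun _ _ g).
have -> : nu ((a *: f + g : Cspace R L) \o emb) s =
    a * nu (f \o emb) s + nu (g \o emb) s.
  rewrite -nuZ// -nuD//.
  exact: (continuous_stable (@cts_fun _ _ (a *: f : Cspace R L))).
by rewrite /= mulrBr opprD addrACA.
Qed.

HB.instance Definition _ := GRing.isLinear.Build R (Cspace R L) (Cspace R L) _
  proj_c0 proj_c0_linear.

Lemma nu_c0 (g : node -> R) s :
  (forall eps : R, 0 < eps -> exists N, forall t, (N <= lev t)%N -> `|g t| <= eps) ->
  nu g s = 0.
Proof.
move=> h; apply/cvg_lim => //; apply/cvgrPdist_le => eps e0.
have [N hN] := h _ e0; exists N => // r /= Nr; rewrite sub0r normrN.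
apply: (le_trans (ler_norm_avg _ _ _)); rewrite -[leRHS](avg_cst r eps s).
by apply: ler_avg => t _ lt; apply: hN; rewrite lt (leq_trans Nr)// leq_addl.
Qed.

Lemma range_emb_open : open (range emb).
Proof.
have -> : range emb = \bigcup_(s in [set: node]) hat [set s].
  apply/seteqP; split=> [_ [s _ <-]|p [s _]]; last first.
    by rewrite tree_hat1 => ->; exists s.
  by exists s => //; rewrite tree_hat1.
by apply: bigcup_open => s _; exact: open_hat.
Qed.

Lemma hat_range_finite A : tree_sets A -> hat A `<=` range emb -> finite_set A.
Proof.
move=> tA Ar; apply: contrapT => iA.
by have [p np /Ar] := tree_hat_infinite tA iA.
Qed.

Lemma finite_bounded_lev (A : set node) : finite_set A ->
  exists N, forall s, (N <= lev s)%N -> ~ A s.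
Proof.
move=> /finite_seqP[l ->]; exists (\max_(s <- l) lev s).+1 => s ls /= sl.
by move: ls; rewrite ltnNge (leq_bigmax_seq _ sl).
Qed.

(** The set where [|f|] is at least [eps] is closed and consists of embedded nodes. Separation
    inside the open set [range emb] encloses it in a hat without points of the remainder, and only
    finite sets have such hats. *)
Lemma natural_c0_small (f : Cspace R L) : (forall p, ~ range emb p -> f p = 0) ->
  forall eps : R, 0 < eps -> exists N, forall s, (N <= lev s)%N -> `|f (emb s)| <= eps.
Proof.
move=> f0 eps e0.
have cf : closed ((fun p => `|f p|) @^-1` [set x | eps <= x]).
  apply: preimage_closed; last exact: closed_ge.
  move=> p _; apply: (@cvg_norm _ _ _ (nbhs p) _ (f : L -> R) (f p)).
  exact: (@cts_fun _ _ f p).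
have [|A [tA FA AU]] := tree_separation cf range_emb_open.
  move=> p /= ep; apply: contrapT => np; move: ep.
  by rewrite f0// normr0 leNgt e0.
have [N hN] := finite_bounded_lev (hat_range_finite tA AU).
exists N => s /hN sA; rewrite leNgt; apply/negP => es; apply: sA.
by apply/(hat_tree_emb s tA); apply: FA; exact: ltW.
Qed.

Lemma proj_c0_id (f : Cspace R L) : (forall p, ~ range emb p -> f p = 0) -> proj_c0 f = f.
Proof.
move=> f0; apply: CspaceP => p; change (proj_c0 f p = f p).
have [[s _ <-]|np] := pselect (range emb p); last by rewrite proj_c0_remainder// f0.
rewrite proj_c0_emb nu_c0 ?subr0// => eps e0.
exact: natural_c0_small.
Qed.

Lemma norm_nu_le (f : Cspace R L) s : `|nu (f \o emb) s| <= `|f|.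
Proof.
have sf := continuous_stable (@cts_fun _ _ f).
have sc c : stable (fun _ : node => c : R).
  by move=> eps e0; exists 0%N => t _ r; rewrite subrr normr0 avg_cst ltW.
have fn t : `|f (emb t)| <= `|f| by apply: supnorm_ge; exact: Cspace_bounded.
rewrite ler_norml -(nu_cst (- `|f|) s) -{2}(nu_cst `|f| s).
by apply/andP; split; apply: ler_nu => // t; have := fn t; rewrite ler_norml => /andP[].
Qed.

Lemma proj_c0_bounded (f : Cspace R L) : `|proj_c0 f| <= 2 * `|f|.
Proof.
apply: supnorm_le => [|p]; first by rewrite mulr_ge0.
have [[s _ <-]|np] := pselect (range emb p); last first.
  by rewrite [X in `|X|](proj_c0_remainder f np) normr0 mulr_ge0.
rewrite [X in `|X|]proj_c0_emb (le_trans (ler_normB _ _))// mulr_natl mulr2n lerD ?norm_nu_le//.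
by apply: supnorm_ge; exact: Cspace_bounded.
Qed.

End Projection.

Section Enumerated.
Variable en : nat -> node.
Hypotheses (en_inj : injective en) (en_surj : forall s, exists n, en n = s).

Local Notation e := (emb \o en).

Lemma range_enum : range e = range emb.
Proof.
apply/seteqP; split=> [_ [n _ <-]|_ [s _ <-]]; first by exists (en n).
by have [n <-] := en_surj s; exists n.
Qed.

Lemma slalom_compactification : is_compactification e.
Proof.
split.
- by move=> m n /(emb_inj tree_sets1)/en_inj.
- move=> n; exists (hat [set en n]); first exact: open_hat.
  by rewrite tree_hat1 range_enum; apply: setIidl => _ ->; exists (en n).
- rewrite range_enum => U [p Up] oU; have [s Us] := stone_approx1 oU Up.
  by exists (emb s); split=> //; exists s.
Qed.

Lemma slalom_complemented : complemented (natural_c0 e R).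
Proof.
have cp : continuous proj_c0 := bounded_operator_continuous (f := proj_c0) proj_c0_bounded.
apply: (projection_complemented cp) => [f|].
  by apply: proj_c0_id => p; exact: proj_c0_remainder.
rewrite /natural_c0 /remainder range_enum; apply/seteqP; split=> [_ [f _ <-] p|f f0].
  exact: proj_c0_remainder.
by exists f => //; exact: proj_c0_id.
Qed.

End Enumerated.

End SlalomSpace.

(** * Radon measures from additive contents on clopen sets *)

Section RadonExtension.
Context {R : realType} {T : topologicalType}.
Variable m : set T -> R.
Hypothesis compactT : compact [set: T].
Hypothesis clopen_base : forall (U : set T) x, open U -> U x ->
  exists C, [/\ clopen C, C x & C `<=` U].
Hypothesis m_ge0 : forall C, 0 <= m C.
Hypothesis m_add : forall C D, clopen C -> clopen D -> C `&` D = set0 ->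
  m (C `|` D) = m C + m D.

Let clopen0 : clopen (set0 : set T).
Proof. by split; [exact: open0|exact: closed0]. Qed.

Let clopenD (C D : set T) : clopen C -> clopen D -> clopen (C `\` D).
Proof.
move=> c [oD cD]; rewrite setDE; apply: clopenI => //.
by split; [exact: closed_openC|exact: open_closedC].
Qed.

Let m0 : m set0 = 0.
Proof.
have /eqP := m_add clopen0 clopen0 (setI0 _).
by rewrite setU0 -{1}[m set0]addr0 (inj_eq (addrI _)) eq_sym => /eqP.
Qed.

Let m_sub C D : clopen C -> clopen D -> C `<=` D -> m C <= m D.
Proof.
move=> c d CD; rewrite -(setDUK CD) m_add ?lerDl//; first exact: clopenD.
by rewrite setDE setICA setICr setI0.
Qed.

Let m_union C D : clopen C -> clopen D -> m (C `|` D) <= m C + m D.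
Proof.
move=> c d; have -> : C `|` D = C `|` (D `\` C).
  apply/seteqP; split=> x [Cx|]; try by left.
    by move=> Dx; have [Cx|nC] := pselect (C x); [left|right].
  by case; right.
rewrite m_add//; [|exact: clopenD|by rewrite setDE setICA setICr setI0].
by rewrite lerD2l; apply: m_sub => //; exact: clopenD.
Qed.

Let open_content (U : set T) : \bar R :=
  ereal_sup [set (m C)%:E | C in [set C | clopen C /\ C `<=` U]].

(** The Riesz construction: open sets are measured from inside by clopen sets, other sets from
    outside by open sets. Finite additivity of [m] is enough, compactness supplying countable
    subadditivity. *)
Definition radon_outer (E : set T) : \bar R :=
  ereal_inf [set open_content U | U in [set U | open U /\ E `<=` U]].

Let content_ge C U : clopen C -> C `<=` U -> ((m C)%:E <= open_content U)%E.
Proof. by move=> c CU; apply: ereal_sup_ubound; exists C. Qed.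

Let content_le U V : U `<=` V -> (open_content U <= open_content V)%E.
Proof.
move=> UV; apply: ge_ereal_sup => _ [C [c CU] <-].
by apply: content_ge => //; exact: subset_trans UV.
Qed.

Let content_ge0 U : (0 <= open_content U)%E.
Proof. by rewrite -[0%E]/(0%:E) -m0; apply: content_ge => //; exact: sub0set. Qed.

Lemma radon_outer_open U : open U -> radon_outer U = open_content U.
Proof.
move=> oU; apply/le_anti/andP; split; first by apply: ereal_inf_lbound; exists U => //; split.
by apply: le_ereal_inf_tmp => _ [V [_ UV] <-]; exact: content_le.
Qed.

Lemma radon_outer_clopen_ge C U : clopen C -> open U -> C `<=` U ->
  ((m C)%:E <= radon_outer U)%E.
Proof. by move=> c oU CU; rewrite radon_outer_open//; exact: content_ge. Qed.

Lemma radon_outer_ge0 E : (0 <= radon_outer E)%E.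
Proof. by apply: le_ereal_inf_tmp => _ [V [_ UV] <-]; exact: content_ge0. Qed.

Lemma radon_outer_le : {homo radon_outer : E F / E `<=` F >-> (E <= F)%E}.
Proof.
move=> E F EF; apply: ereal_inf_le_tmp => _ [U [oU FU] <-].
by exists U => //; split=> //; exact: subset_trans FU.
Qed.

Lemma radon_outer_fin E : radon_outer E \is a fin_num.
Proof.
rewrite ge0_fin_numE ?radon_outer_ge0//.
apply: (@le_lt_trans _ _ (m setT)%:E); last exact: ltry.
apply: (le_trans (radon_outer_le (subsetT E))); rewrite radon_outer_open; last exact: openT.
apply: ge_ereal_sup => _ [C [c CU] <-]; rewrite lee_fin; apply: m_sub => //.
by split; [exact: openT|exact: closedT].
Qed.

Lemma radon_outer0 : radon_outer set0 = 0%E.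
Proof.
rewrite radon_outer_open; last exact: open0.
apply/le_anti/andP; split; last exact: content_ge0.
by apply: ge_ereal_sup => _ [C [c C0] <-]; rewrite (subset0 C) in C0; rewrite C0 m0.
Qed.

Let m_bigcup (E : nat -> set T) N C : clopen C -> (forall n, clopen (E n)) ->
  (forall x, C x -> exists2 n, (n < N)%N & E n x) -> m C <= \sum_(0 <= n < N) m (E n).
Proof.
elim: N C => [|N IH] C c cE CE.
  rewrite big_geq// (_ : C = set0) ?m0//; apply/seteqP; split=> // x /CE[n].
  by rewrite ltn0.
rewrite big_nat_recr//= -(setUIDK C (E N)).
apply: le_trans (m_union (clopenI c (cE N)) (clopenD c (cE N))) _.
rewrite addrC lerD//.
  by apply: m_sub => //; exact: clopenI.
apply: IH => //; first exact: clopenD.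
move=> x [/CE[n nN En] nE]; exists n => //; move: nN; rewrite ltnS leq_eqVlt.
by move=> /orP[/eqP nN|//]; case: nE; rewrite -nN.
Qed.

(** A clopen set inside the union is compact, hence covered by finitely many clopen pieces, each
    inside a single [U n]; finite subadditivity of [m] applies once the pieces are grouped by
    [n]. *)
Let content_bigcup (U : nat -> set T) : (forall n, open (U n)) ->
  (open_content (\bigcup_n U n) <= \sum_(n <oo) open_content (U n))%E.
Proof.
move=> oU; apply: ge_ereal_sup => _ [C [c CU] <-].
have h x : exists nD : nat * set T, C x -> [/\ clopen nD.2, nD.2 x & nD.2 `<=` U nD.1].
  have [/CU[n _ Un]|nC] := pselect (C x); last by exists (0%N, set0).
  by have [D [? ? ?]] := clopen_base (oU n) Un; exists (n, D).
have [f hf] := choice h.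
have cC : compact C by apply: (subclosed_compact _ compactT) => //; case: c.
have [||s sC sc] := @compact_finite_cover T C T C (fun x => (f x).2) cC.
- by move=> x /hf[[]].
- by move=> x Cx; exists x => //; case: (hf _ Cx).
pose E n := \big[setU/set0]_(x <- s | (f x).1 == n) (f x).2.
have cE n : clopen (E n).
  rewrite /E big_seq_cond; apply: big_ind => //; first by move=> ? ?; exact: clopenU.
  by move=> x /andP[/sC/hf[]].
have EU n : E n `<=` U n.
  rewrite /E -bigcup_seq_cond => y [x /= /andP[/sC/hf[_ _ fU] /eqP <-]]; exact: fU.
have fE x : x \in s -> (f x).2 `<=` E (f x).1.
  by move=> xs y fy; rewrite /E -bigcup_seq_cond; exists x => //=; rewrite xs eqxx.
pose N := (\max_(x <- s) (f x).1).+1.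
apply: (@le_trans _ _ (\sum_(0 <= n < N) (m (E n))%:E)%E).
  rewrite sumEFin lee_fin; apply: m_bigcup => // x /sc[y ys fy].
  exists (f y).1; last exact: fE.
  by rewrite ltnS; exact: (@leq_bigmax_seq _ s predT (fun x => (f x).1) y).
apply: (@le_trans _ _ (\sum_(0 <= n < N) open_content (U n))%E).
  by apply: lee_sum => n _; exact: content_ge.
exact: nneseries_lim_ge.
Qed.

Lemma radon_outer_sigma_subadditive : sigma_subadditive radon_outer.
Proof.
move=> F; apply/lee_addgt0Pr => eps e0.
have h n : exists U, [/\ open U, F n `<=` U &
    (open_content U <= radon_outer (F n) + (eps / (2 ^ n.+1)%:R)%:E)%E].
  have en : 0 < eps / (2 ^ n.+1)%:R by rewrite divr_gt0// ltr0n expn_gt0.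
  have [_ [U [oU FU] <-] /ltW lU] := lb_ereal_inf_adherent en (radon_outer_fin (F n)).
  by exists U.
have [U hU] := choice h.
apply: (@le_trans _ _ (\sum_(n <oo) open_content (U n))%E).
  apply: le_trans (content_bigcup (fun n => let: And3 a _ _ := hU n in a)).
  apply: ereal_inf_lbound; exists (\bigcup_n U n) => //; split.
    by apply: bigcup_open => n _; case: (hU n).
  by apply: subset_bigcup => n _; case: (hU n).
apply: (le_trans (lee_nneseries _ _)); last first.
- apply: epsilon_trick; [exact: (fun n => radon_outer_ge0 (F n))|exact: ltW].
- by move=> n _; case: (hU n).
- by move=> n _ _; exact: content_ge0.
Qed.

Definition radon_outer_measure : {outer_measure set T -> \bar R} :=
  HB.pack radon_outer (isOuterMeasure.Build R T radon_outer
    radon_outer0 radon_outer_ge0 radon_outer_le radon_outer_sigma_subadditive).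

(** Inside an open [V] around the test set, exhaust the part of [V] in [U] by a clopen [C], and the
    rest of [V] off [C] by a clopen [D]. These are disjoint, so [m C + m D] stays below the content
    of [V], while [V] without [C] still covers the part of the test set outside [U]. *)
Lemma open_caratheodory U : open U -> radon_outer.-caratheodory U.
Proof.
move=> oU; apply: (@le_caratheodory_measurable _ _ radon_outer_measure) => X.
apply: le_ereal_inf_tmp => _ [V [oV XV] <-].
have oVU : open (V `&` U) by exact: openI.
apply: (@le_trans _ _ (open_content (V `&` U) + radon_outer (X `&` ~` U))%E).
  by rewrite leeD2r// -radon_outer_open//; apply: radon_outer_le; exact: setSI.
rewrite -leeBrDr ?radon_outer_fin//; apply: ge_ereal_sup => _ [C [c CVU] <-].
rewrite leeBrDr ?radon_outer_fin//.
have oVC : open (V `\` C) by rewrite setDE; apply: openI => //; apply: closed_openC; case: c.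
apply: (@le_trans _ _ ((m C)%:E + open_content (V `\` C))%E).
  rewrite leeD2l//; apply: ereal_inf_lbound; exists (V `\` C) => //; split=> //.
  by move=> x [Xx nU]; split; [exact: XV|move=> /CVU[]].
rewrite addeC -leeBrDr//; apply: ge_ereal_sup => _ [D [d DVC] <-].
rewrite leeBrDr// -EFinD addrC -m_add//; last first.
  by apply/seteqP; split=> // x [Cx /DVC[]].
apply: content_ge; first exact: clopenU.
by rewrite subUset; split=> x; [move=> /CVU[]|move=> /DVC[]].
Qed.

End RadonExtension.

Section RadonMeasure.
Context {R : realType} {T : topologicalType} (x0 : T).
Variable m : set T -> R.
Hypothesis compactT : compact [set: T].
Hypothesis clopen_base : forall (U : set T) x, open U -> U x ->
  exists C, [/\ clopen C, C x & C `<=` U].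
Hypothesis m_ge0 : forall C, 0 <= m C.
Hypothesis m_add : forall C D, clopen C -> clopen D -> C `&` D = set0 ->
  m (C `|` D) = m C + m D.

Let mu_out : {outer_measure set (pointed_at x0) -> \bar R} :=
  radon_outer_measure compactT clopen_base m_ge0 m_add.

Definition radon_measure (E : set (borel x0)) : \bar R := radon_outer m E.

Lemma borel_caratheodory (B : set (borel x0)) : measurable B ->
  (radon_outer m).-caratheodory (B : set T).
Proof.
move=> mB; suff : <<s @open (pointed_at x0)>> `<=` mu_out.-caratheodory by apply.
apply: smallest_sub => [|U oU]; last exact: open_caratheodory.
split; first exact: caratheodory_measurable_set0.
  by move=> A mA; rewrite setTD; exact: caratheodory_measurable_setC.
exact: caratheodory_measurable_bigcup.
Qed.

Let radon_measure0 : radon_measure set0 = 0%E.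
Proof. exact: (outer_measure0 mu_out). Qed.

Let radon_measure_ge0 B : (0 <= radon_measure B)%E.
Proof. exact: (outer_measure_ge0 mu_out). Qed.

Let radon_measure_sigma_additive : semi_sigma_additive radon_measure.
Proof.
move=> F mF tF mUF.
apply: (@caratheodory_measure_sigma_additive R (pointed_at x0) mu_out F) => // [i|].
  exact: borel_caratheodory.
exact: borel_caratheodory.
Qed.

HB.instance Definition _ := isMeasure.Build _ _ _ radon_measure
  radon_measure0 radon_measure_ge0 radon_measure_sigma_additive.

Let radon_measure_fin : fin_num_fun radon_measure.
Proof. by move=> B _; exact: radon_outer_fin. Qed.

HB.instance Definition _ := Measure_isFinite.Build _ _ _ radon_measure
  radon_measure_fin.

Definition radon_finite_measure : {finite_measure set (borel x0) -> \bar R} :=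
  radon_measure.

(** Inner regularity of [B] is outer regularity of its complement: an open set around the complement
    of [B] leaves a closed, hence compact, subset of [B], and the total mass is finite. *)
Lemma radon_measure_radon : radon radon_measure.
Proof.
move=> B mB; apply/le_anti/andP; split; last first.
  by apply: ge_ereal_sup => _ [C [_ CB] <-]; exact: (le_outer_measure mu_out).
apply/lee_addgt0Pr => eps e0.
have [_ [U [oU BU] <-] lU] := lb_ereal_inf_adherent e0
  (radon_outer_fin m_ge0 m_add (~` B)).
have fin X : radon_outer m X \is a fin_num := radon_outer_fin m_ge0 m_add X.
have split_T X : (radon_outer m).-caratheodory X ->
    fine (radon_outer m X) + fine (radon_outer m (~` X)) = fine (radon_outer m setT).
  by move=> /(_ setT) ->; rewrite fineD// !setTI.
have hB := split_T _ (borel_caratheodory mB).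
have hU := split_T _ (open_caratheodory compactT clopen_base m_ge0 m_add oU).
apply: (@le_trans _ _ (radon_outer m (~` U) + eps%:E)%E); last first.
  rewrite leeD2r//; apply: ereal_sup_ubound; exists (~` U) => //; split.
    by apply: (subclosed_compact _ compactT) => //; exact: open_closedC.
  by move=> x nU; apply: contrapT => nB; apply: nU; exact: BU.
have : (radon_outer m U < radon_outer m (~` B) + eps%:E)%E.
  by rewrite radon_outer_open.
rewrite /radon_measure -(fineK (fin U)) -(fineK (fin (~` B))) -(fineK (fin (~` U))) -(fineK (fin B)).
by rewrite -!EFinD lte_fin lee_fin; lra.
Qed.

End RadonMeasure.

Theorem clopen_content_supports_measure (R : realType) (T : topologicalType) (m : set T -> R) :
  compact [set: T] ->
  (forall (U : set T) x, open U -> U x -> exists C, [/\ clopen C, C x & C `<=` U]) ->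
  (forall C, 0 <= m C) ->
  (forall C, clopen C -> C !=set0 -> 0 < m C) ->
  (forall C D, clopen C -> clopen D -> C `&` D = set0 -> m (C `|` D) = m C + m D) ->
  supports_measure R T.
Proof.
move=> cT base m_ge0 m_gt0 m_add x0.
exists (radon_finite_measure x0 cT base m_ge0 m_add); split; first exact: radon_measure_radon.
move=> U oU [x Ux]; have [C [c Cx CU]] := base U x oU Ux.
apply: (@lt_le_trans _ _ (m C)%:E); first by rewrite lte_fin m_gt0//; exists x.
exact: radon_outer_clopen_ge.
Qed.

(** * Measure and non-separability of the remainder *)

Lemma compact_set_type (T : topologicalType) (A : set T) :
  compact A -> compact [set: set_type A].
Proof.
move=> cA F PF _; have FA : (set_val @ F) A.
  suff : F (set_val @^-1` A) by [].
  by apply: (@filterE _ F) => x; exact: set_valP.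
have [p [Ap clp]] := cA _ _ FA; exists (SigSub (mem_set Ap)); split=> // B V FB.
rewrite nbhsE => -[_ [[U oU <-] Up] UV].
have : (set_val @ F) (set_val @` B) by apply: (@filterS _ F _ B) FB => x Bx; exists x.
have nU : nbhs p U by exact: open_nbhs_nbhs.
by move=> /clp/(_ nU)[_ [[x Bx <-] Ux]]; exists x; split=> //; exact: UV.
Qed.

Section SlalomRemainder.
Context {R : realType} {W : eqType} (S : W -> slalom).
Hypothesis sumS : forall w, @slalom_summable R (S w).

Local Notation L := (stone (tree_sets S)).
Local Notation emb := (@emb _ (tree_sets S)).
Local Notation hat := (@hat _ (tree_sets S)).

Definition ind (A : set node) (t : node) : R := `[< A t >]%:R.

Lemma ind_stable A : tree_sets S A -> stable (ind A).
Proof.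
move=> [l [ws hA]]; apply: (uniform_stable sumS (M := 1)) => [t|eps e0].
  by rewrite /ind ger0_norm// lern1 leq_b1.
exists l, ws => u v uv; rewrite /ind (_ : `[< A u >] = `[< A v >]) ?subrr ?normr0 ?ltW//.
by apply/asbool_equiv_eq; split; apply: hA => //; exact: agree_sym.
Qed.

(** The asymptotic proportion of members of [A] among the nodes of a level. *)
Definition charge A : R := nu (ind A) root.

Lemma charge_ge0 A : tree_sets S A -> 0 <= charge A.
Proof.
move=> tA; rewrite -(nu_cst 0 root); apply: ler_nu => //; last exact: ind_stable.
by move=> eps e0; exists 0%N => t _ r; rewrite subrr normr0 avg_cst ltW.
Qed.

Lemma infinite_lev (A : set node) N : infinite_set A -> exists2 s, A s & (N <= lev s)%N.
Proof.
move=> iA; apply: contrapT => h; apply: iA; apply: sub_finite_set (finite_lev N) => s As /=.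
by rewrite leqNgt; apply/negP => /ltnW Ns; apply: h; exists s.
Qed.

(** An infinite [A] has members of arbitrarily high level. At such a node the indicator is 1 and its
    limit average is within 1/2 of it. *)
Lemma charge_gt0 A : tree_sets S A -> infinite_set A -> 0 < charge A.
Proof.
move=> tA iA; have e2 : 0 < 2^-1 :> R by rewrite invr_gt0.
have [N hN] := nu_near (ind_stable tA) e2.
have [s As Ns] := infinite_lev N iA.
apply: (nu_root_gt0 (s := s)) (ind_stable tA) _ _; first by move=> t; rewrite /ind.
have := hN _ Ns; rewrite /ind asboolT//= ler_distl => /andP[+ _].
by apply: lt_le_trans; rewrite subr_gt0 invf_lt1// ltr1n.
Qed.

Lemma trace_finite A : tree_sets S A -> (forall p, ~ range emb p -> ~ hat A p) ->
  finite_set A.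
Proof.
by move=> tA h; apply: contrapT => /(tree_hat_infinite tA)[p np]; exact: h.
Qed.

(** The hypotheses speak of the remainder, so they control the sets only up to finitely many nodes.
    The indicators add up from some level on, which is all that limit averages see. *)
Lemma charge_add A B E : tree_sets S A -> tree_sets S B -> tree_sets S E ->
  (forall p, ~ range emb p -> hat E p <-> hat A p \/ hat B p) ->
  (forall p, ~ range emb p -> ~ (hat A p /\ hat B p)) ->
  charge E = charge A + charge B.
Proof.
move=> tA tB tE hE hAB; rewrite /charge -nuD; [|exact: ind_stable..].
apply: eq_nu; first by apply: stableD; exact: ind_stable.
have tAB := tree_setsI tA tB; have tnE := tree_setsC tE.
have tU : tree_sets S (A `|` B).
  by rewrite -[_ `|` _]setCK setCU; apply/tree_setsC/tree_setsI; exact: tree_setsC.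
have tnU := tree_setsC tU.
have f1 : finite_set (A `&` B).
  by apply: trace_finite => // p np; rewrite tree_hatI//; exact: hAB.
have f2 : finite_set (E `&` ~` (A `|` B)).
  apply: trace_finite; first exact: tree_setsI.
  by move=> p np; rewrite tree_hatI// tree_hatC// tree_hatU// => -[/(hE _ np)].
have f3 : finite_set ((A `|` B) `&` ~` E).
  apply: trace_finite; first exact: tree_setsI.
  by move=> p np; rewrite tree_hatI// tree_hatC// tree_hatU// => -[/(hE _ np)].
have [N hN] : exists N, forall s, (N <= lev s)%N ->
    ~ ((A `&` B) `|` ((E `&` ~` (A `|` B)) `|` ((A `|` B) `&` ~` E))) s.
  by apply: finite_bounded_lev; rewrite !finite_setU.
exists N => t /hN h; rewrite /ind.
have [At|At] := asboolP (A t); have [Bt|Bt] := asboolP (B t);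
  have [Et|Et] := asboolP (E t); rewrite /= ?addr0 ?add0r//.
- by case: h; left.
- by case: h; left.
- by case: h; right; right; split=> //; left.
- by case: h; right; right; split=> //; right.
- by case: h; right; left; split=> //; case.
Qed.

Lemma cone_child s :
  [set t | desc s t] = s |` \bigcup_(d < br (lev s)) [set t | desc (child s d) t].
Proof.
apply/seteqP; split=> [t st|t [->|[d /= dl]]]; last first.
- by apply: desc_trans; exact: desc_child.
- exact: desc_refl.
case: (st) => sl ts; move: sl; rewrite leq_eqVlt => /orP[/eqP sl|sl].
  by left; rewrite -ts trunc_id// sl.
right; exists (dig t (lev s)); first exact: dig_lt.
by rewrite -{1}ts -truncS//; exact: desc_trunc.
Qed.

Lemma hat_bigcup n (F : nat -> set node) : (forall i, (i < n)%N -> tree_sets S (F i)) ->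
  tree_sets S (\bigcup_(i < n) F i) /\
  hat (\bigcup_(i < n) F i) = \bigcup_(i < n) hat (F i).
Proof.
elim: n => [|n IH] tF.
  rewrite !II0 !bigcup_set0; split; last exact: tree_hat0.
  by rewrite -setCT; apply: tree_setsC; exact: tree_setsT.
have [t1 h1] := IH (fun i (h : (i < n)%N) => tF i (ltnW h)).
have tn := tF n (ltnSn n).
rewrite !IIS !bigcup_setU !bigcup_set1 tree_hatU// h1; split=> //.
by rewrite -[_ `|` _]setCK setCU; apply/tree_setsC/tree_setsI; exact: tree_setsC.
Qed.

(** A cone consists of its vertex and the cones of the children; a point of the remainder is not the
    vertex, so it descends to a child. *)
Lemma node_at_ex p n : ~ range emb p -> exists2 s, lev s = n & hat [set t | desc s t] p.
Proof.
move=> np; elim: n => [|n [s sn ps]].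
  exists root => //; rewrite (_ : mkset _ = setT) ?tree_hatT//.
  by apply/seteqP; split=> // t _; split=> //; exact: trunc0.
move: ps; rewrite cone_child.
have [t1 h1] := @hat_bigcup (br (lev s)) (fun d => [set t | desc (child s d) t])
  (fun d _ => tree_sets_cone S (child s d)).
rewrite tree_hatU ?h1 ?tree_hat1//; last exact: tree_sets1.
move=> [ps|[d /= dl pd]]; first by case: np; exists s.
by exists (child s d) => //; rewrite lev_child// sn.
Qed.

Definition node_at (p : L) n : node := xget root [set s | lev s = n /\ hat [set t | desc s t] p].

Lemma node_atP p n : ~ range emb p ->
  lev (node_at p n) = n /\ hat [set t | desc (node_at p n) t] p.
Proof.
move=> np; have [s sn ps] := node_at_ex n np; rewrite /node_at.
exact: (xgetPex root (ex_intro (fun s => _ /\ hat _ p) s (conj sn ps))).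
Qed.

Definition branch p n := dig (node_at p n.+1) n.

Lemma branch_lt p n : ~ range emb p -> (branch p n < br n)%N.
Proof. by move=> np; apply: dig_lt; have [-> _] := node_atP n.+1 np. Qed.

Lemma branch_avoid p w m n : ~ range emb p -> (m <= n)%N -> S w n (branch p n) ->
  ~ hat [set t | avoid (S w) m t] p.
Proof.
move=> np mn Sn pa; have [ln pn] := node_atP n.+1 np.
have : hat ([set t | avoid (S w) m t] `&` [set t | desc (node_at p n.+1) t]) p.
  by rewrite tree_hatI//; [exact: tree_sets_avoid|exact: tree_sets_cone].
rewrite (_ : _ `&` _ = set0) ?tree_hat0//; apply/seteqP; split=> // t [/= av].
rewrite /desc ln => -[lt tt]; have := av n; rewrite mn lt => /(_ isT).
by rewrite -(dig_trunc t (ltnSn n)) tt Sn.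
Qed.

(** Past a level where the tails of weights are at most 1/2, the slalom fills no level, so a node
    avoiding it can be extended digit by digit forever. *)
Lemma avoid_infinite w : exists m, infinite_set [set t | avoid (S w) m t].
Proof.
have [m hm] := sumS w (ltac:(rewrite invr_gt0//) : 0 < 2^-1 :> R).
have hd n : (m <= n)%N -> exists2 d, (d < br n)%N & ~~ S w n d.
  move=> mn; apply: contrapT => h; have := hm n.+1.
  rewrite big_nat_recr//= leNgt => /negP; apply.
  have -> : wt (S w) n = 1 :> R.
    rewrite /wt (eq_bigr (fun=> 1)); last first.
      by move=> d _; case: (boolP (S w n d)) => // Sd; case: h; exists d.
    by rewrite sumr_const card_ord divff// pnatr_eq0 -lt0n br_gt0.
  apply: (@lt_le_trans _ _ 1); first by rewrite invf_lt1// ltr1n.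
  by rewrite lerDr; apply: sumr_ge0 => i _; exact: wt_ge0.
exists m => fin; have [N hN] := finite_bounded_lev fin.
have [s sn av] : exists2 s, lev s = (m + N)%N & avoid (S w) m s.
  elim: N {hN} => [|N [s sn av]].
    have [s sm] := node_levels m; exists s; first by rewrite addn0.
    by move=> i; rewrite sm => /andP[mi]; rewrite ltnNge mi.
  have [d dl Sd] := hd (m + N)%N (leq_addr _ _).
  exists (child s d); first by rewrite lev_child ?sn// addnS.
  by apply/avoid_child; rewrite ?sn ?leq_addr.
by apply: (hN s) => //; rewrite sn leq_addl.
Qed.

Section Enumerated.
Variable en : nat -> node.
Hypotheses (en_inj : injective en) (en_surj : forall s, exists n, en n = s).

Local Notation e := (emb \o en).
Local Notation K := (set_type (remainder e)).

Let remP (x : K) : ~ range emb (set_val x).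
Proof. by rewrite -(range_enum S en_surj); exact: (@set_valP _ (remainder e) x). Qed.

Let remE p : ~ range emb p -> exists x : K, set_val x = p.
Proof.
rewrite -(range_enum S en_surj) => np.
by exists (SigSub (mem_set (np : remainder e p))).
Qed.

Lemma remainder_compact : compact (remainder e).
Proof.
apply: (subclosed_compact _ (@compact_setT L)) => //.
by apply: open_closedC; rewrite (range_enum S en_surj); exact: range_emb_open.
Qed.

Lemma open_trace A : open (set_val @^-1` hat A : set K).
Proof. by exists (hat A) => //; exact: open_hat. Qed.

Lemma clopen_trace A : clopen (set_val @^-1` hat A : set K).
Proof.
split; first exact: open_trace.
rewrite -[X in closed X]setCK; apply: open_closedC.
by exists (~` hat A) => //; exact/closed_openC/closed_hat.
Qed.

Lemma remainder_base (U : set K) x : open U -> U x ->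
  exists A, [/\ tree_sets S A, hat A (set_val x) & set_val @^-1` hat A `<=` U].
Proof.
move=> [V oV <-] Vx; have [A [tA Ax AV]] := tree_base oV Vx.
by exists A; split=> // y /AV.
Qed.

Lemma trace_separation (F U : set K) : closed F -> open U -> F `<=` U ->
  exists A, [/\ tree_sets S A, F `<=` set_val @^-1` hat A & set_val @^-1` hat A `<=` U].
Proof.
move=> cF oU FU.
have img (D : set K) : closed D -> closed (set_val @` D : set L).
  move=> cD; apply: compact_closed; first exact: hausdorff_setT.
  apply: continuous_compact.
    by apply: continuous_subspaceT; exact: initial_continuous.
  by apply: (subclosed_compact cD (compact_set_type remainder_compact)).
have [|A [tA FA AU]] := tree_separation (img _ cF) (closed_openC (img _ (open_closedC oU))).
  by move=> _ [x Fx <-] [y nUy /val_inj yx]; apply: nUy; rewrite yx; exact: FU.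
exists A; split=> // [x Fx|x /AU nx]; first by apply: FA; exists x.
by apply: contrapT => nUx; apply: nx; exists x.
Qed.

Lemma clopen_traceE (C : set K) : clopen C ->
  exists2 A, tree_sets S A & C = set_val @^-1` hat A.
Proof.
move=> [oC cC]; have [A [tA CA AC]] := trace_separation cC oC (@subset_refl _ C).
by exists A => //; apply/seteqP.
Qed.

(** Two representatives of one trace differ by a finite set, so the choice is immaterial. A set
    without representative gets the charge of [set0], which keeps the function nonnegative
    everywhere. *)
Definition trace_charge (C : set K) : R :=
  charge (xget set0 [set A | tree_sets S A /\ C = set_val @^-1` hat A]).

Lemma trace_chargeP C : exists A, [/\ tree_sets S A, trace_charge C = charge A &
  clopen C -> C = set_val @^-1` hat A].
Proof.
rewrite /trace_charge; set P := mkset _.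
exists (xget set0 P); case: xgetP => [A _ [tA CA]|nP]; split=> //.
  by rewrite -setCT; apply: tree_setsC; exact: tree_setsT.
by move=> /clopen_traceE[A tA CA]; case: (nP A).
Qed.

Lemma slalom_supports_measure : supports_measure R K.
Proof.
apply: (clopen_content_supports_measure (m := trace_charge)).
- exact: compact_set_type remainder_compact.
- move=> U x oU Ux; have [A [tA Ax AU]] := remainder_base oU Ux.
  by exists (set_val @^-1` hat A); split=> //; exact: clopen_trace.
- by move=> C; have [A [tA -> _]] := trace_chargeP C; exact: charge_ge0.
- move=> C cC [x Cx]; have [A [tA -> CA]] := trace_chargeP C.
  apply: charge_gt0 => // fA; move: Cx; rewrite CA//.
  exact: tree_hat_finite fA (@remP x).
- move=> C D cC cD CD.
  have [A [tA -> /(_ cC) CA]] := trace_chargeP C.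
  have [B [tB -> /(_ cD) DB]] := trace_chargeP D.
  have [E [tE -> /(_ (clopenU cC cD)) CDE]] := trace_chargeP (C `|` D).
  apply: charge_add => // p np; have [x <-] := remE np.
    have := congr1 (@^~ x) CDE; rewrite CA DB /= => h.
    by rewrite h.
  move=> [pA pB]; suff : (C `&` D) x by rewrite CD.
  by rewrite CA DB.
Qed.

(** Take a slalom entered infinitely often by the branches of all points of a countable dense [D]:
    the nodes avoiding it from [m] on have a nonempty open trace containing no point of [D]. *)
Lemma slalom_nonseparable :
  (forall x : nat -> nat -> nat, (forall i n, (x i n < br n)%N) ->
    exists w, forall i N, exists2 n, (N <= n)%N & S w n (x i n)) ->
  ~ separable K.
Proof.
move=> catch [D /pcard_injP[f finj] dD].
have h i : exists x : nat -> nat, (forall n, (x n < br n)%N) /\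
    forall p, D p -> f p = i -> x = branch (set_val p).
  have [[p Dp fp]|np] := pselect (exists2 p, D p & f p = i).
    exists (branch (set_val p)); split=> [n|q Dq fq]; first exact: branch_lt (@remP p).
    by congr (branch (set_val _)); apply: finj; rewrite ?inE// fp.
  (* An index that codes no point of [D] receives an arbitrary admissible branch. *)
  exists (fun=> 0%N); split=> [n|q Dq fq]; first exact: br_gt0.
  by case: np; exists q.
have [x hx] := choice h.
have [w hw] := catch x (fun i => (hx i).1).
have [m im] := avoid_infinite w.
have [p np pm] := tree_hat_infinite (tree_sets_avoid S w m) im.
have [y yp] := remE np.
have [|q [qm Dq]] := dD _ _ (open_trace [set t | avoid (S w) m t]).
  by exists y; rewrite /= yp.
have [n mn Sn] := hw (f q) m.
apply: (branch_avoid (@remP q) mn _ qm).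
by rewrite -((hx (f q)).2 q Dq erefl).
Qed.

End Enumerated.
End SlalomRemainder.

(** * Independent families *)

Definition almost_sub (S S' : slalom) :=
  exists N, forall n d, (N <= n)%N -> (d < br n)%N -> S n d -> S' n d.

(** Among comparable predicates the count on [s] determines the predicate; traces of nested slaloms
    are identified by such a count. *)
Lemma count_subpred_eq (T : eqType) (a b : pred T) (s : seq T) :
  {in s, subpred a b} -> count a s = count b s -> {in s, a =1 b}.
Proof.
elim: s => [//|x s IH] ab.
have abx : a x -> b x by apply: ab; exact: mem_head.
have abs : {in s, subpred a b} by move=> y ys; apply: ab; rewrite inE ys orbT.
have le : (count a s <= count b s)%N.
  by elim: s abs {IH ab} => //= y s IH abs; rewrite leq_add//;
    [|apply: IH => z zs; apply: abs; rewrite inE zs orbT];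
     case ay : (a y) => //; rewrite (abs y (mem_head _ _) ay).
move=> /= e; have [ex es] : a x = b x /\ count a s = count b s.
  case: (a x) (b x) abx e => -[] //= abx.
  - by rewrite !add1n => -[].
  - by have := abx isT.
  - by move: le; rewrite add0n add1n => le e; rewrite e ltnn in le.
by move=> y; rewrite inE => /predU1P[->//|]; exact: IH.
Qed.

Lemma find_uniq_flatten (T : eqType) (G : seq (seq T)) i (w : T) :
  uniq (flatten G) -> (i < size G)%N -> w \in nth [::] G i ->
  find (fun F => w \in F) G = i.
Proof.
elim: G i => [//|F G IH] [|i] /=; first by move=> _ _ ->.
rewrite cat_uniq ltnS => /and3P[_ /hasPn FG uG] iG wi.
case: ifPn => wF; last by rewrite (IH i).
have : w \in flatten G by apply/flattenP; exists (nth [::] G i) => //; exact: mem_nth.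
by move=> /FG; rewrite /= wF.
Qed.

Lemma uniq_flatten_mem (T : eqType) (G : seq (seq T)) F :
  uniq (flatten G) -> F \in G -> uniq F.
Proof.
elim: G => [//|E G IH] /=; rewrite cat_uniq inE => /and3P[uE _ uG] /predU1P[->//|].
exact: IH.
Qed.

Lemma exp2_gt_linear k : exists N, (N * k + 1 < 2 ^ N)%N.
Proof.
(* With m = 2k + 2 and N = 2m, the square of 2^m is at least (m + 1)^2, which exceeds 2mk + 1. *)
exists (2 * (2 * k + 2))%N; set m := (2 * k + 2)%N.
rewrite mul2n -addnn expnD; have := ltn_expl m (ltnSn 1); rewrite {1}/m.
set e := (2 ^ m)%N => he.
have : ((m + 1) * (m + 1) <= e * e)%N by apply: leq_mul; rewrite addn1.
by rewrite /m; nia.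
Qed.

Section NoCube.
Context {W : eqType} (S : W -> slalom).
Hypothesis chainS : forall v w, almost_sub (S v) (S w) \/ almost_sub (S w) (S v).

Section Independent.
Context {J : choiceType} (A : J -> set node) (ld : J -> nat) (vs : J -> seq W).
Hypothesis hA : forall j u v, agree S (ld j) (vs j) u v -> A j u -> A j v.
Hypothesis realized : forall (l : seq J) (eps : J -> bool) n,
  exists2 u, (n <= lev u)%N & forall j, j \in l -> A j u <-> eps j.
Variables (k N : nat).
Hypothesis kN : (N * k + 1 < 2 ^ N)%N.

Let slaloms_of (F : seq J) := flatten [seq vs j | j <- F].

(** Between finitely many slaloms almost inclusions are inclusions from some level on; there all
    sets of the block can be read at once. *)
Definition nested n (F : seq J) :=
  (forall j, j \in F -> (ld j <= n)%N) /\
  (forall v w, v \in slaloms_of F -> w \in slaloms_of F ->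
     (forall i d, (n <= i)%N -> (d < br i)%N -> S v i d -> S w i d) \/
     (forall i d, (n <= i)%N -> (d < br i)%N -> S w i d -> S v i d)).

Lemma nested_ex F : exists n, nested n F.
Proof.
have [n1 h1] : exists n, forall j, j \in F -> (ld j <= n)%N.
  by exists (\max_(j <- F) ld j) => j jF; exact: (leq_bigmax_seq _ jF).
have h v w : exists n : nat,
     (forall i d, (n <= i)%N -> (d < br i)%N -> S v i d -> S w i d) \/
     (forall i d, (n <= i)%N -> (d < br i)%N -> S w i d -> S v i d).
  by case: (chainS v w) => -[n hn]; exists n; [left|right].
have [f hf] := choice (fun vw : W * W => h vw.1 vw.2).
pose V := slaloms_of F.
exists (maxn n1 (\max_(vw <- [seq (v, w) | v <- V, w <- V]) f vw)); split=> [j jF|v w vV wV].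
  by rewrite leq_max h1.
have : (v, w) \in [seq (v, w) | v <- V, w <- V] by apply/allpairsP; exists (v, w).
move=> vwV; have fm := @leq_bigmax_seq _ _ predT f (v, w) vwV isT.
have {}fm : (f (v, w) <= maxn n1 (\max_(vw <- [seq (v, w) | v <- V, w <- V]) f vw))%N.
  by rewrite leq_max fm orbT.
by case: (hf (v, w)) => /= hvw; [left|right] => i d ni; apply: hvw; exact: leq_trans ni.
Qed.

(* On a cone below level n the traces of the slalom sets form a chain, so that
   only N k + 1 < 2 ^ N of the patterns occur. *)
Lemma pattern_missing n F s : nested n F -> uniq F -> size F = N ->
  (forall j, j \in F -> size (vs j) = k) -> lev s = n ->
  exists eps : J -> bool, forall u, desc s u -> ~ forall j, j \in F -> A j u <-> eps j.
Proof.
move=> [ldn chn] uF sF vF sn; apply: contrapT => nex.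
pose V := slaloms_of F.
have sV : size V = (N * k)%N.
  rewrite -sF /V /slaloms_of; elim: F vF {ldn chn uF sF nex V} => [//|j F IH] vF.
  rewrite /= size_cat vF ?mem_head// IH ?mulSn// => i iF.
  by apply: vF; rewrite inE iF orbT.
pose eps (g : {ffun 'I_N -> bool}) j := [exists i : 'I_N, (val i == index j F) && g i].
have h g : exists u, desc s u /\ forall j, j \in F -> A j u <-> eps g j.
  apply: contrapT => nu; apply: nex; exists (eps g) => u su hu; apply: nu.
  by exists u.
have [u hu] := choice h.
(* Among nested slaloms the number of avoided ones tells which are avoided, so this count determines
   the pattern; it takes at most [N * k + 1] values, fewer than the 2^N patterns. *)
pose c g := count (fun v => `[< avoid (S v) n (u g) >]) V.
have cV g : (c g < (N * k).+1)%N by rewrite ltnS -sV; exact: count_size.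
have agr g g' : {in V, (fun v => `[< avoid (S v) n (u g) >])
    =1 (fun v => `[< avoid (S v) n (u g') >])} -> forall j, j \in F -> eps g j -> eps g' j.
  move=> e j jF; have [dg Ag] := hu g; have [dg' Ag'] := hu g'.
  move=> /(Ag _ jF) Aj; apply/(Ag' _ jF); apply: hA Aj.
  apply: (@agree_mono _ S (ld j) n (vs j) V); first exact: ldn.
    by move=> v vj; apply/flatten_mapP; exists j.
  split; rewrite -?sn; [by case: dg|by case: dg'| |].
    by case: dg dg' => _ -> [_ ->].
  by move=> v vV; rewrite sn; apply: asbool_eq_equiv; exact: e.
have cinj : injective (fun g => Ordinal (cV g)).
  move=> g g' /(congr1 val) /= cgg'.
  have e : {in V, (fun v => `[< avoid (S v) n (u g) >])
      =1 (fun v => `[< avoid (S v) n (u g') >])}.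
    have [sub|] := pselect {in V, subpred (fun v => `[< avoid (S v) n (u g) >])
        (fun v => `[< avoid (S v) n (u g') >])}.
      exact: count_subpred_eq.
    (* A slalom [v] avoided by [u g] and not by [u g'] forces the reverse inclusion between the sets
       of avoided slaloms, since [v] is comparable with every other one. *)
    move=> /existsNP[v] /not_implyP[vV] /not_implyP[/asboolP vg vg'].
    move=> w wV; apply/esym; move: w wV; apply: count_subpred_eq => // w wV /asboolP wg'.
    apply/asboolP; case: (chn v w vV wV) => vw.
      case: vg'; apply/asboolP; exact: avoid_sub wg'.
    exact: avoid_sub vg.
  have e' : {in V, (fun v => `[< avoid (S v) n (u g') >])
      =1 (fun v => `[< avoid (S v) n (u g) >])} by move=> v /e ->.
  apply/ffunP => i.
  have [j jF ji] : exists2 j, j \in F & index j F = i.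
    have := ltn_ord i; rewrite -{2}sF; case: (F) uF => // j0 F' uF iF.
    by exists (nth j0 (j0 :: F') i); [exact: mem_nth|exact: index_uniq].
  have epsE g0 : eps g0 j = g0 i.
    apply/existsP/idP => [[i' /andP[/eqP e0 gi]]|gi]; last by exists i; rewrite ji eqxx.
    by rewrite (_ : i = i')//; apply: val_inj; rewrite /= e0.
  by rewrite -!epsE; apply/idP/idP; exact: agr.
have := leq_card _ cinj; rewrite card_ffun card_bool !card_ord leqNgt -addn1.
by rewrite kN.
Qed.

Let packing n (G : seq (seq J)) :=
  uniq (flatten G) /\ forall F, F \in G ->
    [/\ nested n F, size F = N & forall j, j \in F -> size (vs j) = k].

(** With at least as many disjoint blocks as nodes up to level [n], each node of level [n] gets its
    own block and a pattern on it that is missing below the node. Independence realizes all these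
    patterns at one node of level at least [n], against the choice made for its truncation. *)
Lemma packing_bounded n : exists M, forall G, packing n G -> (size G < M)%N.
Proof.
have /finite_seqP[l hl] := finite_lev n.
have ll s : lev s = n -> s \in l.
  by move=> sn; have /seteqP[h _] := hl; apply: h; rewrite /= sn.
exists (size l) => G [uG hG]; rewrite ltnNge; apply/negP => lG.
have h s : exists eps : J -> bool, lev s = n ->
    forall u, desc s u -> ~ forall j, j \in nth [::] G (index s l) -> A j u <-> eps j.
  have [sn|] := pselect (lev s = n); last by exists xpredT.
  have FG : nth [::] G (index s l) \in G.
    by apply: mem_nth; rewrite (leq_trans _ lG)// index_mem ll.
  have [ns sF vF] := hG _ FG.
  have uF := uniq_flatten_mem uG FG.
  by have [eps heps] := pattern_missing ns uF sF vF sn; exists eps.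
have [eps heps] := choice h.
have [u nu hu] := realized (flatten G)
  (fun j => eps (nth root l (find (fun F => j \in F) G)) j) n.
pose s := trunc n u; have sn : lev s = n by rewrite lev_trunc; apply/minn_idPl.
have sl : (index s l < size G)%N by rewrite (leq_trans _ lG)// index_mem ll.
apply: (heps s sn u); first exact: desc_trunc.
move=> j jF; have := hu j; rewrite (find_uniq_flatten uG sl jF) nth_index ?ll//.
by apply; apply/flattenP; exists (nth [::] G (index s l)) => //; exact: mem_nth.
Qed.

(** Packings with the largest number of blocks, one for every [n], use countably many indices. From
    an uncountable class [N] fresh indices could be drawn, and their block, nested from some level
    [n] on, would enlarge the packing for that [n]. *)
Lemma pattern_class_countable : countable [set j | size (vs j) = k].
Proof.
have h n : exists G, packing n G /\ forall G', packing n G' -> (size G' <= size G)%N.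
  have [M hM] := packing_bounded n.
  pose P m := `[< exists2 G, packing n G & size G = m >].
  have ex : exists m, P m by exists 0%N; apply/asboolP; exists [::].
  have ub m : P m -> (m <= M)%N by move=> /asboolP[G /hM /ltnW + <-].
  case: (ex_maxnP ex ub) => _ /asboolP[G pG <-] maxG; exists G; split=> // G' pG'.
  by apply: maxG; apply/asboolP; exists G'.
have [G hG] := choice h.
pose Z := \bigcup_n [set` flatten (G n)].
have cZ : countable Z by apply: bigcup_countable => // n _; exact/finite_set_countable/finite_seq.
apply: contrapT => ncQ.
have iQ : infinite_set ([set j | size (vs j) = k] `\` Z).
  move=> fQ; apply: ncQ; apply: (sub_countable (B := Z `|` ([set j | size (vs j) = k] `\` Z))).
    apply: subset_card_le => j Qj; have [Zj|nZ] := pselect (Z j); by [left|right].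
  rewrite -bigcup2E; apply: bigcup_countable => // -[|[|i]] _ //=.
  exact: finite_set_countable.
have [B BQ NB] := infinite_set_fset N iQ.
pose F := take N (finmap.enum_fset B).
have sF : size F = N by rewrite size_takel.
have FB j : j \in F -> size (vs j) = k /\ ~ Z j.
  by move=> /mem_take jB; have [] := BQ j jB.
have uF : uniq F by apply: take_uniq; exact: finmap.fset_uniq.
have [n nF] := nested_ex F.
have [[uG pG] maxG] := hG n.
suff : packing n (F :: G n) by move=> /maxG; rewrite /= ltnn.
split=> [|E]; last first.
  by rewrite inE => /predU1P[->|/pG//]; split=> // j /FB[].
rewrite /= cat_uniq uF uG andbT /=; apply/hasPn => j jG; apply/negP => /FB[_].
by apply; exists n.
Qed.

End Independent.

Lemma no_uncountable_independent (J : choiceType) (A : J -> set node) :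
  (forall j, tree_sets S (A j)) ->
  (forall (l : seq J) (eps : J -> bool) n,
    exists2 u, (n <= lev u)%N & forall j, j \in l -> A j u <-> eps j) ->
  countable [set: J].
Proof.
move=> tA hr; have [ld hld] := choice tA; have [vs hA] := choice hld.
have -> : [set: J] = \bigcup_k [set j | size (vs j) = k].
  by apply/seteqP; split=> // j _; exists (size (vs j)).
apply: bigcup_countable => // k _; have [N kN] := exp2_gt_linear k.
exact: (pattern_class_countable hA hr kN).
Qed.

End NoCube.

Section SlalomCube.
Context {R : realType} {W : eqType} (S : W -> slalom).
Hypothesis chainS : forall v w, almost_sub (S v) (S w) \/ almost_sub (S w) (S v).
Variable en : nat -> node.
Hypothesis en_surj : forall s, exists n, en n = s.

Local Notation emb := (@emb _ (tree_sets S)).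
Local Notation e := (emb \o en).
Local Notation K := (set_type (remainder e)).

(** For each coordinate a clopen set separates the fibres over 0 and 1. Surjectivity onto the
    vertices of the cube makes these sets independent. *)
Lemma slalom_no_cube (J : Type) : ~ countable [set: J] -> ~ maps_onto_cube R K J.
Proof.
move=> ncJ [f [cf fsurj]]; apply: ncJ.
pose g (j : J) (x : K) : R := set_val (f x j).
have cg j : continuous (g j).
  move=> x; apply: (@continuous_comp _ _ _ (fun x => f x j)); last first.
    exact: initial_continuous.
  apply: (@continuous_comp _ _ _ f (fun y => y j)); first exact: cf.
  exact: (@proj_continuous {classic J} (fun=> set_type _) j).
have h j : exists A, [/\ tree_sets S A,
    (forall x, g j x = 0 -> hat A (set_val x)) & forall x, g j x = 1 -> ~ hat A (set_val x)].
  have cF : closed (g j @^-1` [set 0]).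
    apply: preimage_closed; first by move=> x _; exact: cg.
    exact/accessible_closed_set1/hausdorff_accessible/norm_hausdorff.
  have oU : open (g j @^-1` [set y | y < 1]).
    by apply: open_comp; [move=> x _; exact: cg|exact: open_lt].
  have [|A [tA FA AU]] := trace_separation en_surj cF oU.
    by move=> x /= ->.
  by exists A; split=> // x x1 /AU /=; rewrite x1 ltxx.
have [A hA] := choice h.
apply: (@no_uncountable_independent W S chainS {classic J} A).
  by move=> j; case: (hA j).
move=> l eps n.
have I0 : `[0, 1]%classic (0 : R) by rewrite /= in_itv /= lexx ler01.
have I1 : `[0, 1]%classic (1 : R) by rewrite /= in_itv /= lexx ler01.
pose y : J -> set_type (`[0, 1]%classic : set R) :=
  fun j => if eps j then SigSub (mem_set I0) else SigSub (mem_set I1).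
have [x _ fx] : range f y by rewrite fsurj.
(* The set of low nodes is added to force the approximating node up to level [n]: being finite, it
   has no point of the remainder in its hat. *)
have [u] := stone_approx (set_val x) ([set t | (lev t < n)%N] :: map A l).
rewrite /cylinder /= all_map => /andP[/eqP un /(@allP {classic J}) ul]; exists u.
  rewrite leqNgt; apply/negP => ult.
  have tn := tree_sets_lev S n.
  have un' : hat _ (emb u) := (hat_tree_emb u tn).2 ult.
  apply: (tree_hat_finite (A := [set t | (lev t < n)%N]) _ (p := set_val x)).
  - by apply: sub_finite_set (finite_lev n) => t /= /ltnW.
  - by rewrite -(range_enum S en_surj); exact: (@set_valP _ (remainder e) x).
  - by rewrite /hat /= -un.
move=> j jl; have [tA A0 A1] := hA j.
have /eqP /= uA := ul j jl.
rewrite -(hat_tree_emb u tA) /hat /= uA.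
have gx : g j x = if eps j then 0 else 1 by rewrite /g fx /y; case: (eps j).
case: (eps j) gx => gx; split=> // h0.
- exact: A0.
- by case: (A1 x gx).
Qed.

End SlalomCube.

(** * Sequential compactness *)

Lemma infinite_gt (N : set nat) n : infinite_set N -> exists2 m, N m & (n < m)%N.
Proof.
move=> iN; apply: contrapT => h; apply: iN; apply: sub_finite_set (finite_II n.+1) => m Nm /=.
by rewrite ltnS leqNgt; apply/negP => nm; apply: h; exists m.
Qed.

Lemma diagonal_infinite (N : nat -> set nat) :
  (forall k, infinite_set (N k)) -> (forall k, N k.+1 `<=` N k) ->
  exists phi : nat -> nat, {homo phi : m n / (m < n)%N} /\
    forall k i, (k <= i)%N -> N k (phi i).
Proof.
move=> iN dN; have h (kn : nat * nat) : exists m, N kn.1 m /\ (kn.2 < m)%N.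
  by have [m ? ?] := infinite_gt kn.2 (iN kn.1); exists m.
have [f hf] := choice h.
pose phi := fix phi k := if k is k'.+1 then f (k, phi k') else f (0%N, 0%N).
exists phi; split.
  by apply: homo_ltn => [y x z|k]; [exact: ltn_trans|have [_ ?] := hf (k.+1, phi k)].
have Nphi k : N k (phi k) by case: k => [|k] /=; [have [] := hf (0%N, 0%N)|have [] := hf (k.+1, phi k)].
move=> k i /subnKC <-; move: (i - k)%N => {}i; elim: i k => [|i IH] k.
  by rewrite addn0.
by rewrite addnS -addSn; apply/dN/IH.
Qed.

Lemma enumerate_infinite (N : set nat) : infinite_set N ->
  exists phi : nat -> nat, {homo phi : m n / (m < n)%N} /\ forall k, N (phi k).
Proof.
move=> iN; have [phi [hphi h]] := @diagonal_infinite (fun=> N) (fun=> iN) (fun=> @subset_refl _ _).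
by exists phi; split=> // k; exact: h (leqnn k).
Qed.

Lemma homo_ltn_ge (phi : nat -> nat) : {homo phi : m n / (m < n)%N} -> forall k, (k <= phi k)%N.
Proof. by move=> h; elim=> [//|k IH]; apply: leq_ltn_trans IH _; exact: h. Qed.

Lemma infinite_pigeonhole (N : set nat) n (F : nat -> set nat) : infinite_set N ->
  (forall i, N i -> exists2 d, (d < n)%N & F d i) ->
  exists2 d, (d < n)%N & infinite_set (F d).
Proof.
move=> iN NF; apply: contrapT => h; apply: iN.
apply: (@sub_finite_set _ _ (\bigcup_(d in `I_n) F d)); first by move=> i /NF[d]; exists d.
by apply: bigcup_finite => [|d dn]; [exact: finite_II|apply: contrapT => Fd; apply: h; exists d].
Qed.

Lemma stone_cvg (I : Type) (AA : set (set I)) (r : nat -> stone AA) :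
  (forall A, exists b k0, forall k, (k0 <= k)%N -> val (r k) A = b) ->
  exists x : stone AA, r @ \oo --> x.
Proof.
move=> h; have [z hz] := choice h.
have near_z (l : seq (set I)) : exists k0, forall k, (k0 <= k)%N ->
    all (fun A => val (r k) A == z A) l.
  elim: l => [|A l [k1 IH]]; first by exists 0%N.
  have [k2 h2] := hz A; exists (maxn k1 k2) => k; rewrite geq_max => /andP[k1k k2k] /=.
  by rewrite h2// eqxx IH.
have zS : stone_set AA z.
  move=> l; have [k /(_ k (leqnn k)) kl] := near_z l.
  have [i il] := set_mem (valP (r k)) l; exists i; elim: l kl il => //= A l IH.
  by move=> /andP[/eqP <- kl] /andP[-> il]; exact: IH.
exists (SigSub (mem_set zS)) => U; rewrite nbhsE => -[V [oV Vz] VU].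
have [l lV] := oV _ Vz; have [k0 hk] := near_z l.
by exists k0 => // k /= /hk kl; apply/VU/lV.
Qed.

Section SequentialCompactness.
Context {W : eqType} (S : W -> slalom).
Hypothesis well_ordered : forall P : set W, P !=set0 ->
  exists2 w, P w & forall v, P v -> almost_sub (S w) (S v).

Local Notation L := (stone (tree_sets S)).
Local Notation emb := (@emb _ (tree_sets S)).
Local Notation hat := (@hat _ (tree_sets S)).
Local Notation cone s := [set t | desc s t].
Local Notation avoiding w m := [set t | avoid (S w) m t].

Section Branch.
Variables (q : nat -> L) (s : nat -> node).
Hypotheses (lev_s : forall n, lev (s n) = n)
  (trunc_s : forall m n, (m <= n)%N -> trunc m (s n) = s m)
  (q_s : forall n i, (n <= i)%N -> hat (cone (s n)) (q i)).

Lemma branch_hit w m n i : (m <= n)%N -> S w n (dig (s n.+1) n) -> (n < i)%N ->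
  ~ hat (avoiding w m) (q i).
Proof.
move=> mn Sn ni qi; have := q_s ni => qs.
have : hat (avoiding w m `&` cone (s n.+1)) (q i).
  by rewrite tree_hatI//; [exact: tree_sets_avoid|exact: tree_sets_cone].
rewrite (_ : _ `&` _ = set0) ?tree_hat0//; apply/seteqP; split=> // t [/= av].
rewrite /desc lev_s => -[lt tt]; have := av n; rewrite mn lt => /(_ isT).
by rewrite -(dig_trunc t (ltnSn n)) tt Sn.
Qed.

(** Between levels [m] and [m'] the point follows the branch, so along an avoiding branch the
    starting level of the avoidance is immaterial for late points. *)
Lemma branch_avoids w m m' i : (forall n, avoid (S w) m (s n)) -> (m <= m')%N -> (m' <= i)%N ->
  hat (avoiding w m') (q i) -> hat (avoiding w m) (q i).
Proof.
move=> avs mm mi qi.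
have : hat (avoiding w m' `&` cone (s m')) (q i).
  rewrite tree_hatI; [split=> //; exact: q_s|exact: tree_sets_avoid|exact: tree_sets_cone].
apply: tree_hat_sub.
- by apply: tree_setsI; [exact: tree_sets_avoid|exact: tree_sets_cone].
- exact: tree_sets_avoid.
- move=> t [/= av []]; rewrite lev_s => lt tt.
  by apply/(avoid_split (S w) t mm); rewrite tt.
Qed.

Definition killed w (N : set nat) := infinite_set N /\
  forall m, exists i0, forall i, (i0 <= i)%N -> N i -> ~ hat (avoiding w m) (q i).

(* The least slalom that can be killed on an infinite set of indices is killed,
   together with all later ones; the earlier ones can never be killed, so they
   are eventually decided. *)
Lemma avoid_eventually_decided : exists2 N, infinite_set N & forall w m,
  exists b i0, forall i, (i0 <= i)%N -> N i -> val (q i) (avoiding w m) = b.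
Proof.
have [N iN hN] : exists2 N, infinite_set N & forall w, (exists N', killed w N') -> killed w N.
  have [ne|ne] := pselect ([set w | exists N, killed w N] !=set0); last first.
    exists setT; first exact: infinite_nat.
    by move=> w wk; case: ne; exists w.
  have [w [N kN] wmin] := well_ordered ne.
  exists N => [|v /wmin[n0 sub]]; first by case: kN.
  split; first by case: kN.
  move=> m; have [i0 hi] := kN.2 (maxn m n0); exists i0 => i ii Ni qv.
  apply: (hi i ii Ni); move: qv; apply: tree_hat_sub; try exact: tree_sets_avoid.
  move=> t /= /(avoid_le (leq_maxl m n0)); apply: avoid_sub => n d mn.
  by apply: sub; rewrite (leq_trans _ mn)// leq_maxr.
exists N => // w m.
have [kw|nkw] := pselect (exists N', killed w N').
  exists false; have [_ /(_ m)[i0 hi]] := hN w kw.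
  by exists i0 => i ii Ni; apply/negP/(hi i ii Ni).
have [[n [mn Sn]]|nhit] := pselect (exists n, (m <= n)%N /\ S w n (dig (s n.+1) n)).
  by exists false, n.+1 => i ni _; apply/negP; exact: branch_hit Sn ni.
have avs n : avoid (S w) m (s n).
  move=> i /andP[mi]; rewrite lev_s => ilt; apply/negP => Si; apply: nhit.
  by exists i; split=> //; rewrite -(trunc_s ilt) dig_trunc.
(* Infinitely many failures at the single level [m] would kill [w]: by [branch_avoids] they are
   failures at every later level too. *)
have fin : finite_set (N `&` [set i | ~ hat (avoiding w m) (q i)]).
  apply: contrapT => inf; apply: nkw; exists (N `&` [set i | ~ hat (avoiding w m) (q i)]).
  split=> // m'; exists m' => i mi [Ni nq] qi; apply: nq.
  have [mm|mm] := leqP m m'; first exact: (branch_avoids avs mm mi qi).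
  apply: tree_hat_sub qi; try exact: tree_sets_avoid.
  by move=> t /=; exact: avoid_le (ltnW mm).
have /finite_seqP[l hl] := fin.
exists true, (\max_(i <- l) i).+1 => i ii Ni; apply: contrapT => nq.
have : (N `&` [set i | ~ hat (avoiding w m) (q i)]) i by split.
by rewrite hl /= => il; move: ii; rewrite ltnNge (@leq_bigmax_seq _ l predT id i il isT).
Qed.

(** A member of the algebra is decided by a cone of level [l] and finitely many avoiding sets, all
    eventually constant along the thinned sequence. *)
Lemma branch_subsequence : exists phi : nat -> nat, {homo phi : m n / (m < n)%N} /\
  exists x : L, (q \o phi) @ \oo --> x.
Proof.
have [N iN hN] := avoid_eventually_decided.
have [phi [hphi Nphi]] := enumerate_infinite iN; exists phi; split=> //.
have phi_ge := homo_ltn_ge hphi.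
apply: stone_cvg => A.
have [tA|nA] := pselect (tree_sets S A); last first.
  by exists false, 0%N => k _; apply/negP => /hat_mem.
have [l [ws hA]] := tA.
have [k0 hk0] : exists k0, forall w, w \in ws -> exists b, forall k, (k0 <= k)%N ->
    val (q (phi k)) (avoiding w l) = b.
  elim: ws {hA} => [|w ws [k0 IH]]; first by exists 0%N.
  have [b [i0 hb]] := hN w l; exists (maxn k0 i0) => v; rewrite inE => /predU1P[->|vws].
    exists b => k; rewrite geq_max => /andP[_ ik].
    by apply: hb => //; exact: leq_trans (phi_ge k).
  have [c hc] := IH v vws; exists c => k; rewrite geq_max => /andP[kk _]; exact: hc.
pose k1 := maxn k0 l.
have same k k' : (k1 <= k)%N -> (k1 <= k')%N -> val (q (phi k)) A -> val (q (phi k')) A.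
  rewrite !geq_max => /andP[kk kl] /andP[kk' kl'] qA.
  have [u] := stone_approx (q (phi k)) (A :: cone (s l) :: [seq avoiding w l | w <- ws]).
  have [v] := stone_approx (q (phi k')) (A :: cone (s l) :: [seq avoiding w l | w <- ws]).
  rewrite /cylinder /= !all_map => /and3P[/eqP vA /eqP vs /allP vw] /and3P[/eqP uA /eqP us /allP uw].
  have [cu1 cu2] : desc (s l) u.
    apply/(hat_tree_emb u (tree_sets_cone S (s l))); rewrite /hat /= us.
    by apply: q_s; exact: leq_trans (phi_ge k).
  have [cv1 cv2] : desc (s l) v.
    apply/(hat_tree_emb v (tree_sets_cone S (s l))); rewrite /hat /= vs.
    by apply: q_s; exact: leq_trans (phi_ge k').
  rewrite -vA; apply/(hat_tree_emb v tA); apply: (hA u); last first.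
    by apply/(hat_tree_emb u tA); rewrite /hat /= uA.
  rewrite lev_s in cu1 cu2 cv1 cv2; split=> //; first by rewrite cu2 cv2.
  move=> w wws; have hu := hat_tree_emb u (tree_sets_avoid S w l).
  have hv := hat_tree_emb v (tree_sets_avoid S w l).
  have e : hat (avoiding w l) (emb u) = hat (avoiding w l) (emb v).
    rewrite /hat /=; have /= /eqP -> := uw w wws; have /= /eqP -> := vw w wws.
    by have [b hb] := hk0 w wws; have := hb k kk; have := hb k' kk' => /= -> ->.
  by split=> [/hu|/hv]; [rewrite e => /hv|rewrite -e => /hu].
exists (val (q (phi k1)) A), k1 => k kk; apply/idP/idP; exact: same.
Qed.

End Branch.

(** If no node is repeated infinitely often, a cone containing infinitely many terms passes this on
    to the cone of a child, and the branch so obtained is handled by [branch_subsequence]. *)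
Lemma slalom_sequentially_compact (p : nat -> L) :
  exists phi : nat -> nat, {homo phi : m n / (m < n)%N} /\
  exists x : L, (p \o phi) @ \oo --> x.
Proof.
have [[t it]|nit] := pselect (exists t, infinite_set [set i | p i = emb t]).
  have [phi [hphi phiE]] := enumerate_infinite it; exists phi; split=> //; exists (emb t).
  rewrite (_ : p \o phi = cst (emb t)); last by apply/funext => k; exact: phiE.
  exact: cvg_cst.
pose I s := [set i | hat (cone s) (p i)].
have I_child s : exists d, infinite_set (I s) ->
    (d < br (lev s))%N /\ infinite_set (I (child s d)).
  have [iI|] := pselect (infinite_set (I s)); last by exists 0%N.
  have iI' : infinite_set (I s `\` [set i | p i = emb s]).
    move=> fI; apply: iI; apply: (@sub_finite_set _ _ ((I s `\` [set i | p i = emb s]) `|` [set i | p i = emb s])).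
      by move=> i Ii; have [?|?] := pselect (p i = emb s); [right|left].
    rewrite finite_setU; split=> //; apply: contrapT => inf; apply: nit; by exists s.
  have [|d dl id] := @infinite_pigeonhole _ (br (lev s)) (fun d => I (child s d)) iI'.
    move=> i [Ii ni]; move: Ii; rewrite /I /= cone_child.
    have [t1 h1] := @hat_bigcup _ S (br (lev s)) (fun d => cone (child s d))
      (fun d _ => tree_sets_cone S (child s d)).
    rewrite tree_hatU ?h1 ?tree_hat1//; last exact: tree_sets1.
    by move=> [/ni|[d /= dl pd]]//; exists d.
  by exists d.
have [f hf] := choice I_child.
pose s := fix s n := if n is n'.+1 then child (s n') (f (s n')) else root.
have Is n : infinite_set (I (s n)).
  elim: n => [|n IH] /=; last by have [] := hf _ IH.
  rewrite (_ : I _ = setT); first exact: infinite_nat.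
  apply/seteqP; split=> // i _; rewrite /I /= (_ : mkset _ = setT) ?tree_hatT//.
  by apply/seteqP; split=> // t _; split=> //; exact: trunc0.
have fs n : (f (s n) < br (lev (s n)))%N by have [] := hf _ (Is n).
have lev_s n : lev (s n) = n by elim: n => [//|n IH] /=; rewrite lev_child ?IH// -{2}IH.
have trunc_s m n : (m <= n)%N -> trunc m (s n) = s m.
  elim: n => [|n IH]; first by rewrite leqn0 => /eqP ->; rewrite trunc_id.
  rewrite leq_eqVlt => /predU1P[->|]; first by rewrite trunc_id// lev_s.
  by rewrite ltnS => mn /=; rewrite trunc_child ?lev_s ?IH// -{2}(lev_s n).
have [n|phi0 [hphi0 hI]] := diagonal_infinite Is.
  rewrite /I /=; move=> i /=; apply: tree_hat_sub; try exact: tree_sets_cone.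
  by move=> t; apply: desc_trans; exact: desc_child.
have [phi1 [hphi1 [x hx]]] := @branch_subsequence (p \o phi0) s lev_s trunc_s hI.
by exists (phi0 \o phi1); split; [move=> m n /hphi1/hphi0|exists x].
Qed.

End SequentialCompactness.

(** * Copies of c0 in C(L) *)

Section C0.
Context {R : realType}.
Implicit Types u v : c0 R.

Lemma c0_coord_le u n : `|u n| <= `|u|.
Proof. by apply: supnorm_ge; exact: c0_bounded. Qed.

Lemma c0_norm_le u M : 0 <= M -> (forall n, `|u n| <= M) -> `|u| <= M.
Proof. exact: supnorm_le. Qed.

Lemma c0_small u (eps : R) : 0 < eps -> exists N, forall n, (N <= n)%N -> `|u n| <= eps.
Proof.
move=> e0; have /cvgrPdist_le/(_ _ e0)[N _ h] := @c0_cvg R u.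
by exists N => n /h; rewrite sub0r normrN.
Qed.

Lemma c0_intro (a : nat -> R) :
  (forall eps : R, 0 < eps -> exists N, forall n, (N <= n)%N -> `|a n| <= eps) ->
  a @ \oo --> (0 : R).
Proof.
move=> h; apply/cvgrPdist_le => eps e0; have [N hN] := h _ e0.
by exists N => // n /= /hN; rewrite sub0r normrN.
Qed.

Lemma c0_truncate_cvg (a : nat -> R) N : (fun n => if (n < N)%N then a n else 0) @ \oo --> (0 : R).
Proof.
apply: c0_intro => eps e0; exists N => n Nn.
by rewrite ltnNge Nn normr0 ltW.
Qed.

Definition c0_truncate (a : nat -> R) N : c0 R := C0 (@c0_truncate_cvg a N).

Lemma c0_unit_cvg k : (fun n => (n == k)%:R) @ \oo --> (0 : R).
Proof.
apply: c0_intro => eps e0; exists k.+1 => n kn.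
by rewrite gtn_eqF// normr0 ltW.
Qed.

Definition c0_unit k : c0 R := C0 (c0_unit_cvg k).

Lemma c0_unit_norm k : `|c0_unit k| = 1.
Proof.
apply/le_anti/andP; split.
  by apply: c0_norm_le => // n /=; rewrite ger0_norm// lern1 leq_b1.
by apply: le_trans (c0_coord_le _ k); rewrite /= eqxx normr1.
Qed.

Lemma c0_sumE (I : Type) (s : seq I) (F : I -> c0 R) n :
  (\sum_(i <- s) F i) n = \sum_(i <- s) F i n.
Proof. by elim: s => [|i s IH]; rewrite ?big_nil// !big_cons -IH. Qed.

Lemma c0_truncateE (a : nat -> R) N :
  c0_truncate a N = \sum_(0 <= k < N) a k *: c0_unit k.
Proof.
apply: c0P => n; rewrite c0_sumE /=.
case: ltnP => nN.
  rewrite (bigD1_seq n) ?mem_index_iota ?iota_uniq//=.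
  rewrite [X in X + _](_ : _ = a n); last by rewrite /= /GRing.scale /= eqxx mulr1.
  rewrite big1 ?addr0// => k kn; rewrite /GRing.scale /= eq_sym (negbTE kn) mulr0//.
rewrite big_nat_cond big1// => k /andP[/andP[_ kN] _].
by rewrite /GRing.scale /= gtn_eqF ?mulr0// (leq_trans kN).
Qed.

Lemma c0_truncate_near u (eps : R) : 0 < eps ->
  exists N0, forall N, (N0 <= N)%N -> `|u - c0_truncate u N| <= eps.
Proof.
move=> e0; have [N0 h] := c0_small u e0; exists N0 => N NN.
apply: c0_norm_le => [|n]; first exact: ltW.
change (`|u n - (if (n < N)%N then u n else 0)| <= eps).
case: ltnP => nN; first by rewrite subrr normr0 ltW.
by rewrite subr0; apply: h; exact: leq_trans nN.
Qed.

Section Spread.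
Variable phi : nat -> nat.
Hypothesis phi_incr : {homo phi : m n / (m < n)%N}.

Let phi_inj : injective phi.
Proof.
move=> m n mn; case: (ltngtP m n) => // /phi_incr; by rewrite mn ltnn.
Qed.

(** Moves [u k] to coordinate [phi k]; the range [k <= n] suffices because an increasing [phi]
    satisfies [k <= phi k]. *)
Definition spread_seq u n := \sum_(k < n.+1 | phi k == n) u k.

Lemma spread_phi u k : spread_seq u (phi k) = u k.
Proof.
have kk : (k < (phi k).+1)%N by rewrite ltnS; exact: homo_ltn_ge.
rewrite /spread_seq (bigD1 (Ordinal kk))//= big1 ?addr0// => i /andP[/eqP/phi_inj ik].
by move=> /negP; case; apply/eqP/val_inj.
Qed.

Lemma spread_out u n : (forall k, phi k <> n) -> spread_seq u n = 0.
Proof. by move=> h; rewrite /spread_seq big1// => i /eqP /h. Qed.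

Lemma spread_cvg u : spread_seq u @ \oo --> (0 : R).
Proof.
apply: c0_intro => eps e0; have [N hN] := c0_small u e0.
exists (phi N) => n Nn; have [[k kn]|nk] := pselect (exists k, phi k = n).
  rewrite -kn spread_phi; apply: hN; rewrite leqNgt; apply/negP => /phi_incr.
  by rewrite kn ltnNge Nn.
rewrite spread_out ?normr0 ?ltW// => k kn; by apply: nk; exists k.
Qed.

Definition spread u : c0 R := C0 (spread_cvg u).

Lemma spread_linear : linear spread.
Proof.
move=> a u v; apply: c0P => n.
change (spread_seq (a *: u + v) n = a * spread_seq u n + spread_seq v n).
rewrite /spread_seq mulr_sumr -big_split /=; exact: eq_bigr.
Qed.

HB.instance Definition _ := GRing.isLinear.Build R (c0 R) (c0 R) _ spread spread_linear.

Lemma spread_norm u : `|spread u| = `|u|.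
Proof.
apply/le_anti/andP; split; apply: c0_norm_le => // n.
  change (`|spread_seq u n| <= `|u|).
  have [[k <-]|nk] := pselect (exists k, phi k = n).
    by rewrite spread_phi; exact: c0_coord_le.
  rewrite spread_out ?normr0// => k kn; by apply: nk; exists k.
by rewrite -(spread_phi u n); exact: (c0_coord_le (spread u)).
Qed.

Lemma spread_unit k : spread (c0_unit k) = c0_unit (phi k).
Proof.
apply: c0P => n; change (spread_seq (c0_unit k) n = (n == phi k)%:R).
have [[j <-]|nk] := pselect (exists j, phi j = n).
  by rewrite spread_phi /= (inj_eq phi_inj).
rewrite spread_out; first by case: eqP => // nk'; case: nk; exists k.
by move=> j jn; apply: nk; exists j.
Qed.

End Spread.

(* Neumann series: the solution of M u = v is the limit of u_(i+1) = v + u_i - M u_i. *)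
Lemma c0_near_identity_inverse (M : {linear c0 R -> c0 R}) :
  (forall u, `|M u - u| <= 2^-1 * `|u|) ->
  exists Q : {linear c0 R -> c0 R},
    [/\ forall u, Q (M u) = u, forall v, M (Q v) = v & forall v, `|Q v| <= 2 * `|v|].
Proof.
move=> hM.
have lowM u : `|u| <= 2 * `|M u|.
  have h1 : `|u| <= `|M u| + `|M u - u|.
    rewrite -{1}(subrKC (M u) u) (le_trans (ler_normD _ _))// lerD2l distrC//.
  by have := hM u; lra.
have Minj : injective M.
  move=> u v uv; apply/eqP; rewrite -subr_eq0 -normr_eq0; apply/eqP/le_anti.
  by rewrite normr_ge0 andbT (le_trans (lowM _))// raddfB /= uv subrr normr0 mulr0.
have surj v : exists u, M u = v.
  pose F u : c0 R := v + (u - M u).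
  pose u_ i := iter i F 0.
  have dF u u' : `|F u - F u'| <= 2^-1 * `|u - u'|.
    have -> : F u - F u' = - (M (u - u') - (u - u')).
      rewrite (raddfB M) /F; apply: c0P => n.
      change (v n + (u n - M u n) - (v n + (u' n - M u' n)) =
        - (M u n - M u' n - (u n - u' n))); ring.
    by rewrite normrN; exact: hM.
  have du i : `|u_ i.+1 - u_ i| <= 2^-1 ^+ i * `|v|.
    elim: i => [|i IH].
      by rewrite /u_ /= /F raddf0 !subr0 addr0 expr0 mul1r.
    rewrite exprS -mulrA; apply: le_trans (dF _ _) _.
    by rewrite ler_wpM2l// invr_ge0.
  (* The coefficient is the geometric sum of the steps from [i] to [i + j]. *)
  have dd i j : `|u_ (i + j)%N - u_ i| <= 2^-1 ^+ i * (2 - 2 * 2^-1 ^+ j) * `|v|.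
    elim: j => [|j IH]; first by rewrite addn0 subrr normr0 expr0 mulr1 subrr mulr0 mul0r.
    rewrite addnS -(subrKA (u_ (i + j)%N)) (le_trans (ler_normD _ _))//.
    apply: (le_trans (lerD (du _) IH)).
    rewrite exprD exprS -mulrDl; apply: ler_wpM2r => //.
    have -> : 2^-1 ^+ i * 2^-1 ^+ j + 2^-1 ^+ i * (2 - 2 * 2^-1 ^+ j) =
        2^-1 ^+ i * (2 - 2 * (2^-1 * 2^-1 ^+ j)) :> R by field.
    by [].
  pose b i : R := 2^-1 ^+ i * 2 * `|v|.
  have {}dd i j : (i <= j)%N -> `|u_ j - u_ i| <= b i.
    move=> /subnKC <-; apply: le_trans (dd i _) _; rewrite /b.
    apply: ler_wpM2r => //; apply: ler_wpM2l; first by rewrite exprn_ge0// invr_ge0.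
    by rewrite gerBl mulr_ge0// exprn_ge0// invr_ge0.
  have b_small (eps : R) : 0 < eps -> exists i, b i <= eps.
    move=> e0; have : b @ \oo --> (0 : R).
      rewrite /b -[0](mul0r `|v|); apply: cvgMr_tmp.
      rewrite -[0](mul0r 2); apply: cvgMr_tmp.
      by apply: cvg_expr; rewrite ger0_norm ?invr_ge0// invf_lt1// ltr1n.
    move=> /cvgrPdist_le/(_ _ e0)[i _ /(_ i (leqnn i))].
    by rewrite sub0r normrN => h; exists i; exact: le_trans (ler_norm _) h.
  have coord i j n : (i <= j)%N -> `|u_ j n - u_ i n| <= b i.
    move=> ij; apply: le_trans (dd _ _ ij).
    exact: (c0_coord_le (u_ j - u_ i)).
  (* The limit is taken coordinate by coordinate. The bound [b i] is uniform in the coordinate, so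
     the limit lies in [c0] and convergence is in norm. *)
  pose U n := limn (fun i => u_ i n).
  have cU n : cvgn (fun i => u_ i n).
    apply/cauchy_cvgP/cauchy_exP => eps e0.
    have [i hi] := b_small _ (divr_gt0 e0 (ltr0n R 2)).
    exists (u_ i n); exists i => // j /= ij; rewrite /ball /= distrC.
    rewrite (le_lt_trans (coord _ _ _ ij))// (le_lt_trans hi)// ltr_pdivrMr// ltr_pMr// ltr1n//.
  have Ub i n : `|U n - u_ i n| <= b i.
    rewrite ler_distl; apply/andP; split.
      apply: limr_ge; first exact: cU.
      by exists i => // j /= /(coord _ _ n); rewrite ler_distl => /andP[].
    apply: limr_le; first exact: cU.
    by exists i => // j /= /(coord _ _ n); rewrite ler_distl => /andP[].
  have Uc : U @ \oo --> (0 : R).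
    apply: c0_intro => eps e0; have e2 : 0 < eps / 2 by rewrite divr_gt0.
    have [i hi] := b_small _ e2; have [N hN] := c0_small (u_ i) e2.
    exists N => n /hN nN; rewrite (splitr eps) -(subrK (u_ i n) (U n)).
    by rewrite (le_trans (ler_normD _ _))// lerD// (le_trans (Ub i n)).
  pose V := C0 Uc.
  have b0 i : 0 <= b i by rewrite !mulr_ge0// exprn_ge0// invr_ge0.
  have Vb i : `|V - u_ i| <= b i.
    by apply: c0_norm_le => // n; exact: Ub.
  have M2 u : `|M u| <= 2 * `|u|.
    rewrite -(subrK u (M u)) (le_trans (ler_normD _ _))//; have := hM u; have := normr_ge0 u; lra.
  exists V; apply/eqP; rewrite -subr_eq0 -normr_eq0; apply/eqP/le_anti.
  rewrite normr_ge0 andbT; apply/ler_addgt0Pr => eps e0; rewrite add0r.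
  (* Two thirds pay for [M (V - u_ i)], since [M] has norm at most 2, and one third for the step
     from [u_ i] to [u_ i.+1]. *)
  have [i hi] := b_small _ (divr_gt0 e0 (ltr0n R 3)).
  have -> : M V - v = M (V - u_ i) - (u_ i.+1 - u_ i).
    rewrite (raddfB M) {2}/u_ /= -/(u_ i) /F; apply: c0P => n.
    change (M V n - v n = M V n - M (u_ i) n - (v n + (u_ i n - M (u_ i) n) - u_ i n)); ring.
  rewrite (le_trans (ler_normB _ _))//.
  have := M2 (V - u_ i); have := Vb i; have := dd _ _ (leqnSn i); move: hi; lra.
have [Q0 hQ] := choice surj.
have Qlin : linear Q0.
  by move=> a u v; apply: Minj; rewrite hQ linearP /= !hQ.
pose Q : {linear c0 R -> c0 R} := HB.pack Q0 (GRing.isLinear.Build R (c0 R) (c0 R) _ Q0 Qlin).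
exists Q; split=> [u|v|v]; first by apply: Minj; exact: hQ.
- exact: hQ.
- by rewrite -{2}(hQ v); exact: lowM.
Qed.

End C0.

(** * Extraction of complemented copies of c0 *)

(** Each new term is chosen beyond the thresholds belonging to all terms already chosen. The first
    argument of [P] is the position of the new term, so tolerances may shrink along the way. *)
Lemma thinning (P : nat -> nat -> nat -> Prop) (Q : nat -> Prop) :
  (forall k a, exists n0, forall n, (n0 <= n)%N -> P k a n) ->
  (exists n0, forall n, (n0 <= n)%N -> Q n) ->
  exists psi : nat -> nat, [/\ {homo psi : m n / (m < n)%N}, forall k, Q (psi k) &
    forall j k, (j < k)%N -> P k (psi j) (psi k)].
Proof.
move=> hP [q hq].
have h (s : seq nat) : exists n, Q n /\ forall a, a \in s -> (a < n)%N /\ P (size s) a n.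
  have [n0 h0] : exists n0, forall n, (n0 <= n)%N ->
      forall a, a \in s -> (a < n)%N /\ P (size s) a n.
    move: (size s) => k; elim: s => [|a s [n1 IH]]; first by exists 0%N.
    have [n2 h2] := hP k a; exists (maxn n1 (maxn n2 a.+1)) => n.
    rewrite !geq_max => /and3P[n1n n2n an] b; rewrite inE => /predU1P[->|]; last exact: IH.
    by split=> //; exact: h2.
  exists (maxn n0 q); split=> [|a]; first by apply: hq; exact: leq_maxr.
  by apply: h0; exact: leq_maxl.
have [f hf] := choice h.
pose st k := iter k (fun s => f s :: s) [::].
have size_st k : size (st k) = k by elim: k => //= k ->.
have mem_st j k : (j < k)%N -> f (st j) \in st k.
  elim: k => [//|k IH]; rewrite ltnS leq_eqVlt inE => /predU1P[->|/IH ->].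
    by rewrite eqxx.
  by rewrite orbT.
exists (f \o st); split=> [j k jk|k|j k jk] /=; have [hQ hk] := hf (st k).
- by have [] := hk _ (mem_st _ _ jk).
- exact: hQ.
- by have [_] := hk _ (mem_st _ _ jk); rewrite size_st.
Qed.

Section Sobczyk.
Context {R : realType} {L : compactHausdorffType}.
Local Notation C := (Cspace R L).

Lemma Cspace_norm_le (f : C) M : 0 <= M -> (forall x, `|f x| <= M) -> `|f| <= M.
Proof. exact: supnorm_le. Qed.

Lemma Cspace_norm_ge (f : C) x : `|f x| <= `|f|.
Proof. by apply: supnorm_ge; exact: Cspace_bounded. Qed.

Lemma Cspace_sumE (I : Type) (s : seq I) (F : I -> C) x :
  (\sum_(i <- s) F i : C) x = \sum_(i <- s) F i x.
Proof. by elim: s => [|i s IH]; rewrite ?big_nil// !big_cons -IH. Qed.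

Section Operator.
Variables (T : {linear c0 R -> C}) (B : R).
Hypotheses (B0 : 0 < B) (TB : forall u, `|T u| <= B * `|u|).

Lemma operator_truncate (a : nat -> R) N x :
  T (c0_truncate a N) x = \sum_(0 <= k < N) a k * T (c0_unit k) x.
Proof.
rewrite c0_truncateE raddf_sum; etransitivity; first exact: Cspace_sumE.
by apply: eq_bigr => k _ /=; rewrite linearZ.
Qed.

(** A finite vector of signs has norm at most 1, and with the signs of the values at [x] its image
    sums their absolute values. *)
Lemma operator_sum_le x N : \sum_(0 <= k < N) `|T (c0_unit k) x| <= B.
Proof.
pose a k := Num.sg (T (c0_unit k) x).
have -> : \sum_(0 <= k < N) `|T (c0_unit k) x| = T (c0_truncate a N) x.
  by rewrite operator_truncate; apply: eq_bigr => k _; rewrite /a normrEsg.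
apply: le_trans (ler_norm _) _; apply: (le_trans (Cspace_norm_ge _ _)).
apply: (le_trans (TB _)); rewrite ger_pMr//; apply: c0_norm_le => // n.
change (`|if (n < N)%N then a n else 0| <= 1).
case: ifP => _; last by rewrite normr0.
by rewrite /a normr_sg; case: (_ == _).
Qed.

Lemma operator_unit_small x (eps : R) : 0 < eps ->
  exists N, forall n, (N <= n)%N -> `|T (c0_unit n) x| <= eps.
Proof.
move=> e0; have : cvgn (series (fun k => `|T (c0_unit k) x|)).
  apply: nondecreasing_is_cvgn; first by apply: nondecreasing_series.
  by exists B => _ [N _ <-]; exact: operator_sum_le.
move=> /cvg_series_cvg_0/cvgrPdist_le/(_ _ e0)[N _ hN]; exists N => n /hN.
by rewrite sub0r normrN normr_id.
Qed.

Lemma sum_half_le N : \sum_(0 <= j < N) 2^-1 ^+ j.+1 <= 1 :> R.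
Proof.
suff -> : \sum_(0 <= j < N) 2^-1 ^+ j.+1 = 1 - 2^-1 ^+ N :> R.
  by rewrite gerBl exprn_ge0// invr_ge0.
elim: N => [|N IH]; first by rewrite big_geq// expr0 subrr.
by rewrite big_nat_recr//= IH exprS; field.
Qed.

(* The functionals f y_k - f y are almost biorthogonal to the T e_k. *)
Lemma near_biorthogonal_complemented (y : nat -> L) (y0 : L) (c : R) : 0 < c ->
  y @ \oo --> y0 ->
  (forall k, c <= `|T (c0_unit k) (y k) - T (c0_unit k) y0|) ->
  (forall j k, j != k ->
    `|T (c0_unit j) (y k) - T (c0_unit j) y0| <= c / 2 * 2^-1 ^+ j.+1) ->
  complemented (range T).
Proof.
move=> c_gt0 cy diag offdiag.
pose D k := T (c0_unit k) (y k) - T (c0_unit k) y0.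
have Dn k : D k != 0 by rewrite -normr_gt0; exact: lt_le_trans (diag k).
have DV k : `|(D k)^-1| <= c^-1 by rewrite normfV lef_pV2 ?posrE ?normr_gt0//; exact: diag.
pose nseq_ (f : C) k := (D k)^-1 * (f (y k) - f y0).
have ncvg f : nseq_ f @ \oo --> (0 : R).
  apply: c0_intro => eps e0.
  have : (fun k => f (y k)) @ \oo --> f y0.
    by apply: (cvg_comp _ _ cy); exact: (@cts_fun _ _ f y0).
  have ec : 0 < eps * c by rewrite mulr_gt0.
  move=> /cvgrPdist_le/(_ _ ec)[N _ hN]; exists N => k /hN h.
  rewrite normrM distrC; apply: (@le_trans _ _ (c^-1 * (eps * c))).
    exact: ler_pM.
  by rewrite mulrCA mulVf ?mulr1// gt_eqF.
pose N0 f : c0 R := C0 (ncvg f).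
have Nlin : linear N0.
  move=> a f g; apply: c0P => k.
  change ((D k)^-1 * ((a * f (y k) + g (y k)) - (a * f y0 + g y0)) =
    a * ((D k)^-1 * (f (y k) - f y0)) + (D k)^-1 * (g (y k) - g y0)); ring.
pose N : {linear C -> c0 R} := HB.pack N0 (GRing.isLinear.Build R C (c0 R) _ N0 Nlin).
have Nb f : `|N f| <= 2 / c * `|f|.
  apply: c0_norm_le => [|k]; first by rewrite mulr_ge0// divr_ge0// ltW.
  change (`|(D k)^-1 * (f (y k) - f y0)| <= 2 / c * `|f|).
  rewrite normrM mulrC [2 / c]mulrC -mulrA [c^-1 * _]mulrC ler_pM//.
  by rewrite (le_trans (ler_normB _ _))// mulr2n mulrDl mul1r lerD ?Cspace_norm_ge.
have near_id u : `|N (T u) - u| <= 2^-1 * `|u|.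
  (* The off-diagonal terms add up to at most c/2 times the norm of [u]; division by [|D k| >= c]
     leaves the factor 1/2 required by the Neumann series. *)
  apply: c0_norm_le => [|k]; first by rewrite mulr_ge0// invr_ge0.
  change (`|(D k)^-1 * (T u (y k) - T u y0) - u k| <= 2^-1 * `|u|).
  have -> : (D k)^-1 * (T u (y k) - T u y0) - u k =
      (D k)^-1 * ((T u (y k) - T u y0) - u k * D k).
    by rewrite [RHS]mulrBr mulrCA mulVf// mulr1.
  rewrite normrM; apply: (@le_trans _ _ (c^-1 * (c / 2 * `|u|))); last first.
    by rewrite -mulrA mulKf ?gt_eqF.
  rewrite ler_pM//; apply/ler_addgt0Pr => eps e0.
  (* [u] is replaced by a truncation, on which [T] is a finite sum; the error is at most eps/2 at
     each of the two points. *)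
  have eB : 0 < eps / (2 * B) by rewrite divr_gt0// mulr_gt0.
  have [n0 hn0] := c0_truncate_near u eB.
  pose n := maxn n0 k.+1; have nn : (n0 <= n)%N by exact: leq_maxl.
  have kn : (k < n)%N by exact: leq_maxr.
  pose u' := c0_truncate u n.
  have Tuu' x : `|T u x - T u' x| <= eps / 2.
    have -> : T u x - T u' x = T (u - u') x by rewrite (raddfB T).
    apply: (le_trans (Cspace_norm_ge _ _)); apply: (le_trans (TB _)).
    have := hn0 n nn; rewrite -/u' => h; rewrite mulrC -ler_pdivlMr//.
    by rewrite (le_trans h)// invfM mulrA.
  have main : `|(T u' (y k) - T u' y0) - u k * D k| <= c / 2 * `|u|.
    rewrite !operator_truncate -sumrB (bigD1_seq k) ?mem_index_iota ?iota_uniq//=.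
    rewrite -mulrBr -/(D k) addrAC subrr add0r.
    apply: (le_trans (ler_norm_sum _ _ _)).
    apply: (@le_trans _ _ (\sum_(0 <= j < n | j != k) (c / 2 * `|u|) * 2^-1 ^+ j.+1)).
      apply: ler_sum => j jk; rewrite -mulrBr normrM mulrAC mulrC.
      by rewrite ler_pM// ?c0_coord_le// offdiag.
    apply: (@le_trans _ _ (\sum_(0 <= j < n) (c / 2 * `|u|) * 2^-1 ^+ j.+1)).
      rewrite big_mkcond /=; apply: ler_sum => j _; case: ifP => // _.
      by rewrite !mulr_ge0// ?invr_ge0 ?exprn_ge0 ?invr_ge0 ?ltW.
    rewrite -mulr_sumr ler_piMr// ?sum_half_le//.
    by rewrite mulr_ge0// divr_ge0// ltW.
  have -> : T u (y k) - T u y0 - u k * D k =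
    (T u' (y k) - T u' y0 - u k * D k) + ((T u (y k) - T u' (y k)) - (T u y0 - T u' y0)) by ring.
  rewrite (le_trans (ler_normD _ _))// lerD// (le_trans (ler_normB _ _))//.
  by rewrite [leRHS]splitr lerD.
have [Q [QM MQ Qb]] := @c0_near_identity_inverse R (N \o T) near_id.
(* [Q] inverts the composite of [N] after [T], so this is idempotent with the range of [T]. *)
pose p : {linear C -> C} := T \o (Q \o N).
apply: (@projection_complemented _ _ p).
- apply: (bounded_operator_continuous (M := B * (2 * (2 / c)))) => f.
  apply: (le_trans (TB _)); rewrite -!mulrA ler_pM2l//.
  apply: (le_trans (Qb _)); rewrite ler_pM2l//; apply: (le_trans (Nb _)).
  by rewrite mulrA.
- by move=> f; rewrite /p /=; have /= -> := QM (Q (N f)).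
- apply/seteqP; split=> [_ [f _ <-]|_ [u _ <-]]; first by exists (Q (N f)).
  by exists (T u) => //=; have /= -> := QM u.
Qed.

End Operator.

Theorem sequentially_compact_Sobczyk :
  (forall p : nat -> L, exists phi : nat -> nat, {homo phi : m n / (m < n)%N} /\
     exists x : L, (p \o phi) @ \oo --> x) ->
  hereditarily_separably_Sobczyk C.
Proof.
move=> seqc Y [T [cT [c c_gt0 Tc] TY]].
have [B B0 TB] := continuous_operator_bounded cT.
have h n : exists x, c / 2 <= `|T (c0_unit n) x|.
  apply: contrapT => /forallNP nx.
  have : `|T (c0_unit n)| <= c / 2.
    apply: Cspace_norm_le => [|x]; first by rewrite divr_ge0// ltW.
    by have /negP := nx x; rewrite -ltNge => /ltW.
  apply/negP; rewrite -ltNge; apply: lt_le_trans (Tc _).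
  by rewrite c0_unit_norm mulr1 ltr_pdivrMr// ltr_pMr// ltr1n.
have [x hx] := choice h.
have [phi [hphi [x0 cx]]] := seqc x.
pose g k := T (c0_unit (phi k)).
pose nuk k (f : C) := f (x (phi k)) - f x0.
have nu_small f (eps : R) : 0 < eps -> exists N, forall k, (N <= k)%N -> `|nuk k f| <= eps.
  move=> e0; have : (fun k => f (x (phi k))) @ \oo --> f x0.
    by apply: (cvg_comp _ _ cx); exact: (@cts_fun _ _ f x0).
  by move=> /cvgrPdist_le/(_ _ e0)[N _ hN]; exists N => k /hN; rewrite distrC.
have g_small z (eps : R) : 0 < eps -> exists N, forall k, (N <= k)%N -> `|g k z| <= eps.
  move=> e0; have [N hN] := operator_unit_small B0 TB z e0.
  by exists N => k Nk; apply: hN; apply: leq_trans Nk _; exact: homo_ltn_ge.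
have nug_small a (eps : R) : 0 < eps -> exists N, forall k, (N <= k)%N -> `|nuk a (g k)| <= eps.
  move=> e0; have e2 : 0 < eps / 2 by rewrite divr_gt0.
  have [N1 h1] := g_small (x (phi a)) _ e2; have [N2 h2] := g_small x0 _ e2.
  exists (maxn N1 N2) => k; rewrite geq_max => /andP[k1 k2].
  by rewrite (le_trans (ler_normB _ _))// (splitr eps) lerD ?h1 ?h2.
(* The value at [x (phi k)] is at least c/2 and the one at [x0] is eventually at most c/4, so the
   difference keeps c/4. *)
have c4 : 0 < c / 4 by rewrite divr_gt0.
pose dl k : R := c / 4 / 2 * 2^-1 ^+ k.+1.
have dl0 k : 0 < dl k by rewrite !mulr_gt0// ?invr_gt0// exprn_gt0// invr_gt0.
have dl_le j k : (j <= k)%N -> dl k <= dl j.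
  move=> jk; rewrite /dl ler_pM2l; last by rewrite divr_gt0.
  by rewrite ler_wiXn2l ?invr_ge0 ?invf_le1 ?ler1n.
(* The two conditions pair a later functional with an earlier vector and an earlier functional with
   a later vector. As [dl] decreases, the tolerance at the later position serves in both cases. *)
have [||psi [hpsi diag offd]] := @thinning
    (fun k a n => `|nuk n (g a)| <= dl k /\ `|nuk a (g n)| <= dl k)
    (fun n => c / 4 <= `|nuk n (g n)|).
- move=> k a; have [N1 h1] := nu_small (g a) _ (dl0 k).
  have [N2 h2] := nug_small a _ (dl0 k).
  exists (maxn N1 N2) => n; rewrite geq_max => /andP[/h1 ? /h2 ?]; by split.
- have [N hN] := g_small x0 _ c4; exists N => k /hN hk.
  have := hx (phi k); rewrite -/(g k) /nuk.
  have := ler_normD (g k (x (phi k)) - g k x0) (g k x0); rewrite subrK; lra.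
pose T' : {linear c0 R -> C} := T \o (spread hphi \o spread hpsi).
have T'e k : T' (c0_unit k) = g (psi k) by rewrite /T' /= !spread_unit.
exists (range T'); split.
- by rewrite -TY => _ [u _ <-]; exists (spread hphi (spread hpsi u)).
- exists T'; split=> //.
    apply: (bounded_operator_continuous (M := B)) => u.
    by apply: (le_trans (TB _)); rewrite !spread_norm.
  exists c => // u; apply: le_trans (Tc _).
  by rewrite !spread_norm.
- apply: (@near_biorthogonal_complemented T' B B0 _ (fun k => x (phi (psi k))) x0 (c / 4) c4).
  + by move=> u; apply: (le_trans (TB _)); rewrite !spread_norm.
  + apply: cvg_comp cx; apply/cvgnyPge => A; exists A => // n /= An.
    by apply: leq_trans An _; exact: homo_ltn_ge.
  + by move=> k; rewrite T'e; exact: diag.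
  + move=> j k jk; rewrite T'e -/(dl j).
    move: jk; rewrite neq_ltn => /orP[jk|kj]; last by case: (offd _ _ kj).
    by case: (offd _ _ jk) => + _; move/le_trans; apply; apply: dl_le; exact: ltnW.
Qed.

End Sobczyk.

(** * Summable slaloms and null sets *)

Section SlalomSums.
Context {R : realType}.
Implicit Types S T : slalom.

Lemma summable_bounded S m (M : R) :
  (forall n, \sum_(m <= i < n) wt S i <= M) -> slalom_summable (R := R) S.
Proof.
move=> hM eps e0; pose u n : R := \sum_(m <= i < n) wt S i.
have ub : has_ubound (range u) by exists M => _ [n _ <-]; exact: hM.
have hs : has_sup (range u) by split=> //; exists (u 0%N); exists 0%N.
have [_ [N _ <-] hN] := sup_adherent e0 hs.
exists (maxn m N) => n; case: (leqP n (maxn m N)) => [nN|Nn]; first by rewrite big_geq// ltW.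
have un : u n <= sup (range u) by apply: ub_le_sup => //; exists n.
have uN : u N <= u (maxn m N).
  have [Nm|mN] := leqP N m; last by [].
  by rewrite /u !big_geq.
have : u n = u (maxn m N) + \sum_(maxn m N <= i < n) wt S i.
  by rewrite /u (@big_cat_nat _ _ _ (maxn m N))// ?leq_maxl// ltnW.
move=> e; rewrite e in un; lra.
Qed.

Lemma dominate_countable (T_ : nat -> slalom) :
  (forall j, slalom_summable (R := R) (T_ j)) ->
  exists2 T, slalom_summable (R := R) T & forall j, almost_sub (T_ j) T.
Proof.
move=> sT.
have /choice[N hN] j : exists N, forall n, \sum_(N <= i < n) wt (T_ j) i <= 2^-1 ^+ j.+1 :> R.
  by apply: sT; rewrite exprn_gt0.
pose T n d := [exists j : 'I_n.+1, (N j <= n)%N && T_ j n d].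
exists T; last first.
  move=> j; exists (maxn j (N j)) => n d; rewrite geq_max => /andP[jn Nn] _ Tj.
  have jn1 : (j < n.+1)%N by [].
  by apply/existsP; exists (Ordinal jn1); rewrite /= Nn.
apply: (@summable_bounded _ 0 1) => M.
apply: (le_trans _ (sum_half_le (R := R) M)).
apply: (@le_trans _ _ (\sum_(0 <= n < M) \sum_(0 <= j < M) (N j <= n)%:R * wt (T_ j) n)).
  rewrite big_nat [leRHS]big_nat; apply: ler_sum => n /= nM.
  rewrite [leRHS](@big_cat_nat _ _ _ n.+1)//= -[leLHS]addr0 lerD//; last first.
    by apply: sumr_ge0 => j _; rewrite mulr_ge0// wt_ge0.
  rewrite big_mkord /wt; under [leRHS]eq_bigr do rewrite mulrA.
  rewrite -mulr_suml ler_wpM2r ?invr_ge0//.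
  under [leRHS]eq_bigr do rewrite mulr_sumr.
  rewrite exchange_big /=; apply: ler_sum => d _.
  have [/existsP[j jT]|_] := boolP (T n d); last by apply: sumr_ge0 => j _; rewrite mulr_ge0.
  rewrite (bigD1 j)//= -[leLHS]addr0 lerD//.
    by case/andP: jT => -> ->; rewrite mulr1.
  by apply: sumr_ge0 => i _; rewrite mulr_ge0.
rewrite exchange_big /=; apply: ler_sum => j _.
apply: le_trans (hN j M).
have [NM|MN] := leqP (N j) M; last first.
  rewrite (big_geq (ltnW MN)) big_nat big1 ?lexx// => n /= nM.
  by rewrite leqNgt (ltn_trans nM MN) mul0r.
rewrite [leLHS](@big_cat_nat _ _ _ (N j))//= big_nat big1 ?add0r; last first.
  by move=> n /= nN; rewrite leqNgt nN mul0r.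
rewrite big_nat [leRHS]big_nat; apply: ler_sum => n /andP[-> _].
by rewrite mul1r.
Qed.

End SlalomSums.

(** * Cells of reals and the null sets coded by slaloms *)

Section Cells.
Context {R : realType}.
Implicit Types (S T : slalom) (s t : node) (x : R).

Local Notation mu := (@lebesgue_measure R).

Definition len n : R := \prod_(i < n) ((br i)%:R)^-1.

Definition left_end s : R := \sum_(i < lev s) (dig s i)%:R * len i.+1.

(** Closed, so that decreasing cells meeting a compact set share a point of it. Neighbours overlap
    in an endpoint, which is harmless for coverings and upper bounds of measures. *)
Definition cell s : set R := `[left_end s, left_end s + len (lev s)]%classic.

Let brR n : 0 < (br n)%:R :> R.
Proof. by rewrite ltr0n br_gt0. Qed.

Lemma lenS n : len n.+1 = len n / (br n)%:R.
Proof. by rewrite /len big_ord_recr. Qed.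

Lemma lenE n : len n = (br n)%:R * len n.+1.
Proof. by rewrite lenS mulrC divfK// gt_eqF. Qed.

Lemma len_gt0 n : 0 < len n.
Proof. by apply: prodr_gt0 => i _; rewrite invr_gt0. Qed.

Lemma left_child s d : (d < br (lev s))%N ->
  left_end (child s d) = left_end s + d%:R * len (lev s).+1.
Proof.
move=> h; rewrite /left_end lev_child// big_ord_recr/= dig_child// eqxx.
by congr (_ + _); apply: eq_bigr => i _; rewrite dig_child// ltn_eqF.
Qed.

Lemma cell_child s d : (d < br (lev s))%N -> cell (child s d) `<=` cell s.
Proof.
move=> h x; rewrite /cell /= !in_itv/= left_child// lev_child// => /andP[lx xr].
have l0 := ltW (len_gt0 (lev s).+1); apply/andP; split.
  by apply: le_trans lx; rewrite lerDl mulr_ge0.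
apply: (le_trans xr); rewrite -addrA lerD2l (lenE (lev s)).
by rewrite -[X in _ + X]mul1r -mulrDl ler_wpM2r// natr1 ler_nat.
Qed.

Lemma cell_split s x : cell s x -> exists2 d, (d < br (lev s))%N & cell (child s d) x.
Proof.
rewrite /cell /= in_itv/= => /andP[lx xr].
have l0 := len_gt0 (lev s).+1; pose y := (x - left_end s) / len (lev s).+1.
have xE : x = left_end s + y * len (lev s).+1 by rewrite divfK ?gt_eqF// addrC subrK.
have y0 : 0 <= y by rewrite divr_ge0 ?subr_ge0// ltW.
have yb : y <= (br (lev s))%:R.
  by rewrite ler_pdivrMr// -lenE lerBlDl.
have /andP[t1 t2] := truncn_itv y0.
suff [d db /andP[dy yd]] : exists2 d, (d < br (lev s))%N & d%:R <= y <= d.+1%:R.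
  exists d => //; rewrite /= in_itv/= left_child// lev_child// xE -addrA !lerD2l.
  rewrite !ler_wpM2r ?(ltW l0)//= -[X in _ <= _ + X]mul1r -mulrDl.
  by rewrite ler_wpM2r ?(ltW l0)// natr1.
have [tb|bt] := ltnP (Num.truncn y) (br (lev s)).
  by exists (Num.truncn y) => //; rewrite t1 ltW.
exists (br (lev s)).-1; first by rewrite prednK ?br_gt0.
rewrite prednK ?br_gt0// yb andbT (le_trans _ t1)// ler_nat (leq_trans _ bt)//.
exact: leq_pred.
Qed.

Lemma measurable_cell s : measurable (cell s).
Proof. by rewrite /cell; apply: measurable_itv. Qed.

Lemma mu_cell s : mu (cell s) = (len (lev s))%:E.
Proof.
rewrite /cell lebesgue_measure_itv/= lte_fin ltrDl len_gt0.
by rewrite -EFinB addrAC subrr add0r.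
Qed.


(** The reals below [s] having an expansion whose digit at place [lev s + r] lies in [S]. *)
Fixpoint hits S r s : set R :=
  \big[setU/set0]_(d < br (lev s))
    if r is r'.+1 then hits S r' (child s d)
    else if S (lev s) d then cell (child s d) else set0.

Lemma hits0 S s : hits S 0 s =
  \big[setU/set0]_(d < br (lev s)) if S (lev s) d then cell (child s d) else set0.
Proof. by []. Qed.

Lemma hitsS S r s :
  hits S r.+1 s = \big[setU/set0]_(d < br (lev s)) hits S r (child s d).
Proof. by []. Qed.

Lemma measurable_hits S r s : measurable (hits S r s).
Proof.
elim: r s => [|r IH] s /=; apply: bigsetU_measurable => d _ //.
by case: ifP => // _; exact: measurable_cell.
Qed.

Lemma mu_hits S r s : (mu (hits S r s) <= (len (lev s) * wt S (lev s + r))%:E)%E.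
Proof.
elim: r s => [|r IH] s.
  rewrite hits0; pose F d := if S (lev s) d then cell (child s d) else set0.
  have mF d : measurable (F d) by rewrite /F; case: ifP => // _; exact: measurable_cell.
  apply: (@le_trans _ _ (\sum_(d < br (lev s)) mu (F d))%E).
    apply: (@content_subadditive _ _ _ mu _ F) => //; first by move=> d _; exact: mF.
    by apply: bigsetU_measurable => d _; exact: mF.
  rewrite addn0 /wt (lenE (lev s)) mulrC mulrA divfK ?gt_eqF// mulr_suml -sumEFin.
  apply: lee_sum => d _; rewrite /F; case: ifP => _; last by rewrite measure0 mul0r.
  by rewrite mu_cell mul1r lev_child.
rewrite hitsS; pose F d := hits S r (child s d).
apply: (@le_trans _ _ (\sum_(d < br (lev s)) mu (F d))%E).
  apply: (@content_subadditive _ _ _ mu _ F) => //; first by move=> d _; exact: measurable_hits.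
  by apply: bigsetU_measurable => d _; exact: measurable_hits.
rewrite (lenE (lev s)) -mulrA mulrC.
have -> : len (lev s).+1 * wt S (lev s + r.+1) * (br (lev s))%:R =
   \sum_(d < br (lev s)) len (lev s).+1 * wt S (lev s + r.+1).
  by rewrite sumr_const card_ord mulr_natr.
rewrite -sumEFin; apply: lee_sum => d _; apply: (le_trans (IH _)).
by rewrite lev_child// addSnnS.
Qed.

Lemma mem_hits S r s t d x : desc s t -> lev t = (lev s + r)%N ->
  (d < br (lev t))%N -> S (lev t) d -> cell (child t d) x -> hits S r s x.
Proof.
have memU (F : nat -> set R) n k : (k < n)%N -> F k x -> (\big[setU/set0]_(i < n) F i) x.
  by move=> kn Fk; rewrite -bigcup_mkord; exists k.
move=> + + db Sd xt; elim: r s => [|r IH] s st lt.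
  move: lt; rewrite addn0 => lt.
  have ts : t = s by case: st => _ <-; rewrite trunc_id ?lt.
  rewrite hits0 -ts.
  apply: (@memU (fun d => if S (lev t) d then cell (child t d) else set0) _ d) => //.
  by rewrite Sd.
have sl : (lev s < lev t)%N by rewrite lt addnS ltnS leq_addr.
have db' := dig_lt sl.
rewrite hitsS; apply: (@memU (fun d => hits S r (child s d)) _ (dig t (lev s))) => //=.
have [_ st2] := st; rewrite -[in child s]st2 -truncS//.
apply: IH; first exact: desc_trunc.
by rewrite lt lev_trunc lt addnS (minn_idPl _)// ltnS leq_addr.
Qed.

Definition hits_often S : set R := lim_sup_set (fun n => hits S n root).

(** Borel-Cantelli: the reals hitting [S] at place [n] have measure at most [wt S n]. *)
Lemma hits_often_null S : slalom_summable (R := R) S -> null_ideal R (hits_often S).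
Proof.
move=> sS; exists (hits_often S); split=> //.
  apply: bigcapT_measurable => n; apply: bigcup_measurable => k _.
  exact: measurable_hits.
apply: lim_sup_set_cvg0 => [k|]; first exact: measurable_hits.
have [N hN] := sS 1 ltr01.
pose M : R := \sum_(0 <= i < N) wt S i + 1.
apply: (@le_lt_trans _ _ M%:E); last exact: ltry.
apply: lime_le; first by apply: is_cvg_nneseries.
near=> n; apply: (@le_trans _ _ (\sum_(0 <= i < n) (wt S i)%:E)%E).
  apply: lee_sum => i _; have := mu_hits S i root.
  by rewrite {1}/lev /= /len big_ord0 mul1r add0n.
rewrite sumEFin lee_fin /M.
have Nn : (N <= n)%N by near: n; exists N.
by rewrite (@big_cat_nat _ _ _ N)//= lerD2l.
Unshelve. all: by end_near. Qed.

End Cells.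

(** The estimate of a product of factors 1 - x_i by 1 / (1 + sum of the x_i), cleared of the
    denominator. It turns a positive lower bound on the product into a bound on the sum. *)
Lemma prod_1subr_le {R : realFieldType} (x : nat -> R) m n :
  (forall i, 0 <= x i <= 1) ->
  \prod_(m <= i < n) (1 - x i) * (1 + \sum_(m <= i < n) x i) <= 1.
Proof.
move=> x01; have [nm|/ltnW mn] := leqP n m; first by rewrite !big_geq// addr0 mulr1.
rewrite -(subnKC mn); elim: (n - m)%N => [|k IH].
  by rewrite addn0 !big_geq// addr0 mulr1.
rewrite addnS !big_nat_recr ?leq_addr//=; move: IH.
set P := \prod_(_ <= _ < _) _; set Q := \sum_(_ <= _ < _) _.
have P0 : 0 <= P by apply: prodr_ge0 => i _; rewrite subr_ge0; case/andP: (x01 i).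
have Q0 : 0 <= Q by apply: sumr_ge0 => i _; case/andP: (x01 i).
move: (x (m + k)%N) (x01 (m + k)%N) => y /andP[y0 _] IH.
apply: le_trans IH; rewrite -subr_ge0.
have -> : P * (1 + Q) - P * (1 - y) * (1 + (Q + y)) = P * y * (Q + y) by ring.
by rewrite mulr_ge0 ?mulr_ge0 ?addr_ge0.
Qed.

(** * Summable slaloms bounding all codes inside a null set *)

Section NullDominates.
Context {R : realType}.
Implicit Types (S T : slalom) (s t : node) (x : R).

Local Notation mu := (@lebesgue_measure R).

Lemma cell_desc s t : desc s t -> cell t `<=` (cell s : set R).
Proof.
move: {2}(lev t - lev s)%N (erefl (lev t - lev s)%N) => n.
elim: n t => [|n IH] t e [st ts].
  by rewrite -ts trunc_id//; lia.
have [sn tS] : (lev s <= (lev t).-1)%N /\ lev t = (lev t).-1.+1 by lia.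
have lt : lev (trunc (lev t).-1 t) = (lev t).-1 by rewrite lev_trunc; lia.
have d : ((lev t).-1 < lev t)%N by lia.
have tE : t = child (trunc (lev t).-1 t) (dig t (lev t).-1).
  by rewrite -truncS// trunc_id//; lia.
apply: (subset_trans _ (IH (trunc (lev t).-1 t) _ _)); first last.
- by split; rewrite ?lt// trunc_trunc.
- by rewrite lt; lia.
- by rewrite [X in cell X `<=` _]tE; apply: cell_child; rewrite lt dig_lt.
Qed.

(** Outer regularity encloses the null set in an open set of measure below 1, which cannot cover the
    root cell, the unit interval. *)
Lemma compact_avoiding_null (N : set R) : null_ideal R N ->
  exists C : set R, [/\ compact C, measurable C, C `&` N = set0 & (0 < mu (C `&` cell root))%E].
Proof.
move=> [A [mA A0 NA]].
have h2 : (0 : R) < 1 / 2 by lra.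
have [|U [oU AU Ue]] := lebesgue_regularity_outer mA _ h2.
  by rewrite [X in (X < _)%E]A0 ltry.
have mU : measurable U by exact: measurable_realfun.open_measurable.
have mUA : measurable (U `\` A) by exact: measurableD.
have U1 : (mu U < 1)%E.
  rewrite -(setDUK AU) setUC.
  apply: (@le_lt_trans _ _ (mu (U `\` A) + mu A)%E); first exact: measureU2.
  have -> : mu A = 0%E := A0.
  rewrite adde0; apply: (lt_trans Ue); rewrite lte_fin; lra.
have mI : measurable (cell root : set R) by exact: measurable_cell.
exists (cell root `\` U); split.
- apply: (@subclosed_compact _ _ (cell root)).
  + by rewrite setDE; apply: closedI; [exact: interval_closed|exact: open_closedC].
  + exact: segment_compact.
  + exact: subDsetl.
- exact: measurableD.
- by apply/seteqP; split=> // x [[_ Ux] /NA/AU].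
rewrite (setIidl (@subDsetl _ _ _)) lt_neqAle measure_ge0 andbT eq_sym.
apply/eqP => C0; have : (mu (cell root) <= mu (cell root `\` U) + mu U)%E.
  apply: (@le_trans _ _ (mu ((cell root `\` U) `|` U))); last first.
    by apply: measureU2 => //; exact: measurableD.
  apply: le_measure; rewrite ?inE//; first by apply: measurableU => //; exact: measurableD.
  by move=> x Ix; have [|] := pselect (U x); [right|left].
rewrite C0 add0e mu_cell {1}/lev /= /len big_ord0 leNgt.
by rewrite U1.
Qed.

Section KilledDigits.
Variable C : set R.
Hypothesis mC : measurable C.

Definition heavy s := (0 < mu (C `&` cell s))%E.

Let g s : R := fine (mu (C `&` cell s)).

Let mCs s : measurable (C `&` cell s).
Proof. by apply: measurableI => //; exact: measurable_cell. Qed.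

Let gE s : mu (C `&` cell s) = (g s)%:E.
Proof.
rewrite fineK// ge0_fin_numE// (@le_lt_trans _ _ (mu (cell s)))//; last by rewrite mu_cell ltry.
by apply: le_measure; rewrite ?inE//; [exact: mCs|exact: measurable_cell].
Qed.

Let g_ge0 s : 0 <= g s.
Proof. by rewrite -lee_fin -gE measure_ge0. Qed.

Let heavyE s : heavy s <-> 0 < g s.
Proof. by rewrite /heavy gE lte_fin. Qed.

Let g_le s : g s <= len (lev s).
Proof.
rewrite -lee_fin -gE -mu_cell; apply: le_measure; rewrite ?inE//.
  exact: mCs.
exact: measurable_cell.
Qed.

Let g_child s : g s <= \sum_(d < br (lev s)) g (child s d).
Proof.
rewrite -lee_fin -gE -sumEFin; pose F d := C `&` cell (child s d).
apply: (@le_trans _ _ (\sum_(d < br (lev s)) mu (F d))%E).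
  apply: (@content_subadditive _ _ _ mu _ F); [by move=> d _; exact: mCs|exact: mCs|].
  move=> x [Cx /cell_split[d db dx]]; rewrite -bigcup_mkord.
  by exists d.
by apply: lee_sum => d _; rewrite -gE.
Qed.

Definition light_digits s : slalom := fun n d =>
  (lev s <= n)%N && `[< ~ exists t, [/\ desc s t, lev t = n & heavy (child t d)] >].

Let wt_le1 S n : wt S n <= 1 :> R.
Proof.
rewrite /wt ler_pdivrMr ?ltr0n ?br_gt0// mul1r.
apply: (@le_trans _ _ (\sum_(d < br n) 1)); first by apply: ler_sum => d _; rewrite lern1 leq_b1.
by rewrite sumr_const card_ord.
Qed.

Let g_prod s r t : desc s t ->
  g t <= len (lev t) * \prod_(lev t <= i < lev t + r) (1 - wt (light_digits s) i).
Proof.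
elim: r t => [|r IH] t st; first by rewrite addn0 big_geq// mulr1.
set T := light_digits s.
rewrite big_ltn ?addnS ?ltnS ?leq_addr//.
set P := \prod_(_ <= _ < _) _; have P0 : 0 <= P by apply: prodr_ge0 => i _; rewrite subr_ge0.
apply: (le_trans (g_child t)).
apply: (@le_trans _ _ (\sum_(d < br (lev t)) (1 - (T (lev t) d)%:R) * (len (lev t).+1 * P))).
  apply: ler_sum => d _; have := ltn_ord d => db.
  have ld : 0 <= len (lev t).+1 * P by rewrite mulr_ge0// ltW// len_gt0.
  have [h|nh] := pselect (heavy (child t d)); last first.
    have : g (child t d) <= 0 by rewrite leNgt; apply/negP => /heavyE.
    by move=> /le_trans; apply; rewrite mulr_ge0// subr_ge0 lern1 leq_b1.
  have -> : T (lev t) d = false.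
    by apply/negbTE/nandP; right; apply/asboolP; apply; exists t.
  rewrite subr0 mul1r; have := IH (child t d); rewrite lev_child// addSn; apply.
  by apply: desc_trans st _; exact: desc_child.
rewrite -mulr_suml sumrB sumr_const card_ord (lenE (lev t)).
rewrite le_eqVlt; apply/orP; left; apply/eqP.
have b0 : (br (lev t))%:R != 0 :> R by rewrite pnatr_eq0 -lt0n br_gt0.
rewrite /wt -/T; move: (\sum_(d < br (lev t)) _) => Q; field.
by [].
Qed.

(** With [P] the product and [Q] the sum of weights, [g s <= len (lev s) * P] and [P * (1 + Q) <= 1]
    give [Q * g s <= len (lev s)]. *)
Lemma light_digits_summable s : heavy s -> slalom_summable (R := R) (light_digits s).
Proof.
move=> /heavyE gs0; apply: (@summable_bounded _ _ (lev s) (len (lev s) / g s)) => n.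
have l0 := @len_gt0 R (lev s).
have [nl|/ltnW ln] := leqP n (lev s); first by rewrite big_geq// divr_ge0 ?ltW.
set Q := \sum_(_ <= _ < _) _.
have Q0 : 0 <= Q by apply: sumr_ge0 => i _; exact: wt_ge0.
have := g_prod (n - lev s) (desc_refl s); rewrite subnKC//.
have := @prod_1subr_le R (wt (light_digits s)) (lev s) n.
rewrite -/Q; set P := \prod_(_ <= _ < _) _.
move=> /(_ (fun i => _)) PQ gP; rewrite ler_pdivlMr//.
apply: (@le_trans _ _ (Q * (len (lev s) * P))); first by rewrite ler_wpM2l.
rewrite mulrCA ger_pMr// (le_trans _ (PQ _))//; last by move=> i; rewrite wt_ge0 wt_le1.
have P0 : 0 <= P by apply: prodr_ge0 => i _; rewrite subr_ge0.
by rewrite mulrC ler_wpM2l// lerDr.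
Qed.

(** Below any heavy node some digit of [S] is not light, hence is the last digit of a further heavy
    node. Iteration yields a branch of heavy cells, and compactness a point of [C] in all of them,
    which hits [S] infinitely often. *)
Lemma hits_often_light S : compact C -> heavy root ->
  (forall s, heavy s -> ~ almost_sub S (light_digits s)) ->
  C `&` hits_often S !=set0.
Proof.
move=> cC hr nS.
have /choice[f hf] (s : node) : exists s', heavy s -> [/\ heavy s', desc s s' &
    exists t d, [/\ s' = child t d, (d < br (lev t))%N, (lev s <= lev t)%N & S (lev t) d]].
  have [hs|nhs] := pselect (heavy s); last by exists s.
  have : exists n d, [/\ (lev s <= n)%N, (d < br n)%N, S n d & ~~ light_digits s n d].
    apply: contrapT => nex; apply: (nS _ hs); exists (lev s) => n d sn db Sd.
    by apply/negPn/negP => nl; apply: nex; exists n, d.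
  move=> [n [d [sn db Sd]]]; rewrite /light_digits sn/= => /asboolP/contrapT[t [st tn ht]].
  exists (child t d) => _; subst n; split=> //; last by exists t, d.
  by apply: desc_trans st _; exact: desc_child.
pose s_ i := iter i f root.
have hs i : heavy (s_ i) by elim: i => // i IH; have [] := hf _ IH.
have sS i := hf _ (hs i).
have si i : (i <= lev (s_ i))%N.
  elim: i => // i IH; have [_ _ [t [d [e db st _]]]] := sS i.
  by rewrite /s_ iterS -/(s_ i) e lev_child// ltnS (leq_trans IH).
have sdesc i j : (i <= j)%N -> desc (s_ i) (s_ j).
  move=> /subnKC <-; elim: (j - i)%N => [|k IH]; first by rewrite addn0; exact: desc_refl.
  rewrite addnS; apply: desc_trans IH _; by have [] := sS (i + k)%N.
have /choice[c hc] i : exists x, (C `&` cell (s_ i)) x.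
  apply/set0P/eqP => e; have := hs i; rewrite /heavy e measure0; by rewrite ltxx.
have [|x [Cx xc]] := cC (c @ \oo) _; first by exists 0%N => // i _; exact: (hc i).1.
exists x; split=> // n _ /=.
have xs i : cell (s_ i) x.
  have cl : closed (cell (s_ i) : set R) by exact: interval_closed.
  apply: cl => B Bx; apply: xc => //.
  by exists i => // j /= ij; apply: (cell_desc (sdesc _ _ ij)); exact: (hc j).2.
have [_ _ [t [d [e db st Sd]]]] := sS n.
exists (lev t); first exact: leq_trans (si n) st.
apply: (@mem_hits _ _ _ _ t d) => //; first by split; rewrite ?trunc0.
by rewrite -e; exact: (xs n.+1).
Qed.

End KilledDigits.

Lemma null_dominates (N : set R) : null_ideal R N ->
  exists2 T, slalom_summable (R := R) T &
    forall S, hits_often S `<=` N -> almost_sub S T.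
Proof.
move=> /compact_avoiding_null[C [cC mC CN hr]].
have [e _ eS] := node_enum.
(* Nodes that are not heavy contribute the empty slalom. *)
pose T_ j := if `[< heavy C (e j) >] then light_digits C (e j) else (fun _ _ => false).
have [|T sT TT] := @dominate_countable R T_.
  move=> j; rewrite /T_; case: asboolP => [h|_]; first exact: light_digits_summable.
  apply: (@summable_bounded _ _ 0 0) => n; rewrite big1// => i _.
  by rewrite /wt big1 ?mul0r.
exists T => // S SN; apply: contrapT => nST.
have [s hs|x [Cx Sx]] := @hits_often_light C S cC hr.
  move=> [k hk]; apply: nST; have [j ej] := eS s; have [k' hk'] := TT j.
  exists (maxn k k') => n d; rewrite geq_max => /andP[kn k'n] db Sd.
  apply: hk' => //; rewrite /T_ ej asboolT//; exact: hk.
have : (C `&` N) x by split=> //; exact: SN.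
by rewrite CN.
Qed.

End NullDominates.

(** * Infinitely often equal codes and meager sets *)

Lemma nowhere_dense_sub (T : topologicalType) (A B : set T) :
  A `<=` B -> nowhere_dense B -> nowhere_dense A.
Proof.
move=> AB nB; apply/seteqP; split=> // x Ax.
have : interior (closure B) x by apply: interiorS Ax; exact: closure_subset.
by rewrite nB.
Qed.

Section MeagerCode.
Context {R : realType}.

(** Each interval between consecutive multiples of [1 / n.+1] is cut into [br n] equal parts, and
    the code is the number of the part. The factor [n.+1] makes every code value occur arbitrarily
    close to any real as [n] grows. *)
Definition code n (y : R) : nat :=
  `|(Num.floor (y * (br n * n.+1)%:R) %% (br n)%:Z)%Z|%N.

Lemma eventually_different_nowhere_dense (x : nat -> nat) N :
  (forall n, (x n < br n)%N) ->
  nowhere_dense [set y | forall n, (N <= n)%N -> code n y != x n].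
Proof.
move=> xb; set A := [set _ | _]; apply/seteqP; split=> // z.
rewrite /interior /= => /nbhs_ballP[e e0 ze].
have [n [Nn ne]] : exists n, (N <= n)%N /\ n.+1%:R^-1 < e.
  exists (maxn N (Num.truncn e^-1)); split; first exact: leq_maxl.
  rewrite invf_plt ?posrE ?ltr0n//.
  apply: (@lt_le_trans _ _ (Num.truncn e^-1).+1%:R); first exact: truncnS_gt.
  by rewrite ler_nat ltnS leq_maxr.
pose b : R := (br n)%:R; pose k : R := n.+1%:R.
have b0 : 0 < b by rewrite ltr0n br_gt0.
have k0 : 0 < k by rewrite ltr0n.
have cE : (br n * n.+1)%:R = b * k by rewrite natrM.
pose q := Num.floor (z * k).
(* In the interval of length [1 / n.+1] containing [z], [m] indexes the part with code [x n], and
   [y] is the midpoint of that part. *)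
pose m : int := (q * (br n)%:Z + (x n)%:Z)%R.
have mE : m%:~R = q%:~R * b + (x n)%:R :> R by rewrite intrD intrM.
have := floor_itv (z * k); rewrite -/q => /andP[qz zq].
rewrite intrD in zq.
have xb' : (x n)%:R + 1 <= b by rewrite natr1 ler_nat.
have x0 : 0 <= (x n)%:R :> R by [].
pose y : R := (m%:~R + 2^-1) / (b * k).
have bk0 : 0 < b * k by rewrite mulr_gt0.
have : ball z e y.
  rewrite /ball /= distrC; apply: le_lt_trans ne.
  have -> : y - z = (m%:~R + 2^-1 - z * k * b) / (b * k).
    by rewrite /y; field; rewrite !gt_eqF.
  rewrite normrM normfV (gtr0_norm bk0) ler_pdivrMr// mulrCA mulVf ?gt_eqF// mulr1.
  rewrite mE ler_norml; apply/andP; split; nra.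
move=> /ze; pose I : set R := `](m%:~R / (b * k)), ((m%:~R + 1) / (b * k))[%classic.
have oI : open I by exact: interval_open.
have Iy : I y.
  rewrite /I /= in_itv/= /y; apply/andP.
  by split; rewrite ltr_pM2r ?invr_gt0//; lra.
move=> /(_ I)[|t [At]]; first exact: open_nbhs_nbhs.
rewrite /I /= in_itv/= ltr_pdivrMr// ltr_pdivlMr// => /andP[mt tm].
have ft : Num.floor (t * (br n * n.+1)%:R) = m.
  by apply: floor_def; rewrite cE intrD ltW.
have := At n Nn; rewrite /code ft /m modzMDl modz_small ?absz_nat ?eqxx//.
by rewrite ltz_nat xb.
Qed.

(** Otherwise every [y] in [Y] eventually differs from some [x i], and countably many pairs [(i, N)]
    cover [Y] by nowhere dense sets. *)
Lemma nonmeager_catches (Y : set R) (x : nat -> nat -> nat) :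
  ~ meager_ideal R Y -> (forall i n, (x i n < br n)%N) ->
  exists2 y, Y y & forall i N, exists2 n, (N <= n)%N & code n y = x i n.
Proof.
move=> nY xb; apply: contrapT => nex; apply: nY.
(* The intersection with [Y] makes the union equal to [Y], as [meager_ideal] demands; numbers coding
   no pair give the empty set. *)
pose F k : set R := if unpickle k is Some (i, N) then
  Y `&` [set y | forall n, (N <= n)%N -> code n y != x i n] else set0.
exists F.
  move=> k; rewrite /F; case: unpickle => [[i N]|].
    by apply: nowhere_dense_sub (@subIsetr _ _ _) _; exact: eventually_different_nowhere_dense.
  by rewrite /nowhere_dense closure0 interior0.
apply/seteqP; split=> [y Yy|y [k _]]; last by rewrite /F; case: unpickle => [[i N] []|].
apply: contrapT => nF; apply: nex; exists y => // i N; apply: contrapT => nn; apply: nF.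
exists (pickle (i, N)) => //; rewrite /F pickleK; split=> // n Nn.
by apply/eqP => e; apply: nn; exists n.
Qed.

End MeagerCode.

(** * Towers of slaloms *)

(** An initial ordinal obtained without cardinals: well-order [A] and keep the points with fewer
    than [|A|] predecessors. If a point is lost, all predecessors of the least lost one are kept,
    and they are already as many as [A]. *)
Lemma short_well_order (X : Type) (A : set X) :
  exists (W : Type) (lt : W -> W -> Prop),
    [/\ well_founded lt,
        forall P : set W, P !=set0 ->
          exists2 w, P w & forall v, P v -> v = w \/ lt w v,
        forall w, ~ (A #<= [set v | lt v w])%card &
        (A #<= [set: W])%card].
Proof.
pose T : eqType := {classic set_type A}.
have [le wo] := wochoice.well_ordering_principle T.
have wc : wochoice.wo_chain le predT by move=> B _; exact: wo.
have lr x : le x x by exact: (wochoice.wo_chain_reflexive wc).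
have la x y : le x y -> le y x -> x = y.
  by move=> xy yx; apply: (wochoice.wo_chain_antisymmetric wc) => //; rewrite xy.
have least (P : set T) : P !=set0 -> exists2 w, P w & forall v, P v -> le w v.
  move=> [x Px]; have [|w [[/asboolP Pw wmin] _]] := wo [pred v | `[< P v >]].
    by exists x; apply/asboolP.
  by exists w => // v Pv; apply: wmin; apply/asboolP.
pose below w := [set v | le v w /\ v <> w].
pose D : set T := [set w | ~ (A #<= below w)%card].
have AD : (A #<= D)%card.
  have [bad|nbad] := pselect ((~` D) !=set0).
    have [w /contrapT Aw wmin] := least _ bad.
    apply: card_le_trans Aw _; apply: subset_card_le => v [vw nvw] /= Av.
    by apply: nvw; apply: la => //; apply: wmin; rewrite /= notK.
  have -> : D = [set: T].
    by apply/seteqP; split=> // v _; apply: contrapT => nD; apply: nbad; exists v.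
  by have := card_setT_sym A; rewrite card_eq_le => /andP[].
pose lt (v w : set_type D) := le (val v) (val w) /\ val v <> val w.
have leastD (P : set (set_type D)) : P !=set0 ->
    exists2 w, P w & forall v, P v -> v = w \/ lt w v.
  move=> [x Px]; have [|_ [w Pw <-] wmin] := least (val @` P); first by exists (val x), x.
  exists w => // v Pv; have [->|vw] := pselect (v = w); [by left|right].
  split; first by apply: wmin; exists v.
  by move=> /val_inj e; apply: vw.
exists (set_type D), lt; split; [|exact: leastD| |].
- move=> w; apply: contrapT => nw.
  have [z nz zmin] := leastD [set w | ~ Acc lt w] (ex_intro _ w nw).
  apply: nz; split=> v [vz nvz]; apply: contrapT => /zmin[e|[zv nzv]].
    by apply: nvz; rewrite e.
  by apply: nvz; exact: la.
- move=> w Aw; apply: (set_mem (valP w)); apply: card_le_trans Aw _.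
  have vi : {in [set v | lt v w] &, injective (val : set_type D -> T)}.
    by move=> x y _ _; exact: val_inj.
  rewrite -(card_le_eql (inj_card_eq vi)); apply: subset_card_le => _ [v vw <-].
  exact: vw.
- apply: card_le_trans AD _; by have := card_setT_sym D; rewrite card_eq_le => /andP[].
Qed.

Lemma almost_sub_trans S1 S2 S3 :
  almost_sub S1 S2 -> almost_sub S2 S3 -> almost_sub S1 S3.
Proof.
move=> [N h] [M k]; exists (maxn N M) => n d; rewrite geq_max => /andP[Nn Mn] db Sd.
exact/k/h.
Qed.

Lemma list_slalom_summable (R : realType) (G : nat -> seq nat) :
  (forall n, (size (G n) <= n.+1)%N) ->
  slalom_summable (R := R) (fun n d => d \in G n).
Proof.
move=> hG; apply: (@summable_bounded _ _ 0 2) => M.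
apply: (@le_trans _ _ (2 * \sum_(0 <= n < M) 2^-1 ^+ n.+1)); last first.
  by rewrite -[leRHS]mulr1 ler_wpM2l// sum_half_le.
rewrite mulr_sumr; apply: ler_sum => n _.
rewrite exprS mulrA mulfV// mul1r /wt ler_pdivrMr ?ltr0n ?br_gt0//.
apply: (@le_trans _ _ (size (G n))%:R).
  elim: (G n) => [|a s IH]; first by rewrite big1.
  apply: (@le_trans _ _ (\sum_(d < br n) (((d : nat) == a)%:R + ((d : nat) \in s)%:R) : R)).
    by apply: ler_sum => d _; rewrite inE; case: eqP; case: (_ \in _); rewrite ?addr0 ?add0r ?lerDl.
  rewrite big_split/= -natr1 addrC lerD//.
  have [ab|ba] := ltnP a (br n); last first.
    by rewrite big1// => d _; rewrite ltn_eqF// (leq_trans (ltn_ord d)).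
  rewrite (bigD1 (Ordinal ab))//= eqxx big1 ?addr0// => d.
  by rewrite -val_eqE => /= /negbTE ->.
apply: (@le_trans _ _ n.+1%:R); first by rewrite ler_nat.
rewrite /br natrX (_ : 4%:R = 2 * 2); last by rewrite -natrM.
rewrite exprMn mulrA -exprMn mulVf// expr1n mul1r -natrX ler_nat.
exact: ltn_expl.
Qed.

(** Recursion needs a total choice function, whereas [step] works only over good predecessors. The
    junk value [a0] fills the other cases, and induction shows that they never arise. *)
Lemma well_founded_family (W A : Type) (a0 : A) (lt : W -> W -> Prop)
    (dom : W -> (W -> A) -> A -> Prop) (good : W -> A -> Prop) :
  well_founded lt ->
  (forall w p q a, (forall v, lt v w -> p v = q v) -> dom w p a -> dom w q a) ->
  (forall w p, (forall v, lt v w -> good v (p v)) -> exists2 a, good w a & dom w p a) ->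
  exists S : W -> A, forall w, good w (S w) /\ dom w S (S w).
Proof.
move=> wf ext step.
have /choice[f hf] (wp : W * (W -> A)) : exists a,
    (forall v, lt v wp.1 -> good v (wp.2 v)) -> good wp.1 a /\ dom wp.1 wp.2 a.
  have [/step[a ga da]|nh] := pselect (forall v, lt v wp.1 -> good v (wp.2 v)).
    by exists a.
  by exists a0.
pose restr w (p : forall v, lt v w -> A) v :=
  if pselect (lt v w) is left h then p v h else a0.
pose S := Fix wf (fun=> A) (fun w p => f (w, restr w p)).
have SE w : S w = f (w, restr w (fun v _ => S v)).
  rewrite /S Fix_eq// => x p q pq; congr (f (x, _)); apply/funext => v.
  by rewrite /restr; case: pselect.
have rE w v : lt v w -> restr w (fun v _ => S v) v = S v.
  by rewrite /restr; case: pselect.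
exists S; apply: (well_founded_ind wf) => w IH.
have [v vw|gw dw] := hf (w, restr w (fun v _ => S v)).
  by rewrite /= rE//; exact: (IH v vw).1.
by rewrite -SE in gw dw; split=> //; apply: ext dw; exact: rE.
Qed.

(** The null sets coded by the earlier slaloms have a null union, by the hypothesis on initial
    segments, so [null_dominates] bounds them all at once. *)
Lemma domination_tower (R : realType) (W : Type) (lt : W -> W -> Prop) (E : W -> slalom) :
  well_founded lt -> (forall w, slalom_summable (R := R) (E w)) ->
  (forall w (F : W -> set R), (forall v, lt v w -> null_ideal R (F v)) ->
    null_ideal R (\bigcup_(v in [set v | lt v w]) F v)) ->
  exists S : W -> slalom, forall w, [/\ slalom_summable (R := R) (S w),
    almost_sub (E w) (S w) & forall v, lt v w -> almost_sub (S v) (S w)].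
Proof.
move=> wf sE nullU.
have [|||S hS] := @well_founded_family W slalom (fun _ _ => false) lt
    (fun w p T => forall v, lt v w -> almost_sub (p v) T)
    (fun w T => slalom_summable (R := R) T /\ almost_sub (E w) T); [by []| | |]; last first.
- by exists S => w; have [[]] := hS w.
- move=> w p sp.
  have := nullU w (fun v => hits_often (p v)) (fun v vw => hits_often_null (sp v vw).1).
  move=> /null_dominates[T sT hT].
  (* Joins the bound [T] with the prescribed [E w], as a sequence constant from 1 on. *)
  have [|T' sT' hT'] := @dominate_countable R (fun j => if j is 0%N then T else E w).
    by case.
  exists T'; first by split=> //; exact: (hT' 1%N).
  move=> v vw; apply: almost_sub_trans (hT' 0%N); apply: hT.
  by move=> x ?; exists v.
- move=> w p q T pq h v vw; rewrite -pq//; exact: h.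
Qed.

(** * The two compactifications *)

Theorem corollary5p15 (R : realType) :
  (exists (L : compactHausdorffType) (e : nat -> L),
     [/\ is_compactification e,
         ~ separable (set_type (remainder e)),
         supports_measure R (set_type (remainder e)) &
         complemented (natural_c0 e R)]) /\
  (add_eq_non (null_ideal R) (meager_ideal R) ->
   exists (L : compactHausdorffType) (e : nat -> L),
     [/\ is_compactification e,
         ~ separable (set_type (remainder e)),
         supports_measure R (set_type (remainder e)) &
         complemented (natural_c0 e R)] /\
     (forall (W : Type) (le : rel W), is_omega1 le ->
        ~ maps_onto_cube R (set_type (remainder e)) W) /\
     hereditarily_separably_Sobczyk (Cspace R L)).
Proof.
have [en en_inj en_surj] := node_enum.
split=> [|[A [Y [[AN nA Amin] [nY _] AY]]]].
  pose W : eqType := {classic {S : slalom | slalom_summable (R := R) S}}.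
  pose S (w : W) : slalom := sval w.
  have sS w : slalom_summable (R := R) (S w) by exact: svalP.
  exists (stone (tree_sets S)), (emb (tree_sets S) \o en); split.
  - exact: slalom_compactification.
  - apply: (slalom_nonseparable sS en_surj) => x xb.
    have sT : slalom_summable (R := R) (fun n d => d \in [seq x i n | i <- iota 0 n.+1]).
      by apply: list_slalom_summable => n; rewrite size_map size_iota.
    exists (exist _ _ sT) => i N.
    (* From level [i] on, the digit of branch [i] is among the [n.+1] listed ones. *)
    exists (maxn i N); first exact: leq_maxr.
    have : x i (maxn i N) \in [seq x j (maxn i N) | j <- iota 0 (maxn i N).+1].
      by apply: (map_f (fun j => x j _)); rewrite mem_iota ltnS leq_maxl.
    exact.
  - exact: slalom_supports_measure.
  - exact: slalom_complemented.
have [W0 [lt [wf least small large]]] := short_well_order A.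
have Y0 : Y <> set0.
  move=> Y0; apply: nY; exists (fun=> set0); last by rewrite bigcup0.
  by move=> _; rewrite /nowhere_dense closure0 interior0.
(* [W0] is at least as large as [A], hence as [Y], so the non-meager set can be listed along the
   tower. *)
have /pfcard_geP[//|[y]] : (Y #<= [set: W0])%card by rewrite -(card_le_eql AY).
pose E w : slalom := fun n d => d \in [:: code n (y w)].
have sE w : slalom_summable (R := R) (E w) by exact: list_slalom_summable.
(* An initial segment is smaller than [A], so by the minimality of [A] the null sets indexed by it
   have a null union. *)
have [w F F0|S hS] := @domination_tower R W0 lt E wf sE _.
  apply: contrapT => nF; apply: (small w).
  apply: card_le_trans (card_image_le F [set v | lt v w]).
  by apply: Amin; [move=> _ [v vw <-]; exact: F0|rewrite bigcup_image].
pose W : eqType := {classic W0}; pose S' : W -> slalom := S.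
have sS (w : W) : slalom_summable (R := R) (S' w) by have [] := hS w.
have wo (P : set W) : P !=set0 ->
    exists2 w, P w & forall v, P v -> almost_sub (S' w) (S' v).
  move=> /least[w Pw wmin]; exists w => // v /wmin[->|wv]; first by exists 0%N.
  by have [_ _] := hS v; exact.
have chain (v w : W) : almost_sub (S' v) (S' w) \/ almost_sub (S' w) (S' v).
  have [|u [->|->] h] := wo [set u | u = v \/ u = w]; first by exists v; left.
    by left; apply: h; right.
  by right; apply: h; left.
exists (stone (tree_sets S')), (emb (tree_sets S') \o en); split; [split| split].
- exact: slalom_compactification.
- apply: (slalom_nonseparable sS en_surj) => x xb.
  have [_ /(@surj _ _ _ _ y)[w _ <-] hw] := nonmeager_catches nY xb.
  exists w => i N; have [_ [M hM] _] := hS w.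
  have [n] := hw i (maxn N M); rewrite geq_max => /andP[Nn Mn] e.
  by exists n => //; apply: hM => //; rewrite /E inE e.
- exact: slalom_supports_measure.
- exact: slalom_complemented.
- by move=> J le [_ cJ _]; apply: slalom_no_cube.
- by apply: sequentially_compact_Sobczyk; exact: slalom_sequentially_compact.
Qed.
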